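(* Let $\Omega$ be a bounded Reinhardt domain in $\mathbb{C}^n$ and let $\phi_1,\ldots,\phi_m$ be functions on $\Omega$ each of which is a finite sum of bounded quasi-homogeneous functions on $\Omega$. Assume that the product of Toeplitz operators $T_{\phi_m}\cdots T_{\phi_1}$ is the zero operator on the Bergman space $A^2(\Omega)$. Then $\phi_j=0$ for some $j\in\{1,\ldots,m\}$.
   Context: A domain $\Omega\subset\mathbb{C}^n$ is a (nonempty) connected open set. It is called Reinhardt if $(e^{i\theta_1}z_1,\ldots,e^{i\theta_n}z_n)\in\Omega$ whenever $(z_1,\ldots,z_n)\in\Omega$ and $\theta_1,\ldots,\theta_n\in\mathbb{R}$. $A^2(\Omega)$ denotes the Bergman space, i.e. the closed subspace of $L^2(\Omega)$ (Lebesgue measure) consisting of square integrable holomorphic functions on $\Omega$, and $P:L^2(\Omega)\to A^2(\Omega)$ is the orthogonal projection (Bergman projection). For $\phi\in L^\infty(\Omega)$ the Toeplitz operator $T_\phi$ on $A^2(\Omega)$ is $T_\phi f=P(\phi f)$ for $f\in A^2(\Omega)$. A function $\phi$ on $\Omega$ is called (separately) quasi-homogeneous if there exist $f:[0,\infty)^n\to\mathbb{C}$ and $(k_1,\ldots,k_n)\in\mathbb{Z}^n$ such that $\phi(r_1e^{i\theta_1},\ldots,r_ne^{i\theta_n})=f(r_1,\ldots,r_n)e^{i(k_1\theta_1+\cdots+k_n\theta_n)}$ for all points $(r_1e^{i\theta_1},\ldots,r_ne^{i\theta_n})\in\Omega$ with $r_j\ge 0$, $\theta_j\in\mathbb{R}$.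 Different summands of a finite sum of quasi-homogeneous functions may have different $(k_1,\ldots,k_n)$. Symbols of Toeplitz operators are elements of $L^\infty(\Omega)$: bounded quasi-homogeneous functions are understood to be measurable, and $\phi_j=0$ means equality in $L^\infty(\Omega)$, i.e. almost everywhere. *)

(* Defs.v *)
From HB Require Import structures.
From mathcomp Require Import all_boot all_order all_algebra.
From mathcomp Require Import complex.
From mathcomp Require Import all_classical all_reals all_analysis.

Set Implicit Arguments.
Unset Strict Implicit.
Unset Printing Implicit Defensive.

Import Order.TTheory GRing.Theory Num.Theory.
Import numFieldNormedType.Exports.

Local Open Scope classical_set_scope.
Local Open Scope ring_scope.
Local Open Scope complex_scope.

(* The standard topology and norm of R[i], seen as a normed module over itself;
   the library declares them for variables of type numClosedFieldType only.
   Consequently 'rV[R[i]]_n is a normed module over R[i] (sup norm), and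
   [differentiable] for functions on it means complex differentiable. *)
#[export, non_forgetful_inheritance]
HB.instance Definition _ (R : realType) := PseudoPointedMetric.copy R[i] R[i]^o.
#[export, non_forgetful_inheritance]
HB.instance Definition _ (R : realType) := NormedModule.copy R[i] R[i]^o.

Definition complex_display : measure_display.
Proof. exact: default_measure_display. Qed.

Section measurable_complex.
Variable R : realType.

(* R[i] carries the sigma-algebra transported from R * R, i.e. the Borel one. *)
Definition complex_measurable : set (set R[i]) :=
  g_sigma_preimageU (@complex.Re R) (@complex.Im R).

Let complex_measurable0 : complex_measurable set0.
Proof. exact: sigma_algebra0. Qed.

Let complex_measurableC A : complex_measurable A -> complex_measurable (~` A).
Proof. exact: sigma_algebraC. Qed.

Let complex_measurable_bigcup (F : (set R[i])^nat) :
  (forall i, complex_measurable (F i)) -> complex_measurable (\bigcup_i F i).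
Proof. exact: sigma_algebra_bigcup. Qed.

HB.instance Definition _ := @isMeasurable.Build complex_display R[i]
  complex_measurable complex_measurable0 complex_measurableC
  complex_measurable_bigcup.

End measurable_complex.

Definition matrix_display : measure_display -> measure_display.
Proof. exact. Qed.

Section measurable_matrix.
Context {d} {T : measurableType d}.
Variables m n : nat.

(* The product sigma-algebra on the entries; for T = R[i] it is the Borel
   sigma-algebra. *)
Definition matrix_measurable : set (set 'M[T]_(m, n)) :=
  <<s \bigcup_ij preimage_set_system setT
        (fun A : 'M[T]_(m, n) => A ij.1 ij.2) measurable >>.

Let matrix_measurable0 : matrix_measurable set0.
Proof. exact: sigma_algebra0. Qed.

Let matrix_measurableC A : matrix_measurable A -> matrix_measurable (~` A).
Proof. exact: sigma_algebraC. Qed.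

Let matrix_measurable_bigcup (F : (set 'M[T]_(m, n))^nat) :
  (forall i, matrix_measurable (F i)) -> matrix_measurable (\bigcup_i F i).
Proof. exact: sigma_algebra_bigcup. Qed.

HB.instance Definition _ := @isMeasurable.Build (matrix_display d) 'M[T]_(m, n)
  matrix_measurable matrix_measurable0 matrix_measurableC
  matrix_measurable_bigcup.

End measurable_matrix.

Lemma measurable_fun_complex d (T : measurableType d) (R : realType)
    (f g : T -> R) : measurable_fun setT f -> measurable_fun setT g ->
  measurable_fun setT (fun x => f x +i* g x).
Proof.
move=> mf mg; apply: measurability => // _ [B [] [C mC <-] <-]; rewrite !setTI.
  by rewrite -[X in measurable X]setTI; exact: mf.
by rewrite -[X in measurable X]setTI; exact: mg.
Qed.

Lemma measurable_fun_matrix d d' (T : measurableType d) (U : measurableType d')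
    m n (f : T -> 'M[U]_(m, n)) :
  (forall i j, measurable_fun setT (fun x => f x i j)) -> measurable_fun setT f.
Proof.
move=> mf; apply: measurability => // _ [B [[i j] _ [C mC <-]] <-].
by rewrite !setTI -[X in measurable X]setTI; exact: mf.
Qed.

Lemma measurable_entry d (T : measurableType d) m n i j :
  measurable_fun setT (fun A : 'M[T]_(m, n) => A i j).
Proof.
move=> _ A mA; rewrite setTI; apply: sub_sigma_algebra.
by exists (i, j) => //; exists A => //; rewrite setTI.
Qed.

Section lebesgue.
Variable R : realType.

Definition add_coord n (p : 'rV[R[i]]_n * R * R) : 'rV[R[i]]_n.+1 :=
  \row_j oapp (p.1.1 ord0) (p.1.2 +i* p.2) (unlift ord0 j).

Lemma measurable_add_coord n : measurable_fun setT (@add_coord n).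
Proof.
apply: measurable_fun_matrix => i j.
apply: (@eq_measurable_fun _ _ _ _ setT
  (fun p : 'rV[R[i]]_n * R * R =>
     oapp (p.1.1 ord0) (p.1.2 +i* p.2) (unlift ord0 j))).
  by move=> p _; rewrite mxE.
case: (unlift ord0 j) => [k|] /=.
  apply: (measurableT_comp (measurable_entry _ _)).
  exact: (measurableT_comp measurable_fst).
apply: measurable_fun_complex => //.
exact: (measurableT_comp measurable_snd).
Qed.

Section extend_measure.
Variables (n : nat) (mu : {measure set 'rV[R[i]]_n -> \bar R}).

Definition extend_measure : set 'rV[R[i]]_n.+1 -> \bar R :=
  pushforward (mu \x lebesgue_measure \x lebesgue_measure)%E (@add_coord n).

Let mf : measurable_fun setT (@add_coord n) := @measurable_add_coord n.

Let extend_measure0 : extend_measure set0 = 0%E.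
Proof. exact: measure0. Qed.

Let extend_measure_ge0 A : (0 <= extend_measure A)%E.
Proof. exact: measure_ge0. Qed.

Let extend_measure_sigma_additive : semi_sigma_additive extend_measure.
Proof. exact: measure_semi_sigma_additive. Qed.

HB.instance Definition _ := isMeasure.Build _ _ _ extend_measure
  extend_measure0 extend_measure_ge0 extend_measure_sigma_additive.

End extend_measure.

(* Lebesgue measure of C^n = R^(2n), one complex coordinate at a time; the
   base case is the unit mass on the one-point space C^0. *)
Fixpoint lebesgue_Cn n : {measure set 'rV[R[i]]_n -> \bar R} :=
  match n with
  | 0 => dirac (0 : 'rV[R[i]]_0)
  | n'.+1 => extend_measure (lebesgue_Cn n')
  end.

End lebesgue.

Section domains.
Context {R : realType} {n : nat}.

Definition expi (t : R) : R[i] := cos t +i* sin t.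

Definition domain (Om : set 'rV[R[i]]_n) :=
  [/\ Om !=set0, connected Om & open Om].

Definition reinhardt (Om : set 'rV[R[i]]_n) :=
  forall (z : 'rV[R[i]]_n) (theta : 'I_n -> R),
    Om z -> Om (\row_j (expi (theta j) * z 0 j)).

(* f is only ever evaluated on [0, +oo)^n, so that taking it total on R^n is
   harmless. *)
Definition quasi_homogeneous (Om : set 'rV[R[i]]_n)
    (phi : 'rV[R[i]]_n -> R[i]) :=
  exists (f : 'rV[R]_n -> R[i]) (k : 'I_n -> int),
    forall (r : 'rV[R]_n) (theta : 'I_n -> R), (forall j, 0 <= r 0 j) ->
      let z := \row_j ((r 0 j)%:C * expi (theta j)) in
      Om z -> phi z = f r * expi (\sum_j (k j)%:~R * theta j).

End domains.

Section bergman.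
Context {R : realType} {n : nat}.
Implicit Types (Om : set 'rV[R[i]]_n) (f g h phi : 'rV[R[i]]_n -> R[i]).

Local Notation mu := (lebesgue_Cn R n).

(* Lebesgue (as opposed to Borel) measurability on Om: the measurable sets of
   'rV[R[i]]_n are the Borel sets, so h is Lebesgue measurable iff it agrees
   almost everywhere with a Borel function. The integral of a nonnegative
   function is the supremum of the integrals of the Borel simple functions below
   it, hence it has the correct value for Lebesgue measurable functions. *)
Definition lebesgue_measurable Om h :=
  exists2 g, measurable_fun Om g & {ae mu, forall z, Om z -> h z = g z}.

Definition bounded_quasi_homogeneous Om phi :=
  [/\ quasi_homogeneous Om phi, [bounded phi z | z in Om] & lebesgue_measurable Om phi].

Definition sum_of_quasi_homogeneous Om phi :=
  exists (N : nat) (q : 'I_N -> 'rV[R[i]]_n -> R[i]),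
    (forall l, bounded_quasi_homogeneous Om (q l)) /\
    (forall z, Om z -> phi z = \sum_l q l z).

Definition L2 Om : set ('rV[R[i]]_n -> R[i]) :=
  [set h | lebesgue_measurable Om h /\
    (\int[mu]_(z in Om) ((complex.Re `|h z|) ^+ 2)%:E < +oo)%E].

Definition Cintegral Om h : R[i] :=
  (\int[mu]_(z in Om) complex.Re (h z))
    +i* (\int[mu]_(z in Om) complex.Im (h z)).

Definition L2_dot Om h g : R[i] := Cintegral Om (fun z => h z * conjc (g z)).

(* Functions on Om are represented by total functions whose values outside Om
   are irrelevant. *)
Definition bergman_space Om : set ('rV[R[i]]_n -> R[i]) :=
  [set f | L2 Om f /\ forall z, Om z -> differentiable f z].

(* The orthogonal projection of h onto the Bergman space, which is unique as a
   function on Om. *)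
Definition bergman_projection Om h : 'rV[R[i]]_n -> R[i] :=
  xget (cst 0) [set g | bergman_space Om g /\
    forall f, bergman_space Om f -> L2_dot Om (fun z => h z - g z) f = 0].

Definition toeplitz Om phi f : 'rV[R[i]]_n -> R[i] :=
  bergman_projection Om (fun z => phi z * f z).

(* T_(phi m-1) (... (T_(phi 0) f)): the operator of index 0 acts first. *)
Definition toeplitz_product Om m (phi : 'I_m -> 'rV[R[i]]_n -> R[i]) f :=
  foldl (fun g j => toeplitz Om (phi j) g) f (enum 'I_m).

End bergman.

(* Main.v *)
(* Monomials are orthogonal on a Reinhardt domain, and the projection of a bounded
   function homogeneous of degree b under the torus is a multiple of z^b: by a discrete
   Goursat argument, the average of f(e^(i t) z) e^(-i b.t) is z^b times a coefficient
   that does not depend on z. Hence a Toeplitz operator whose symbol is a finite sum of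
   homogeneous functions maps a monomial z^e with large exponents to a finite sum of
   monomials z^(e+k), k ranging over the degrees. If no symbol vanishes almost
   everywhere, let psi_j be the lexicographically largest nonzero component of the j-th
   symbol. The leading coefficient of the image of z^e under the product is a product of
   inner products, so that for every g some factor
   int psi_j z^(b_j+g) conj(z^(b'_j+g)) = int W_j |z|^(2g) is zero.
   If each of finitely many weights w_j has a nonzero moment int w_j t^(k+1), then some
   moment int w_j t^k is nonzero for all j at once: otherwise the product of the functions
   s |-> int w_j t^s, zero at the integers, is zero at all real s >= 1 by polynomial
   approximation, so one factor vanishes on an interval and then everywhere. So for some
   j all the moments int W_j |z|^(2g+2) vanish; as W_j is invariant under rotations, its
   mixed moments vanish as well, and W_j, hence psi_j, is zero almost everywhere. *)
Require Import Defs.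
From HB Require Import structures.
From mathcomp Require Import all_boot all_order all_algebra.
From mathcomp Require Import complex.
From mathcomp Require Import all_classical all_reals all_analysis.
From mathcomp Require Import measurable_realfun.
From mathcomp Require Import ring lra zify.
Set Implicit Arguments.
Unset Strict Implicit.
Unset Printing Implicit Defensive.
Import Order.TTheory GRing.Theory Num.Theory.
Import numFieldNormedType.Exports.
Local Open Scope classical_set_scope.
Local Open Scope ring_scope.
Local Open Scope complex_scope.

(** * Moments of integrable functions *)

(** Every leading coefficient may vanish for many exponents, and the zero sets of several weights
    might together cover all integers although no weight is zero. On the integers nothing forbids
    this; on real exponents a product of continuous functions vanishes on an interval only if one
    factor vanishes on a smaller interval, and that is why real powers enter. The shift from [k] to
    [k.+1] is forced: mass on [t = 0] is seen by the exponent 0 alone. Adding the same [g] to all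
    exponents multiplies the integrand of each inner product by [|z|^(2g)], so finitely many weights
    can be fixed before [g] is chosen. Degrees may be negative, hence the large starting exponent. A
    function of the Bergman space is only square integrable. Its Laurent coefficients are replaced
    by averages over dyadic grids of angles, which are finite sums, and its integrals are first cut
    off to rotation invariant sets on which it is bounded. *)

Section bernstein.
Context {R : realType}.
Implicit Types (N : nat) (g : nat -> R) (x : R).

(* The Bernstein polynomial sum_k g k C(N,k) X^k (1-X)^(N-k), i.e. the expectation
   of g under the binomial law, built one Bernoulli trial at a time. *)
Fixpoint bernstein N g : {poly R} :=
  if N is N'.+1 then
    'X * bernstein N' (fun k => g k.+1) + (1 - 'X) * bernstein N' g
  else (g 0)%:P.

Lemma bernsteinS N g x : (bernstein N.+1 g).[x] =
  x * (bernstein N (fun k => g k.+1)).[x] + (1 - x) * (bernstein N g).[x].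
Proof. by rewrite /= !hornerE. Qed.

Lemma bernstein_lin N g h a x :
  (bernstein N (fun k => a * g k + h k)).[x] =
  a * (bernstein N g).[x] + (bernstein N h).[x].
Proof.
elim: N g h => [|N IH] g h; first by rewrite /= !hornerC.
by rewrite !bernsteinS (IH (fun k => g k.+1)) IH; ring.
Qed.

Lemma bernstein_cst N a x : (bernstein N (fun=> a)).[x] = a.
Proof.
elim: N => [|N IH]; first by rewrite /= hornerC.
by rewrite bernsteinS IH; ring.
Qed.

(** Mean square distance from [c] under the binomial law. Conditioning on the first trial moves [c]
    to [c - 1], so the induction needs [c] arbitrary; [c = N x] gives the variance. *)
Lemma bernstein_sq N c x :
  (bernstein N (fun k => (k%:R - c) ^+ 2)).[x] =
  N%:R * x * (1 - x) + (N%:R * x - c) ^+ 2.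
Proof.
elim: N c => [|N IH] c; first by rewrite /= hornerC; ring.
rewrite bernsteinS IH.
rewrite (_ : (fun k : nat => _) = (fun k : nat => (k%:R - (c - 1)) ^+ 2)).
  by rewrite IH -natr1; ring.
by apply/funext => k; rewrite -natr1; congr (_ ^+ 2); ring.
Qed.

Lemma bernstein_le N g h x : 0 <= x <= 1 -> (forall k, (k <= N)%N -> g k <= h k) ->
  (bernstein N g).[x] <= (bernstein N h).[x].
Proof.
move=> /andP[x0 x1]; elim: N g h => [|N IH] g h gh.
  by rewrite /= !hornerC; apply: gh.
rewrite !bernsteinS lerD// ler_wpM2l ?subr_ge0 ?IH// => k kN.
- by apply: gh; rewrite ltnS.
- by apply: gh; rewrite leqW.
Qed.

(** Bernstein's proof with Chebyshev's inequality built in: the Lipschitz error [L y] is majorised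
    by a quadratic in [y], whose binomial mean is known exactly. *)
Lemma lipschitz_poly_approx (f : R -> R) (L e : R) :
  0 <= L -> 0 < e ->
  (forall x y : R, 0 <= x <= 1 -> 0 <= y <= 1 -> `|f x - f y| <= L * `|x - y|) ->
  exists p : {poly R}, forall x, 0 <= x <= 1 -> `|f x - p.[x]| <= e.
Proof.
move=> L0 e0 fL.
(* The error will be at most [2 L d]: one [L d] from the constant term, one from the variance
   because [N d^2 >= 1]. Using [L + 1] keeps the divisor positive when [L = 0]. *)
pose d := e / (2 * (L + 1)).
have L1 : 0 < L + 1 by lra.
have d0 : 0 < d by rewrite /d divr_gt0 // mulr_gt0.
pose N := (Num.truncn (d ^- 2)).+1.
have N0 : 0 < N%:R :> R by [].
have Nd : 1 <= N%:R * d ^+ 2.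
  rewrite -ler_pdivrMr ?exprn_gt0// div1r ltW//.
  exact: truncnS_gt.
exists (bernstein N (fun k => f (k%:R / N%:R))) => x x01.
have d2 : d * (2 * (L + 1)) = e by rewrite /d; field; rewrite gt_eqF.
have key (s : R) : s ^+ 2 = 1 -> s * ((bernstein N (fun k => f (k%:R / N%:R))).[x] - f x) <= e.
  move=> s2.
  have -> : s * ((bernstein N (fun k => f (k%:R / N%:R))).[x] - f x) =
     (bernstein N (fun k => s * f (k%:R / N%:R) + - (s * f x))).[x].
    by rewrite (bernstein_lin N _ (fun=> - (s * f x))) bernstein_cst; ring.
  apply: (@le_trans _ _ (bernstein N (fun k =>
      (L / (d * N%:R ^+ 2)) * (k%:R - N%:R * x) ^+ 2 + L * d)).[x]).
    apply: bernstein_le => // k kN.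
    have kx : `|f (k%:R / N%:R) - f x| <= L * `|k%:R / N%:R - x|.
      apply: fL => //; rewrite divr_ge0 ?ler0n//=.
      by rewrite ler_pdivrMr// mul1r ler_nat.
    have s1 : `|s| = 1 by apply/eqP; rewrite -(@eqrXn2 _ 2) // -normrX s2 normr1 expr1n.
    apply: (@le_trans _ _ `|f (k%:R / N%:R) - f x|).
      by rewrite -mulrN -mulrDr (le_trans (ler_norm _))// normrM s1 mul1r.
    apply: (le_trans kx).
    have -> : L / (d * N%:R ^+ 2) * (k%:R - N%:R * x) ^+ 2 + L * d =
       L * (`|k%:R / N%:R - x| ^+ 2 / d + d).
      rewrite real_normK ?num_real//; field; rewrite (gt_eqF N0) (gt_eqF d0) //.
    apply: ler_wpM2l => //.
    set y := `|_|.
    have y0 : 0 <= y by exact: normr_ge0.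
    (* [y <= y^2 / d + d]: the second term suffices below [d], the first one above it. *)
    have [yd|dy] := leP y d.
      by apply: (le_trans yd); rewrite lerDr divr_ge0 ?sqr_ge0// ltW.
    apply: (@le_trans _ _ (y ^+ 2 / d)); last by rewrite lerDl ltW.
    by rewrite ler_pdivlMr// expr2 ler_wpM2l// ltW.
  rewrite bernstein_lin bernstein_cst bernstein_sq.
  have -> : L / (d * N%:R ^+ 2) * (N%:R * x * (1 - x) + (N%:R * x - N%:R * x) ^+ 2) =
     L * (x * (1 - x)) / (d * N%:R).
    by field; rewrite (gt_eqF N0) (gt_eqF d0).
  have H : L * (x * (1 - x)) / (d * N%:R) <= L * d.
    rewrite ler_pdivrMr; last exact: mulr_gt0.
    rewrite -[leRHS]mulrA ler_wpM2l//.
    have : x * (1 - x) <= 1 by nra.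
    by move=> /le_trans; apply; apply: (le_trans Nd); rewrite expr2; nra.
  by apply: (le_trans (lerD H (lexx _))); nra.
rewrite ler_norml; apply/andP; split.
  by have := key 1 (expr1n _ 2); lra.
by have := key (-1); rewrite sqrrN expr1n => /(_ erefl); lra.
Qed.

End bernstein.

(** * Integrals of an integrable weight against bounded functions *)

Section weighted_moments.
Context d (T : measurableType d) (R : realType).
Variables (mu : {measure set T -> \bar R}) (D : set T).
Hypothesis mD : measurable D.
Implicit Types (w h t : T -> R).

Definition bounded_measurable_on h :=
  measurable_fun D h /\ exists M, forall x, D x -> `|h x| <= M.
Local Notation bmeas := bounded_measurable_on.

Lemma eq_bmeas h1 h2 : h1 =1 h2 -> bmeas h1 -> bmeas h2.
Proof. by move=> /funext->. Qed.

Lemma bmeas_cst a : bmeas (fun=> a).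
Proof. by split=> //; exists `|a|. Qed.

Lemma bmeasD h1 h2 : bmeas h1 -> bmeas h2 -> bmeas (fun x => h1 x + h2 x).
Proof.
move=> [m1 [M1 b1]] [m2 [M2 b2]]; split; first exact: measurable_funD.
exists (M1 + M2) => x Dx; apply: (le_trans (ler_normD _ _)).
by apply: lerD; [exact: b1|exact: b2].
Qed.

Lemma bmeasM h1 h2 : bmeas h1 -> bmeas h2 -> bmeas (fun x => h1 x * h2 x).
Proof.
move=> [m1 [M1 b1]] [m2 [M2 b2]]; split; first exact: measurable_funM.
exists (M1 * M2) => x Dx; rewrite normrM.
by apply: ler_pM => //; [exact: b1|exact: b2].
Qed.

Lemma bmeasX h k : bmeas h -> bmeas (fun x => h x ^+ k).
Proof.
move=> bh; elim: k => [|k IH]; first exact: bmeas_cst.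
by apply: eq_bmeas (bmeasM bh IH) => x; rewrite exprS.
Qed.

Lemma bmeasB h1 h2 : bmeas h1 -> bmeas h2 -> bmeas (fun x => h1 x - h2 x).
Proof.
move=> b1 b2; apply: eq_bmeas (bmeasD b1 (bmeasM (bmeas_cst (-1)) b2)) => x.
by rewrite mulN1r.
Qed.

Lemma bmeas_sum (I : Type) (r : seq I) (P : pred I) (h : I -> T -> R) :
  (forall i, bmeas (h i)) -> bmeas (fun x => \sum_(i <- r | P i) h i x).
Proof.
move=> bh; elim: r => [|i r IH].
  by apply: eq_bmeas (bmeas_cst 0) => x; rewrite big_nil.
case Pi : (P i).
  by apply: eq_bmeas (bmeasD (bh i) IH) => x; rewrite big_cons Pi.
by apply: eq_bmeas IH => x; rewrite big_cons Pi.
Qed.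

Lemma bmeas_poly t (p : {poly R}) : bmeas t -> bmeas (fun x => p.[t x]).
Proof.
move=> bt; apply: (@eq_bmeas (fun x => \sum_(i < size p) p`_i * t x ^+ i)).
  by move=> x; rewrite horner_coef.
by apply: bmeas_sum => i; apply: bmeasM; [exact: bmeas_cst|exact: bmeasX].
Qed.

Local Notation integ w := (mu.-integrable D (EFin \o w)).

Lemma integrable_bmeas w h : integ w -> bmeas h -> integ (fun x => w x * h x).
Proof.
move=> iw [mh [M hM]].
rewrite (_ : EFin \o _ = (EFin \o w) \* (EFin \o h))%E; last first.
  by apply/funext => x /=; rewrite EFinM.
apply: integrableMl => //; exists M; split; first exact: num_real.
by move=> y My x Dx; apply: (le_trans (hM x Dx)); exact: ltW.
Qed.

Lemma Rintegral_bmeas_sum w (I : Type) (r : seq I) (h : I -> T -> R) :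
  integ w -> (forall i, bmeas (h i)) ->
  \int[mu]_(x in D) (w x * \sum_(i <- r) h i x) =
  \sum_(i <- r) \int[mu]_(x in D) (w x * h i x).
Proof.
move=> iw bh; elim: r => [|i r IH].
  rewrite big_nil; under eq_Rintegral do rewrite big_nil mulr0.
  by rewrite Rintegral_cst// mul0r.
rewrite big_cons -IH -RintegralD//; last 2 first.
- exact: integrable_bmeas.
- by apply: integrable_bmeas => //; exact: bmeas_sum.
by apply: eq_Rintegral => x _; rewrite big_cons mulrDr.
Qed.

Lemma Rintegral_bmeasZ w h a : integ w -> bmeas h ->
  \int[mu]_(x in D) (w x * (a * h x)) = a * \int[mu]_(x in D) (w x * h x).
Proof.
move=> iw bh; rewrite -RintegralZl//; last exact: integrable_bmeas.
by apply: eq_Rintegral => x _; rewrite mulrCA.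
Qed.

Lemma Rintegral_poly w t g (p : {poly R}) : integ w -> bmeas t -> bmeas g ->
  \int[mu]_(x in D) (w x * (g x * p.[t x])) =
  \sum_(i < size p) p`_i * \int[mu]_(x in D) (w x * (g x * t x ^+ i)).
Proof.
move=> iw bt bg.
transitivity (\int[mu]_(x in D) (w x * \sum_(i < size p) p`_i * (g x * t x ^+ i))).
  apply: eq_Rintegral => x _; congr (_ * _); rewrite horner_coef mulr_sumr.
  by apply: eq_bigr => i _; rewrite mulrCA.
have bi (i : nat) : bmeas (fun x => g x * t x ^+ i).
  by apply: bmeasM => //; exact: bmeasX.
rewrite Rintegral_bmeas_sum// => [|i].
  by apply: eq_bigr => i _; rewrite Rintegral_bmeasZ.
by apply: bmeasM => //; exact: bmeas_cst.
Qed.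

Lemma Rintegral_le_sup w h e : integ w -> bmeas h ->
  (forall x, D x -> `|h x| <= e) ->
  `|\int[mu]_(x in D) (w x * h x)| <= e * \int[mu]_(x in D) `|w x|.
Proof.
move=> iw bh he.
have ih := integrable_bmeas iw bh.
have iaw : integ (fun x => `|w x|).
  by have := integrable_abse iw; apply: eq_integrable.
apply: (le_trans (le_normr_Rintegral mD ih)).
rewrite -RintegralZl//; apply: le_Rintegral => //.
- by have := integrable_abse ih; apply: eq_integrable.
- have := integrableZl mD e iaw; apply: eq_integrable => //.
- by move=> x Dx; rewrite normrM mulrC ler_wpM2r// he.
Qed.

(** The functional [h |-> int w h] is continuous for the sup norm, so its zeros are stable under
    uniform limits. The polynomial approximation arguments that follow conclude through this. *)
Lemma Rintegral_approx0 w h : integ w -> bmeas h ->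
  (forall e, 0 < e -> exists g, [/\ bmeas g, forall x, D x -> `|h x - g x| <= e &
     \int[mu]_(x in D) (w x * g x) = 0]) ->
  \int[mu]_(x in D) (w x * h x) = 0.
Proof.
move=> iw bh H; apply/eqP; rewrite -normr_le0; apply/ler_addgt0Pr => e e0.
rewrite add0r.
have C0 : 0 <= \int[mu]_(x in D) `|w x| by apply: Rintegral_ge0 => x _.
set C := \int[mu]_(x in D) _ in C0.
have [|g [bg hg g0]] := H (e / (C + 1)); first by rewrite divr_gt0// ltr_wpDl.
have -> : \int[mu]_(x in D) (w x * h x) = \int[mu]_(x in D) (w x * (h x - g x)).
  under [in RHS]eq_Rintegral do rewrite mulrBr.
  rewrite RintegralB//; [by rewrite g0 subr0|exact: integrable_bmeas..].
apply: (le_trans (Rintegral_le_sup iw (bmeasB bh bg) hg)).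
rewrite -/C mulrAC ler_pdivrMr; last by rewrite ltr_wpDl.
by apply: ler_wpM2l; [exact: ltW|rewrite lerDl].
Qed.

End weighted_moments.

(** * Estimates for real powers on the unit interval *)

Section powR_unit_interval.
Context {R : realType}.
Implicit Types (x y t s e c : R).

Lemma powR_le1 t s : 0 <= t <= 1 -> 0 <= s -> t `^ s <= 1.
Proof.
move=> /andP[t0 t1] s0; have -> : 1 = 1 `^ s :> R by rewrite powR1.
by apply: ge0_ler_powR => //; rewrite nnegrE.
Qed.

(** [s >= 1] keeps the slope bounded at 0 and [s <= 2] fixes the constant. Dividing by the larger
    base [x] leaves [1 - r^s <= 1 - r^2 <= 2 (1 - r)] with [r = y / x]. *)
Lemma powR_lipschitz_base s x y : 1 <= s <= 2 -> 0 <= x <= 1 -> 0 <= y <= 1 ->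
  `|x `^ s - y `^ s| <= 2 * `|x - y|.
Proof.
move=> s12; wlog yx : x y / y <= x => [H|x01 y01].
  by have [yx|/ltW xy] := leP y x; [exact: H|rewrite distrC (distrC x) => ? ?; exact: H].
move: s12 x01 y01 => /andP[s1 s2] /andP[x0 x1] /andP[y0 y1].
have [x00|xn0] := eqVneq x 0.
  have -> : y = x by apply/eqP; rewrite eq_le yx x00.
  by rewrite !subrr normr0 mulr0.
have xp : 0 < x by rewrite lt_neqAle eq_sym xn0.
have le : y `^ s <= x `^ s by apply: ge0_ler_powR => //; rewrite ?nnegrE//; lra.
rewrite !ger0_norm ?subr_ge0//.
have [y00|yn0] := eqVneq y 0.
  rewrite y00 powR0 ?gt_eqF//; last lra.
  rewrite !subr0; have := @ge1r_powR R x s; rewrite xp x1 => /(_ isT s1); lra.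
have yp : 0 < y by rewrite lt_neqAle eq_sym yn0.
pose r := y / x.
have r1 : 0 < r <= 1 by rewrite divr_gt0//= ler_pdivrMr ?mul1r.
have yE : y = x * r by rewrite /r mulrC divfK.
have rs : r ^+ 2 <= r `^ s.
  by rewrite -powR_mulrn; [apply: ger_powR|case/andP: r1 => /ltW].
have r0 : 0 <= r by case/andP: r1 => /ltW.
rewrite yE (powRM _ x0 r0).
have xs : x `^ s <= x by apply: ge1r_powR; rewrite ?xp.
have xs0 : 0 <= x `^ s by apply: powR_ge0.
case/andP: r1 => _ r1.
have -> : x `^ s - x `^ s * r `^ s = x `^ s * (1 - r `^ s) by ring.
apply: (@le_trans _ _ (x `^ s * (2 * (1 - r)))).
  by apply: ler_wpM2l => //; rewrite expr2 in rs; nra.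
by have -> : 2 * (x - x * r) = x * (2 * (1 - r)) by [ring|]; apply: ler_wpM2r => //; lra.
Qed.

Lemma mul_ln_le1 t : 0 < t <= 1 -> t * - ln t <= 1.
Proof.
move=> /andP[t0 t1].
have := @ln_sublinear R t^-1; rewrite invr_gt0 => /(_ t0); rewrite lnV ?posrE// => /ltW H.
by apply: (le_trans (ler_wpM2l (ltW t0) H)); rewrite divff ?gt_eqF.
Qed.

(** The derivative in [s] is [t^s ln t], bounded by 1 since [t^s <= t] and [t |ln t| <= 1]; the
    inequality [1 + x <= exp x] stands in for the mean value theorem. *)
Lemma powR_lipschitz_exponent t s1 s2 : 0 <= t <= 1 -> 1 <= s1 -> 1 <= s2 ->
  `|t `^ s1 - t `^ s2| <= `|s1 - s2|.
Proof.
move=> t01; wlog s12 : s1 s2 / s1 <= s2 => [H|s11 s21].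
  have [?|/ltW ?] := leP s1 s2; first exact: H.
  by rewrite distrC (distrC s1) => ? ?; exact: H.
move: t01 => /andP[t0 t1].
have [->|tn0] := eqVneq t 0.
  by rewrite !powR0 ?subrr ?normr0 ?gt_eqF//; lra.
have tp : 0 < t by rewrite lt_neqAle eq_sym tn0.
have tt : 0 < t <= 1 by rewrite tp.
have le : t `^ s2 <= t `^ s1 by apply: ger_powR.
rewrite ger0_norm ?subr_ge0// distrC ger0_norm ?subr_ge0//.
have -> : t `^ s2 = t `^ s1 * t `^ (s2 - s1).
  by rewrite -powRD ?tn0 ?implybT//; congr (_ `^ _); ring.
have H : 1 + (s2 - s1) * ln t <= t `^ (s2 - s1).
  by rewrite /powR (negbTE tn0) expR_ge1Dx.
have ts : t `^ s1 <= t by apply: ge1r_powR.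
have ts0 := powR_ge0 t s1.
have L := mul_ln_le1 tt.
have ln0 : ln t <= 0 by apply: ln_le0.
have -> : t `^ s1 - t `^ s1 * t `^ (s2 - s1) = t `^ s1 * (1 - t `^ (s2 - s1)) by ring.
apply: (@le_trans _ _ (t `^ s1 * ((s2 - s1) * - ln t))).
  by apply: ler_wpM2l => //; lra.
rewrite mulrCA -[leRHS]mulr1; apply: ler_wpM2l; first lra.
by apply: le_trans L; apply: ler_wpM2r => //; lra.
Qed.

(* With v = t^(e/N), the polynomial (2v - 1)^N in v approximates v^(2N) = t^(2e):
   this is what lets a zero interval of t |-> int w t^s be doubled. *)
Lemma powR_double_approx t c e N : 0 <= t <= 1 -> 1 <= c -> 0 <= e ->
  `|t `^ (c + 2 * e) - t `^ c * (2 * t `^ (e / N.+1%:R) - 1) ^+ N.+1| <=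
  4 * e ^+ 2 / N.+1%:R.
Proof.
move=> /andP[t0 t1] c1 e0.
have N0 : 0 < N.+1%:R :> R by [].
have [->|tn0] := eqVneq t 0.
  rewrite (@powR0 _ (c + 2 * e)) ?(@powR0 _ c) ?gt_eqF//; [|lra|lra].
  by rewrite mul0r subr0 normr0 divr_ge0// mulr_ge0// sqr_ge0.
have tp : 0 < t by rewrite lt_neqAle eq_sym tn0.
have tt : 0 < t <= 1 by rewrite tp.
set v := t `^ (e / _).
have v01 : 0 <= v <= 1.
  by rewrite powR_ge0 powR_le1 ?t0// divr_ge0.
have -> : t `^ (c + 2 * e) = t `^ c * (v ^+ 2) ^+ N.+1.
  rewrite powRD ?tn0 ?implybT//; congr (_ * _).
  rewrite -exprM -powR_mulrn ?powR_ge0// -powRrM; congr (_ `^ _).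
  by rewrite natrM; field; rewrite gt_eqF.
rewrite -mulrBr normrM (ger0_norm (powR_ge0 _ _)).
have A (a b : R) n : `|a| <= 1 -> `|b| <= 1 -> `|a ^+ n - b ^+ n| <= n%:R * `|a - b|.
  move=> a1 b1; rewrite subrXX normrM mulrC ler_wpM2r//.
  apply: (le_trans (ler_norm_sum _ _ _)).
  have -> : n%:R = \sum_(i < n) (1 : R) by rewrite sumr_const card_ord.
  apply: ler_sum => i _.
  by rewrite normrM !normrX mulr_ile1// exprn_ile1.
(* [v^2] and [2 v - 1] agree to second order at [v = 1]. As [1 - v] is of order [1/N], the [N.+1]
   factors together cost only order [1/N]. *)
have B : `|(v ^+ 2) ^+ N.+1 - (2 * v - 1) ^+ N.+1| <= N.+1%:R * (1 - v) ^+ 2.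
  apply: (le_trans (A _ _ _ _ _)).
  - by rewrite ger0_norm ?sqr_ge0//; rewrite expr2; nra.
  - by rewrite ler_norml; apply/andP; split; lra.
  - have -> : v ^+ 2 - (2 * v - 1) = (1 - v) ^+ 2 by ring.
    by rewrite ger0_norm ?sqr_ge0.
apply: (le_trans (ler_wpM2l (powR_ge0 _ _) B)).
have ln0 : ln t <= 0 by apply: ln_le0.
have H : 1 - e / N.+1%:R * - ln t <= v.
  by rewrite mulrN opprK /v /powR (negbTE tn0) expR_ge1Dx.
have H1 : (1 - v) ^+ 2 <= (e / N.+1%:R * - ln t) ^+ 2.
  have z0 : 0 <= e / N.+1%:R * - ln t by rewrite mulr_ge0 ?divr_ge0// oppr_ge0.
  case/andP: v01 => v0 v1; move: (e / _ * - _) z0 H => z z0 H.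
  by rewrite ler_sqr ?nnegrE//; lra.
(* With [r] the square root of [t], [t (ln t)^2 = 4 (r ln r)^2 <= 4]: the origin of the factor 4. *)
pose r := t `^ (2^-1).
have r01 : 0 < r <= 1 by rewrite powR_gt0//= powR_le1 ?t0.
have rr : t = r ^+ 2.
  by rewrite /r -powR_mulrn ?powR_ge0// -powRrM mulVf// powRr1.
have lr : ln t = 2 * ln r by rewrite rr lnXn ?powR_gt0// mulr_natl.
have Lr := mul_ln_le1 r01.
have lnr0 : ln r <= 0 by apply: ln_le0; case/andP: r01.
have ts : t `^ c <= t by apply: ge1r_powR.
have ts0 := powR_ge0 t c.
apply: (@le_trans _ _ (t * (N.+1%:R * (e / N.+1%:R * - ln t) ^+ 2))).
  apply: (@le_trans _ _ (t `^ c * (N.+1%:R * (e / N.+1%:R * - ln t) ^+ 2))).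
    by apply: ler_wpM2l => //; apply: ler_wpM2l => //.
  by rewrite ler_wpM2r// mulr_ge0// sqr_ge0.
have -> : t * (N.+1%:R * (e / N.+1%:R * - ln t) ^+ 2) = (4 * e ^+ 2 / N.+1%:R) * (r * - ln r) ^+ 2.
  by rewrite lr rr; field; rewrite gt_eqF.
rewrite -[leRHS]mulr1; apply: ler_wpM2l.
  by rewrite divr_ge0// mulr_ge0// sqr_ge0.
case/andP: r01 => r0 r1.
by rewrite expr_le1// mulr_ge0 ?(ltW r0) ?oppr_ge0.
Qed.

(** [(1 - (1-t)^(N+1))^K] is divisible by [t^K] and close to 1 away from [t = 0], while [t^(k+1)]
    absorbs the defect near 0. So [t^(k+1)] is a uniform limit of multiples of [t^(k+1+K)]. *)
Lemma polydiv_Xk_approx t K N k : 0 <= t <= 1 ->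
  `|t ^+ k.+1 - t ^+ k.+1 * (1 - (1 - t) ^+ N.+1) ^+ K| <= K%:R / N.+1%:R.
Proof.
move=> /andP[t0 t1].
have N0 : 0 < N.+1%:R :> R by [].
have y01 : 0 <= (1 - t) ^+ N.+1 <= 1.
  by rewrite exprn_ge0 ?exprn_ile1 ?subr_ge0// lerBlDr lerDl.
set y := (1 - t) ^+ N.+1 in y01 *.
have yK : 0 <= 1 - (1 - y) ^+ K <= K%:R * y.
  elim: K => [|K /andP[IH1 IH2]]; first by rewrite expr0 subrr mul0r lexx.
  rewrite exprS -natr1; case/andP: y01 => y0 y1.
  have : 0 <= (1 - y) ^+ K by rewrite exprn_ge0 ?subr_ge0.
  move: ((1 - y) ^+ K) IH1 IH2 => z *; apply/andP; split; nra.
(* Bernoulli: [(1-t)^n (1 + n t) <= 1], hence [t (1-t)^n <= 1/n]. *)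
have ty : t * y <= N.+1%:R^-1.
  have bern : t * y * N.+1%:R <= 1.
    suff : y * (1 + N.+1%:R * t) <= 1.
      by case/andP: y01 => y0 _ H; apply: le_trans H; rewrite mulrDr mulr1 -[leLHS]add0r lerD// le_eqVlt; apply/orP; left; apply/eqP; ring.
    rewrite /y.
    elim: {y y01 yK N0} N.+1 => [|n IH]; first by rewrite mul0r addr0 expr0 mulr1.
    have z0 : 0 <= (1 - t) ^+ n by rewrite exprn_ge0 ?subr_ge0.
    have z1 : (1 - t) ^+ n <= 1 by rewrite exprn_ile1 ?subr_ge0// lerBlDr lerDl.
    rewrite exprS -natr1; move: ((1 - t) ^+ n) (n%:R) IH z0 z1 => z m IH z0 z1.
    have : z * (1 + m * t) * (1 - t) <= 1 * (1 - t) by apply: ler_wpM2r; lra.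
    have : t * (z * (1 - t)) <= t * 1 by apply: ler_wpM2l => //; nra.
    lra.
  by rewrite -[leRHS]div1r ler_pdivlMr.
rewrite -[X in `|X - _|]mulr1 -mulrBr normrM !ger0_norm ?exprn_ge0//; last by case/andP: yK.
apply: (@le_trans _ _ (t * (K%:R * y))).
  rewrite exprS -mulrA; apply: ler_wpM2l => //.
  case/andP: yK => yK0 yK1; apply: le_trans yK1.
  by rewrite ler_piMl// exprn_ile1.
by rewrite mulrCA ler_wpM2l.
Qed.

End powR_unit_interval.

(** * Products of moments, at integer and at real exponents *)

Section moment_products.
Context d (T : measurableType d) (R : realType).
Variables (mu : {measure set T -> \bar R}) (D : set T).
Hypothesis mD : measurable D.
Implicit Types (w h t : T -> R) (s e a b c r u : R).
Local Notation bmeas := (bounded_measurable_on D).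
Local Notation integ w := (mu.-integrable D (EFin \o w)).

Variable t : T -> R.
Hypotheses (mt : measurable_fun D t) (t01 : forall x, D x -> 0 <= t x <= 1).

Let bt : bmeas t.
Proof. by split=> //; exists 1 => x /t01 /andP[t0 t1]; rewrite ger0_norm. Qed.

Let bpow s : 0 <= s -> bmeas (fun x => t x `^ s).
Proof.
move=> s0; split.
  exact: (measurableT_comp (measurable_powR _)).
by exists 1 => x /t01 tx; rewrite ger0_norm ?powR_ge0// powR_le1.
Qed.

Let F w s := \int[mu]_(x in D) (w x * t x `^ s).
Let M w k := \int[mu]_(x in D) (w x * t x ^+ k).

Let FM w k : F w k%:R = M w k.
Proof.
apply: eq_Rintegral => x; rewrite inE => /t01 /andP[t0 _].
by rewrite powR_mulrn.
Qed.

(* The bound for one factor only involves sup norms over [0, 1], hence it is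
   stable under products: apply the functional of the first factor to the
   estimate for the others, at u * t x. *)
Lemma prod_moments_approx (ws : seq (T -> R)) :
  (forall w, w \in ws -> integ w) ->
  exists2 C : R, 0 <= C & forall (p : {poly R}) (s e : R), 1 <= s ->
    (forall u, 0 <= u <= 1 -> `|u `^ s - p.[u]| <= e) ->
    forall u, 0 <= u <= 1 ->
    `|u `^ s * \prod_(w <- ws) F w s -
      \sum_(k < size p) p`_k * (u ^+ k * \prod_(w <- ws) M w k)| <= e * C.
Proof.
elim: ws => [|w ws IH] iws.
  exists 1 => // p s e s1 H u u01; rewrite big_nil mulr1.
  under eq_bigr do rewrite big_nil mulr1.
  by rewrite -horner_coef mulr1; exact: H.
have iw : integ w by apply: iws; rewrite mem_head.
have [|C C0 HC] := IH; first by move=> v vws; apply: iws; rewrite inE vws orbT.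
exists (C * \int[mu]_(x in D) `|w x|).
  by rewrite mulr_ge0//; apply: Rintegral_ge0.
move=> p s e s1 H u u01.
have s0 : 0 <= s by lra.
pose P k := \prod_(v <- ws) M v k.
have -> : u `^ s * \prod_(v <- w :: ws) F v s -
    \sum_(k < size p) p`_k * (u ^+ k * \prod_(v <- w :: ws) M v k) =
  \int[mu]_(x in D) (w x * ((u * t x) `^ s * \prod_(v <- ws) F v s -
     \sum_(k < size p) p`_k * ((u * t x) ^+ k * P k))).
  transitivity (\int[mu]_(x in D) (w x * (u `^ s * \prod_(v <- ws) F v s * t x `^ s)) -
      \int[mu]_(x in D) (w x * \sum_(k < size p) p`_k * (u ^+ k * P k) * t x ^+ k)).
    rewrite Rintegral_bmeasZ//; last exact: bpow.
    rewrite Rintegral_bmeas_sum// => [|k]; last first.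
      by apply: bmeasM; [exact: bmeas_cst|exact: bmeasX].
    congr (_ - _); first by rewrite big_cons -/(F w s); ring.
    apply: eq_bigr => k _; rewrite Rintegral_bmeasZ//; last exact: bmeasX.
    by rewrite big_cons /P /M; ring.
  rewrite -RintegralB//; last 2 first.
  - by apply: integrable_bmeas => //; apply: bmeasM; [exact: bmeas_cst|exact: bpow].
  - apply: integrable_bmeas => //; apply: bmeas_sum => k.
    by apply: bmeasM; [exact: bmeas_cst|exact: bmeasX].
  apply: eq_Rintegral => x; rewrite inE => /t01 /andP[t0 t1].
  have u0 : 0 <= u by case/andP: u01.
  rewrite -mulrBr powRM//; congr (_ * (_ - _)); first by ring.
  by apply: eq_bigr => k _; rewrite exprMn; ring.
have ut x : D x -> 0 <= u * t x <= 1.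
  move=> /t01 /andP[t0 t1]; case/andP: u01 => u0 u1.
  by rewrite mulr_ge0// mulr_ile1.
rewrite mulrA; apply: Rintegral_le_sup => //.
- have bu : bmeas (fun x => u * t x) by apply: bmeasM => //; exact: bmeas_cst.
  apply: bmeasB; last first.
    apply: bmeas_sum => k; apply: bmeasM; first exact: bmeas_cst.
    by apply: bmeasM; [exact: bmeasX|exact: bmeas_cst].
  apply: bmeasM; last exact: bmeas_cst.
  split; first exact: (measurableT_comp (measurable_powR _) bu.1).
  by exists 1 => x /ut tx; rewrite ger0_norm ?powR_ge0// powR_le1.
- by move=> x Dx; apply: HC => //; exact: ut.
Qed.

(** Approximating [x^s] by polynomials makes the product at [s] a limit of combinations of the
    products at integers; [prod_moments_approx] is used at [u = 1]. *)
Lemma prod_moments_real (ws : seq (T -> R)) s :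
  (forall w, w \in ws -> integ w) ->
  (forall k : nat, \prod_(w <- ws) M w k = 0) -> 1 <= s <= 2 ->
  \prod_(w <- ws) F w s = 0.
Proof.
move=> iws M0 s12; have [C C0 HC] := prod_moments_approx iws.
apply/eqP; rewrite -normr_le0; apply/ler_addgt0Pr => e e0; rewrite add0r.
have [||p Hp] := @lipschitz_poly_approx R (fun x => x `^ s) 2 (e / (C + 1)) (ler0n _ 2).
- by rewrite divr_gt0// ltr_wpDl.
- by move=> x y x01 y01; exact: powR_lipschitz_base.
have s1 : 1 <= s by case/andP: s12.
have := HC p s _ s1 Hp 1; rewrite lexx ler01 => /(_ isT).
rewrite powR1 mul1r [X in _ - X]big1 ?subr0 => [|k _]; last by rewrite M0 !mulr0.
move=> /le_trans; apply; rewrite mulrAC ler_pdivrMr; last by rewrite ltr_wpDl.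
by apply: ler_wpM2l; [exact: ltW|rewrite lerDl].
Qed.

Lemma F_lipschitz w s1 s2 : integ w -> 1 <= s1 -> 1 <= s2 ->
  `|F w s1 - F w s2| <= `|s1 - s2| * \int[mu]_(x in D) `|w x|.
Proof.
move=> iw s11 s21; rewrite /F -RintegralB//; try by
  (apply: integrable_bmeas => //; apply: bpow; lra).
under eq_Rintegral do rewrite -mulrBr.
apply: Rintegral_le_sup => //.
- by apply: bmeasB; apply: bpow; lra.
- by move=> x /t01 tx; exact: powR_lipschitz_exponent.
Qed.

(** By [F_lipschitz], a factor that is nonzero at [c] stays nonzero near [c]. It can be cancelled on
    a smaller interval, where the induction continues with the other factors. *)
Lemma zero_interval (ws : seq (T -> R)) a b : 1 <= a -> a < b ->
  (forall w, w \in ws -> integ w) ->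
  (forall s, a <= s <= b -> \prod_(w <- ws) F w s = 0) ->
  exists w a' b', [/\ w \in ws, 1 <= a', a' < b' &
     forall s, a' <= s <= b' -> F w s = 0].
Proof.
elim: ws a b => [|w ws IH] a b a1 ab iws H.
  have := H a; rewrite lexx ltW// => /(_ isT) /eqP.
  by rewrite big_nil oner_eq0.
have [Fw|] := pselect (forall s, a <= s <= b -> F w s = 0).
  by exists w, a, b; rewrite mem_head.
move=> /existsNP[c /not_implyP[/andP[ac cb] /eqP Fc]].
have iw : integ w by apply: iws; rewrite mem_head.
have C0 : 0 <= \int[mu]_(x in D) `|w x| by apply: Rintegral_ge0.
set C := \int[mu]_(x in D) _ in C0.
pose r := `|F w c| / (C + 1).
have r0 : 0 < r by rewrite divr_gt0 ?normr_gt0// ltr_wpDl.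
have nz s : 1 <= s -> `|c - s| < r -> F w s != 0.
  move=> s1 cs; apply/negP => /eqP Fs0.
  have c1 : 1 <= c by apply: le_trans ac.
  have := F_lipschitz iw c1 s1; rewrite Fs0 subr0 -/C => H1.
  move: cs; rewrite /r ltr_pdivlMr ?ltr_wpDl// => H2.
  have := normr_ge0 (c - s); nra.
pose a' := Num.max a (c - r / 2); pose b' := Num.min b (c + r / 2).
have ab' : a' < b'.
  by rewrite /a' /b' gt_max !lt_min ab/=; apply/and3P; split; lra.
have [||s|v [a2 [b2 [vws ? ? Hv]]]] := IH a' b' _ ab'.
- by rewrite le_max a1.
- by move=> v vws; apply: iws; rewrite inE vws orbT.
- rewrite ge_max le_min -!andbA => /and4P[as_ cs sb sc].
  have := H s; rewrite as_ sb => /(_ isT) /eqP; rewrite big_cons mulf_eq0.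
  have /negbTE -> /= : F w s != 0.
    apply: nz; first exact: le_trans as_.
    by rewrite ltr_norml; apply/andP; split; lra.
  by move/eqP.
by exists v, a2, b2; rewrite inE vws orbT.
Qed.

(** The approximants of [t^(c + 2 e)] from [powR_double_approx] are combinations of
    [t^(c + e i / (N+1))] with [i <= N+1], and these exponents all lie in [[c, c + e]]. *)
Lemma double_zero_interval w c e : integ w -> 1 <= c -> 0 <= e ->
  (forall s, c <= s <= c + e -> F w s = 0) -> F w (c + 2 * e) = 0.
Proof.
move=> iw c1 e0 H; apply: Rintegral_approx0 => //; first by apply: bpow; lra.
move=> r r0.
pose N := Num.truncn (4 * e ^+ 2 / r).
have N0 : 0 < N.+1%:R :> R by [].
have eN : 0 <= e / N.+1%:R by rewrite divr_ge0.
have bp := bpow eN.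
have bc : bmeas (fun x => t x `^ c) by apply: bpow; lra.
pose p : {poly R} := (2%:P * 'X - 1) ^+ N.+1.
exists (fun x => t x `^ c * p.[t x `^ (e / N.+1%:R)]); split.
- by apply: bmeasM => //; exact: bmeas_poly.
- move=> x /t01 tx; rewrite /p !hornerE.
  apply: (le_trans (powR_double_approx N tx c1 e0)).
  rewrite ler_pdivrMr// [leRHS]mulrC -ler_pdivrMr// ltW//.
  exact: truncnS_gt.
rewrite Rintegral_poly// big1// => i _.
have -> : \int[mu]_(x in D) (w x * (t x `^ c * (t x `^ (e / N.+1%:R)) ^+ i)) =
   F w (c + e / N.+1%:R * i%:R).
  apply: eq_Rintegral => x xD; congr (_ * _).
  rewrite -powR_mulrn ?powR_ge0// -powRrM -powRD//.
  apply/implyP => /eqP H0.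
  have : 0 <= e / N.+1%:R * i%:R by rewrite mulr_ge0.
  by move: (e / N.+1%:R * i%:R) H0 => z; lra.
rewrite H ?mulr0//; apply/andP; split; first by rewrite lerDl mulr_ge0.
rewrite lerD2l mulrAC ler_pdivrMr// ler_wpM2l// ler_nat.
have := ltn_ord i.
have sp : (size p <= N.+2)%N.
  rewrite /p (leq_trans (size_poly_exp_leq _ _))//.
  have : (size ((2%:P * 'X - 1)%R : {poly R}) <= 2)%N.
    rewrite (leq_trans (size_polyD _ _))// size_polyN size_poly1 geq_max.
    by rewrite mul_polyC (leq_trans (size_scale_leq _ _)) ?size_polyX.
  by case: (size _) => [|[|[|]]] //= _; rewrite ?mul0n ?mul1n.
by move=> ip; rewrite -ltnS (leq_trans ip sp).
Qed.

(** The left end [a] stays fixed while each application of [double_zero_interval] doubles the length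
    of the zero interval. *)
Lemma zero_interval_ray w a b : integ w -> 1 <= a -> a < b ->
  (forall s, a <= s <= b -> F w s = 0) -> forall s, a <= s -> F w s = 0.
Proof.
move=> iw a1 ab H.
have step n : forall s, a <= s <= a + 2 ^+ n * (b - a) -> F w s = 0.
  elim: n => [|n IH] s; first by rewrite expr0 mul1r addrC subrK; exact: H.
  rewrite exprS => /andP[as_ sb].
  have -> : s = a + 2 * ((s - a) / 2) by field.
  apply: double_zero_interval => // [|u /andP[au ub]]; first lra.
  by apply: IH; rewrite au/=; lra.
move=> s as_; pose n := (Num.truncn ((s - a) / (b - a))).+1.
apply: (step n); rewrite as_/= -lerBlDl -ler_pdivrMr ?subr_gt0//.
apply: (@le_trans _ _ n%:R); first by rewrite ltW// truncnS_gt.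
rewrite -natrX ler_nat ltnW//; exact: ltn_expl.
Qed.

(** [t^(k+1)] is a uniform limit of multiples of [t^K]. Only positive exponents can be recovered,
    since mass on [t = 0] contributes to the exponent 0 alone. *)
Lemma eventually_zero_moments w K : integ w -> (forall k, (K <= k)%N -> M w k = 0) ->
  forall k, M w k.+1 = 0.
Proof.
move=> iw H k; apply: Rintegral_approx0 => //; first exact: bmeasX.
move=> e e0; pose N := Num.truncn (K%:R / e).
pose p : {poly R} := (\sum_(i < N.+1) (1 - 'X) ^+ i) ^+ K.
have pE x : x ^+ K * p.[x] = (1 - (1 - x) ^+ N.+1) ^+ K.
  rewrite /p horner_exp -exprMn; congr (_ ^+ _).
  have := subrXX (1 : R) (1 - x) N.+1; rewrite expr1n => ->; congr (_ * _); first by ring.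
  rewrite horner_sum; apply: eq_bigr => i _.
  by rewrite expr1n mul1r horner_exp !hornerE.
exists (fun x => t x ^+ (k.+1 + K) * p.[t x]); split.
- by apply: bmeasM; [exact: bmeasX|exact: bmeas_poly].
- move=> x /t01 tx; rewrite exprD -mulrA pE.
  apply: (le_trans (polydiv_Xk_approx K N k tx)).
  by rewrite ler_pdivrMr// [leRHS]mulrC -ler_pdivrMr// ltW// truncnS_gt.
rewrite Rintegral_poly//; last exact: bmeasX.
rewrite big1// => i _.
have -> : \int[mu]_(x in D) (w x * (t x ^+ (k.+1 + K) * t x ^+ i)) = M w (k.+1 + K + i).
  by apply: eq_Rintegral => x _; rewrite -exprD.
by rewrite H ?mulr0// addnAC leq_addl.
Qed.

Lemma prod_moments_neq0 (ws : seq (T -> R)) :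
  (forall w, w \in ws -> integ w) ->
  (forall w, w \in ws -> exists k, M w k.+1 != 0) ->
  exists k, forall w, w \in ws -> M w k != 0.
Proof.
move=> iws H; apply: contrapT => /forallNP N.
have M0 k : \prod_(w <- ws) M w k = 0.
  apply/eqP; rewrite -[_ == 0]negbK prodf_seq_neq0; apply/negP => /allP A.
  by apply: (N k) => w /A.
have F0 s : 1 <= s <= 2 -> \prod_(w <- ws) F w s = 0 by exact: prod_moments_real.
have lt12 : 1 < 2 :> R by rewrite ltr1n.
have [w [a [b [wws a1 ab F0w]]]] := zero_interval (lexx 1) lt12 iws F0.
have iw := iws _ wws.
have ray := zero_interval_ray iw a1 ab F0w.
have [k /eqP] := H w wws; apply.
apply: (@eventually_zero_moments w (Num.truncn a).+1) => // j aj.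
rewrite -FM ray// (le_trans (ltW (truncnS_gt a)))// ler_nat.
by [].
Qed.

End moment_products.

(** * Vanishing moments and vanishing integrals over level sets *)

Section moment_determinacy.
Context d (T : measurableType d) (R : realType).
Variables (mu : {measure set T -> \bar R}) (D : set T).
Hypothesis mD : measurable D.
Implicit Types (w h t : T -> R) (e a b c B : R).
Local Notation bmeas := (bounded_measurable_on D).
Local Notation integ w := (mu.-integrable D (EFin \o w)).

Lemma Rintegral_dominated (f : (T -> R)^nat) (g w : T -> R) :
  (forall n, measurable_fun D (f n)) -> measurable_fun D g -> integ w ->
  (forall x, D x -> f ^~ x @ \oo --> g x) ->
  (forall n x, D x -> `|f n x| <= w x) ->
  (fun n => \int[mu]_(x in D) f n x) @ \oo --> \int[mu]_(x in D) g x.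
Proof.
move=> mf mg iw fg fw.
have [||| | |ig _ H] := @dominated_convergence _ _ _ mu _ mD
  (fun n => EFin \o f n) (EFin \o g) (EFin \o w).
- by move=> n; exact/measurable_EFinP.
- exact/measurable_EFinP.
- by apply: aeW => x Dx; apply: cvg_EFin; [exact: nearW|exact: fg].
- exact: iw.
- by apply: aeW => x n Dx; rewrite /= lee_fin; exact: fw.
- by move: H; rewrite -(fineK (integrable_fin_num mD ig)) => /fine_cvg.
Qed.

Lemma Rintegral_setI_preimage w t A :
  \int[mu]_(x in D `&` t @^-1` A) w x = \int[mu]_(x in D) (w x * \1_A (t x)).
Proof.
rewrite Rintegral_mkcondr; apply: eq_Rintegral => x _.
rewrite patchE indicE; case: ifPn; rewrite ?inE ?notin_setE /= => tA.
  by rewrite mem_set// mulr1.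
by rewrite memNset// mulr0.
Qed.

(** Polynomials approximate Lipschitz functions, Lipschitz ramps converge to indicators of
    half-lines []a, +oo[], and the half-lines form a pi-system that generates the Borel sets. *)
Lemma moments_unit_interval w t : measurable_fun D t ->
  (forall x, D x -> 0 <= t x <= 1) -> integ w ->
  (forall k, \int[mu]_(x in D) (w x * t x ^+ k) = 0) ->
  forall A, measurable A -> \int[mu]_(x in D `&` t @^-1` A) w x = 0.
Proof.
move=> mt t01 iw M0.
have bt : bmeas t.
  by split=> //; exists 1 => x /t01 /andP[t0 t1]; rewrite ger0_norm.
have mtA A : measurable A -> measurable (D `&` t @^-1` A) by exact: mt.
have iwA A : measurable A -> mu.-integrable (D `&` t @^-1` A) (EFin \o w).
  by move=> mA; apply: integrableS iw => //; exact: mtA.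
have lip (f : R -> R) L : 0 <= L -> measurable_fun setT f ->
    (forall x y, `|f x - f y| <= L * `|x - y|) -> (forall x, `|f x| <= 1) ->
    \int[mu]_(x in D) (w x * f (t x)) = 0.
  move=> L0 mf fL f1; apply: Rintegral_approx0 => //.
    by split; [exact: (measurableT_comp mf)|exists 1].
  move=> e e0.
  have [p Hp] := @lipschitz_poly_approx R f L e L0 e0 (fun x y _ _ => fL x y).
  exists (fun x => p.[t x]); split; first exact: bmeas_poly.
    by move=> x /t01; exact: Hp.
  transitivity (\int[mu]_(x in D) (w x * (1 * p.[t x]))).
    by under [RHS]eq_Rintegral do rewrite mul1r.
  rewrite Rintegral_poly//; last exact: bmeas_cst.
  rewrite big1// => i _; under eq_Rintegral do rewrite mul1r.
  by rewrite M0 mulr0.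
have ray a : \int[mu]_(x in D `&` t @^-1` `]a, +oo[) w x = 0.
  (* For [n > 0], a ramp rising from 0 at [a] to 1 at [a + 1/n]; being 0 at [a], it converges to the
     indicator of the open half-line. *)
  pose f n (y : R) : R := Num.min 1 (Num.max 0 (n%:R * (y - a))).
  have f01 n y : 0 <= f n y <= 1.
    by rewrite /f le_min ler01 le_max lexx/= ge_min lexx.
  have f1 n y : `|f n y| <= 1.
    by rewrite ler_norml; case/andP: (f01 n y) => ? ?; apply/andP; split; lra.
  have fL n x y : `|f n x - f n y| <= n%:R * `|x - y|.
    rewrite -[n%:R]ger0_norm// -normrM.
    have -> : n%:R * (x - y) = n%:R * (x - a) - n%:R * (y - a) by ring.
    rewrite /f; move: (n%:R * (x - a)) (n%:R * (y - a)) => u v.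
    have N1 : u - v <= `|u - v| by exact: ler_norm.
    have N2 : v - u <= `|u - v| by rewrite distrC; exact: ler_norm.
    move: (`|u - v|) N1 N2 => z N1 N2; rewrite ler_norml.
    case: (leP 0 u) => hu; case: (leP 0 v) => hv; rewrite /Num.min;
      do 2 ?[case: ltP => ?]; apply/andP; split; lra.
  have mf n : measurable_fun setT (f n).
    apply: measurable_minr => //; apply: measurable_maxr => //.
    by apply: measurable_funM => //; exact: measurable_funB.
  have i0 n : \int[mu]_(x in D) (w x * f n (t x)) = 0.
    by apply: (lip (f n) n%:R).
  rewrite Rintegral_setI_preimage.
  have iaw : integ (fun x => `|w x|).
    by have := integrable_abse iw; apply: eq_integrable.
  have mw : measurable_fun D w by apply/measurable_EFinP; exact: (measurable_int mu).
  have := @Rintegral_dominated (fun n x => w x * f n (t x))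
    (fun x => w x * \1_(`]a, +oo[) (t x)) (fun x => `|w x|).
  move=> /(_ _ _ iaw) H.
  apply/esym; apply: (cvg_unique _ _ (H _ _ _ _)) => //.
  - rewrite (_ : (fun n => _) = fun=> 0); first exact: cvg_cst.
    by apply/funext => n; rewrite i0.
  - move=> n; apply: measurable_funM => //; exact: (measurableT_comp (mf n)).
  - apply: measurable_funM => //.
    by apply: (measurableT_comp (measurable_indic _)).
  - move=> x Dx; rewrite indicE; apply: cvgMr.
    have [ax|xa] := ltP a (t x).
      rewrite mem_set/= ?in_itv/= ?ax//.
      have [n0 Hn0] : exists n0 : nat, 1 <= n0%:R * (t x - a).
        exists (Num.truncn (t x - a)^-1).+1.
        by rewrite -ler_pdivrMr ?subr_gt0// div1r ltW// truncnS_gt.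
      apply: cvg_near_cst; exists n0 => // n /= nn0.
      rewrite /f max_r; last by rewrite mulr_ge0// subr_ge0 ltW.
      rewrite min_l// (le_trans Hn0)// ler_wpM2r ?ler_nat//.
      by rewrite subr_ge0 ltW.
    rewrite memNset/=; last by rewrite in_itv/= andbT; apply/negP; rewrite -leNgt.
    rewrite (_ : (fun n => _) = fun=> 0); first exact: cvg_cst.
    apply/funext => n; rewrite /f max_l ?min_r//.
    by rewrite mulr_ge0_le0// subr_le0.
  - by move=> n x Dx; rewrite normrM ler_piMr.
pose P A := (\int[mu]_(x in D `&` t @^-1` A) (w x)%:E = 0)%E.
have PE A : measurable A -> \int[mu]_(x in D `&` t @^-1` A) w x = 0 <-> P A.
  move=> mA; rewrite /P /Rintegral; split => [|->//].
  have := integrable_fin_num (mtA _ mA) (iwA _ mA).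
  by move=> /fineK {2}<- ->.
move=> A mA; apply/(PE _ mA).
have PT : P setT.
  apply/PE => //; rewrite preimage_setT setIT.
  by have := M0 0; under eq_Rintegral do rewrite mulr1.
have sA : (@RGenOInfty.G R).-sigma.-measurable A.
  by rewrite -RGenOInfty.measurableE.
apply: (@dynkin_induction _ _ (@RGenOInfty.G R) P) sA => //.
- exact: RGenOInfty.measurableE.
- move=> _ _ [a ->] [b ->]; exists (Num.max a b).
  by apply/seteqP; split=> x /=; rewrite !in_itv/= !andbT gt_max => /andP.
- by move=> _ [a ->]; apply/PE => //; exact: ray.
- move=> S mS PS; apply/PE; first exact: measurableC.
  rewrite Rintegral_setI_preimage.
  have : \int[mu]_(x in D) (w x * (1 - \1_S (t x))) = 0.
    under eq_Rintegral do rewrite mulrBr.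
    have bS : bmeas (fun x => \1_S (t x) : R).
      split; first exact: (measurableT_comp (measurable_indic mS) mt).
      by exists 1 => x _; rewrite indicE; case: (_ \in _); rewrite ?normr1 ?normr0.
    rewrite RintegralB//; last exact: integrable_bmeas.
      by rewrite -Rintegral_setI_preimage (PE _ mS).2// subr0; exact: M0 0.
    by apply: integrable_bmeas => //; exact: bmeas_cst.
  apply: etrans; apply: eq_Rintegral => x _; rewrite !indicE in_setC.
  by case: (_ \in _); rewrite /= ?subr0 ?subrr.
- move=> F mF tF PF; rewrite /P preimage_bigcup setI_bigcupr.
  rewrite integral_bigcup//.
  + by rewrite eseries0// => i _ _; exact: PF.
  + apply/trivIsetP => i j _ _ ij; rewrite -subset0 => x [[_ xi] [_ xj]].
    by have /trivIsetP/(_ i j I I ij) := tF; rewrite -subset0; apply; split; [exact: xi|].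
  + by move=> k; exact: mtA.
  + by rewrite -setI_bigcupr -preimage_bigcup; apply: iwA; exact: bigcup_measurable.
Qed.

End moment_determinacy.

(** * Bounded functions and several variables *)

Section moments_several_variables.
Context d (T : measurableType d) (R : realType).
Variables (mu : {measure set T -> \bar R}) (D : set T).
Hypothesis mD : measurable D.
Implicit Types (w h t : T -> R) (e a b c B : R).
Local Notation bmeas := (bounded_measurable_on D).
Local Notation integ w := (mu.-integrable D (EFin \o w)).

(** An affine map carries a bounded [t] into the unit interval. Powers of the new variable are
    polynomials in [t], so their moments vanish too. *)
Lemma moments_determine w t : bmeas t -> integ w ->
  (forall k, \int[mu]_(x in D) (w x * t x ^+ k) = 0) ->
  forall A, measurable A -> \int[mu]_(x in D) (w x * \1_A (t x)) = 0.
Proof.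
move=> bt iw M0 A mA; have [mt [B tB]] := bt.
pose C := `|B| + 1; have C0 : 0 < C by rewrite ltr_wpDl.
pose s x := (2 * C)^-1 * (t x + C).
have sE x : s x * (2 * C) - C = t x by rewrite /s; field; rewrite gt_eqF.
have bs : bmeas s.
  by apply: bmeasM; [exact: bmeas_cst|apply: bmeasD => //; exact: bmeas_cst].
have mA' : measurable ((fun y : R => y * (2 * C) - C) @^-1` A).
  rewrite -[X in measurable X]setTI.
  have : measurable_fun setT (fun y : R => y * (2 * C) - C).
    by apply: measurable_funB => //; apply: measurable_funM.
  by apply.
have := @moments_unit_interval _ _ _ mu D mD w s bs.1 _ iw _ _ mA'.
rewrite -Rintegral_setI_preimage.
rewrite (_ : s @^-1` _ = t @^-1` A); last first.
  by apply/seteqP; split=> x /=; rewrite sE.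
apply.
- move=> x Dx; have := tB x Dx; rewrite ler_norml => /andP[t1 t2].
  have BB := ler_norm B.
  have t3 : - C <= t x <= C by rewrite /C; apply/andP; split; lra.
  rewrite /s mulrC; case/andP: t3 => t3 t4; apply/andP; split.
    by rewrite divr_ge0 ?mulr_ge0 ?(ltW C0)//; lra.
  by rewrite ler_pdivrMr ?mulr_gt0//; lra.
- move=> k; pose p : {poly R} := ((2 * C)^-1 *: ('X + C%:P)) ^+ k.
  transitivity (\int[mu]_(x in D) (w x * (1 * p.[t x]))).
    by apply: eq_Rintegral => x _; rewrite /p horner_exp hornerZ hornerD hornerX hornerC mul1r.
  rewrite Rintegral_poly//; last exact: bmeas_cst.
  rewrite big1// => i _; under eq_Rintegral do rewrite mul1r.
  by rewrite M0 mulr0.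
Qed.

Lemma prod_moments_neq0_bounded B t (ws : seq (T -> R)) :
  measurable_fun D t -> (forall x, D x -> 0 <= t x <= B) ->
  (forall w, w \in ws -> integ w) ->
  (forall w, w \in ws -> exists k, \int[mu]_(x in D) (w x * t x ^+ k.+1) != 0) ->
  exists k, forall w, w \in ws -> \int[mu]_(x in D) (w x * t x ^+ k) != 0.
Proof.
move=> mt tB iws H.
pose C := `|B| + 1; have C0 : 0 < C by rewrite ltr_wpDl.
pose s x := C^-1 * t x.
have bt : bmeas t.
  by split=> //; exists B => x /tB /andP[t0 t1]; rewrite ger0_norm.
have sk w k : w \in ws -> \int[mu]_(x in D) (w x * s x ^+ k) =
    (C^-1) ^+ k * \int[mu]_(x in D) (w x * t x ^+ k).
  move=> /iws iw; rewrite -Rintegral_bmeasZ//; last exact: bmeasX.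
  by apply: eq_Rintegral => x _; rewrite /s exprMn.
have Ck k : (C^-1) ^+ k != 0 by rewrite expf_neq0// invr_eq0 gt_eqF.
have [||k|k Hk] := @prod_moments_neq0 _ _ _ mu D mD s _ _ ws iws.
- by apply: measurable_funM.
- move=> x /tB /andP[t0 t1]; have BB := ler_norm B.
  rewrite /s mulrC divr_ge0 ?(ltW C0)//= ler_pdivrMr// mul1r /C; lra.
- by move=> kws; have [j Hj] := H _ kws; exists j; rewrite sk// mulf_neq0.
by exists k => w wws; have := Hk w wws; rewrite sk// mulf_eq0 negb_or => /andP[].
Qed.

Lemma multi_prod_moments_neq0 n B (t : 'I_n -> T -> R) (ws : seq (T -> R)) :
  (forall i, measurable_fun D (t i)) -> (forall i x, D x -> 0 <= t i x <= B) ->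
  (forall w, w \in ws -> integ w) ->
  (forall w, w \in ws -> exists g : nat -> nat,
     \int[mu]_(x in D) (w x * \prod_i t i x ^+ (g i).+1) != 0) ->
  exists g : nat -> nat, forall w, w \in ws ->
    \int[mu]_(x in D) (w x * \prod_i t i x ^+ g i) != 0.
Proof.
move=> mt tB iws H.
have bt i : bmeas (t i).
  by split=> //; exists B => x /(tB i) /andP[t0 t1]; rewrite ger0_norm.
have bprod (P : pred 'I_n) (f : 'I_n -> nat) :
    bmeas (fun x => \prod_(i | P i) t i x ^+ f i).
  rewrite /index_enum; elim: (Finite.enum _) => [|i r IH].
    by apply: eq_bmeas (bmeas_cst D 1) => x; rewrite big_nil.
  case Pi : (P i).
    by apply: eq_bmeas (bmeasM (bmeasX (f i) (bt i)) IH) => x; rewrite big_cons Pi.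
  by apply: eq_bmeas IH => x; rewrite big_cons Pi.
(* The exponents of index below [r] are already common to all weights. The others still depend on
   [w] and are kept positive, as the one-variable lemma asks. *)
suff key r : (r <= n)%N -> exists k : nat -> nat, forall w, w \in ws ->
    exists g : nat -> nat, \int[mu]_(x in D) (w x *
      \prod_i t i x ^+ (if (i < r)%N then k i else (g i).+1)) != 0.
  have [k Hk] := key n (leqnn n); exists k => w /Hk[g].
  by under eq_Rintegral do under eq_bigr do rewrite ltn_ord.
elim: r => [|r IH] rn; first by exists id.
have [k Hk] := IH (ltnW rn).
have /choice[G HG] : forall w, exists g : nat -> nat, w \in ws ->
    \int[mu]_(x in D) (w x *
      \prod_i t i x ^+ (if (i < r)%N then k i else (g i).+1)) != 0.
  move=> w; have [/Hk[g Hg]|] := boolP (w \in ws); first by exists g.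
  by exists id.
pose o := Ordinal rn.
(* All variables except the [r]-th are absorbed into the weight. *)
pose v w x := w x * \prod_(i | i != o) t i x ^+ (if (i < r)%N then k i else (G w i).+1).
have vE w x j : v w x * t o x ^+ j = w x * \prod_i t i x ^+
    (if (i < r.+1)%N then (if val i == r then j else k i) else (G w i).+1).
  rewrite /v [in RHS](bigD1 o)//= ltnSn eqxx -mulrA [in RHS](mulrC (t o x ^+ j)).
  congr (_ * (_ * _)); apply: eq_bigr => i io.
  have /negbTE ir : val i != r by apply: contra io => /eqP ir; apply/eqP/val_inj.
  by rewrite ltnS (leq_eqVlt i r); move: ir; case: eqP.
have [||||j Hj] := @prod_moments_neq0_bounded B (t o) [seq v w | w <- ws].
- exact: mt.
- by move=> x; exact: tB.
- by move=> _ /mapP[w wws ->]; apply: integrable_bmeas; [exact: mD|exact: iws|exact: bprod].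
- move=> _ /mapP[w wws ->]; exists (G w r); under eq_Rintegral do rewrite vE.
  have := HG w wws; congr (is_true (~~ (_ == _))).
  apply: eq_Rintegral => x _; congr (_ * _); apply: eq_bigr => i _.
  by rewrite ltnS (leq_eqVlt i r); case: eqP => //= ->; rewrite ltnn.
exists (fun i => if i == r then j else k i) => w wws; exists (G w).
by have := Hj _ (map_f _ wws); under eq_Rintegral do rewrite vE.
Qed.

End moments_several_variables.

(** * Lebesgue measure on C^n *)

Section measure_preserving.
Context d (T : measurableType d) (R : realType).

Definition measure_preserving (m : set T -> \bar R) (f : T -> T) :=
  measurable_fun setT f /\ forall A, measurable A -> m (f @^-1` A) = m A.

Lemma measure_preserving_id m : measure_preserving m id.
Proof. by split. Qed.

Lemma measure_preserving_comp m f g :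
  measure_preserving m f -> measure_preserving m g -> measure_preserving m (f \o g).
Proof.
move=> [mf pf] [mg pg]; split; first exact: measurableT_comp.
move=> A mA; rewrite comp_preimage pg ?pf//.
by rewrite -[X in measurable X]setTI; exact: mf.
Qed.

End measure_preserving.

Section sigma_finite_measure.
Context d (T : measurableType d) (R : realType).
Variables (m : {measure set T -> \bar R}) (sf : sigma_finite setT m).

(* The phantom argument is what lets the instances below find the proof [sf]. *)
Definition sigma_finite_measure_of of sigma_finite setT m := m : set T -> \bar R.
Local Notation m' := (sigma_finite_measure_of sf).

HB.instance Definition _ := Measure.on m'.
HB.instance Definition _ := Measure_isSigmaFinite.Build _ _ _ m' sf.

End sigma_finite_measure.

Section skew_products.
Context d1 d2 (T1 : measurableType d1) (T2 : measurableType d2) (R : realType).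
Local Open Scope ereal_scope.

Lemma measure_preserving_skew1 (m1 : {measure set T1 -> \bar R})
    (m2 : {sigma_finite_measure set T2 -> \bar R}) f (g : T1 -> T2 -> T2) :
  measure_preserving m1 f -> (forall x, measure_preserving m2 (g x)) ->
  measurable_fun setT (fun p : T1 * T2 => g p.1 p.2) ->
  measure_preserving (m1 \x m2) (fun p => (f p.1, g p.1 p.2)).
Proof.
move=> [mf pf] pg mg; split.
  apply/measurable_fun_pairP; split => /=; first exact: (measurableT_comp mf).
  exact: mg.
move=> A mA; rewrite /product_measure1.
transitivity (\int[m1]_x ((m2 \o xsection A) \o f) x).
  apply: eq_integral => x _ /=; rewrite -[RHS](pg x).2; last exact: measurable_xsection.
  by congr (m2 _); apply/seteqP; split => y; rewrite /xsection /= ?inE.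
have mphi := measurable_fun_xsection m2 mA.
transitivity (\int[pushforward m1 f]_(x in setT) (m2 \o xsection A) x).
  by rewrite ge0_integral_pushforward.
by apply: eq_measure_integral => B mB _; exact: pf.
Qed.

Lemma sigma_finite_product_measure1 (m1 : {sigma_finite_measure set T1 -> \bar R})
    (m2 : {sigma_finite_measure set T2 -> \bar R}) : sigma_finite setT (m1 \x m2).
Proof.
have /sigma_finiteP[F [TF ndF finF]] := sigma_finiteT m1.
have /sigma_finiteP[G [TG ndG finG]] := sigma_finiteT m2.
exists (fun n => F n `*` G n); last first.
  move=> n; have [mF Foo] := finF n; have [mG Goo] := finG n.
  split; first exact: measurableX.
  by rewrite product_measure1E// lte_mul_pinfty// ge0_fin_numE.
apply/esym/seteqP; split=> // -[x y] _.
have [i _ Fx] : (\bigcup_n F n) x by rewrite -TF.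
have [j _ Gy] : (\bigcup_n G n) y by rewrite -TG.
exists (maxn i j) => //; split => /=.
- by have /subsetPset := ndF _ _ (leq_maxl i j); apply.
- by have /subsetPset := ndG _ _ (leq_maxr i j); apply.
Qed.

(** Sections have to be taken in the other order than in the definition of the product measure. The
    two iterated measures agree by uniqueness, which is where sigma-finiteness of [m1] enters. *)
Lemma measure_preserving_skew2 (m1 : {measure set T1 -> \bar R})
    (m2 : {sigma_finite_measure set T2 -> \bar R}) (g : T2 -> T1 -> T1) :
  sigma_finite setT m1 ->
  (forall y, measure_preserving m1 (g y)) ->
  measurable_fun setT (fun p : T1 * T2 => g p.2 p.1) ->
  measure_preserving (m1 \x m2) (fun p => (g p.2 p.1, p.2)).
Proof.
move=> sf1 pg mg.
pose m1' : {sigma_finite_measure set T1 -> \bar R} :=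
  sigma_finite_measure_of sf1.
have mS : measurable_fun setT (fun p : T1 * T2 => (g p.2 p.1, p.2)).
  by apply/measurable_fun_pairP; split; [exact: mg|exact: measurable_snd].
split=> // A mA.
have E B : measurable B -> (m1 \x m2) B = (m1 \x^ m2) B.
  have := @product_measure_unique _ _ _ _ _ m1' m2 (m1' \x^ m2)%E.
  by apply => U V mU mV; exact: product_measure2E.
rewrite !E//; last by rewrite -[X in measurable X]setTI; exact: mS.
rewrite /product_measure2; apply: eq_integral => y _ /=.
rewrite -[RHS](pg y).2; last exact: measurable_ysection.
by congr (m1 _); apply/seteqP; split => x; rewrite /ysection /= ?inE.
Qed.

End skew_products.

Section lebesgue_translation.
Variable R : realType.

Lemma measure_preserving_translation (a : R) :
  measure_preserving (@lebesgue_measure R) (fun x => x + a).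
Proof.
have mf : measurable_fun setT (fun x : R => x + a) by exact: measurable_funD.
split=> // A mA.
pose nu := measure_function_pushforward__canonical__measure_function_Measure
  (@lebesgue_measure R) (mf : measurable_fun setT (_ : _ -> measurableTypeR R)).
apply/esym; apply: (@lebesgue_measure_unique R nu _ A mA).
move=> _ [[b c] _ <-].
suff : lebesgue_measure [set` `]b, c]] =
    lebesgue_measure ((fun x : R => x + a) @^-1` [set` `]b, c]]) by [].
have -> : (fun x : R => x + a) @^-1` [set` `]b, c]] = [set` `]b - a, c - a]].
  by apply/seteqP; split => x /=; rewrite !in_itv/= ltrBlDr lerBrDr.
rewrite !lebesgue_measure_itv/= !lte_fin ltrD2r; case: ifP => // _.
by rewrite -!EFinB; congr (_%:E); ring.
Qed.
End lebesgue_translation.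

(** * Measurability of complex-valued functions *)

Section complex_measurability.
Context d (T : measurableType d) (R : realType).
Implicit Types (f g : T -> R[i]) (D : set T).

Lemma measurable_Re : measurable_fun setT (@complex.Re R).
Proof.
move=> _ A mA; rewrite setTI; apply: sub_sigma_algebra; left.
by exists A => //; rewrite setTI.
Qed.

Lemma measurable_Im : measurable_fun setT (@complex.Im R).
Proof.
move=> _ A mA; rewrite setTI; apply: sub_sigma_algebra; right.
by exists A => //; rewrite setTI.
Qed.

Lemma measurable_fun_complexP D f : measurable D ->
  measurable_fun D f <-> measurable_fun D (fun x => complex.Re (f x)) /\
                         measurable_fun D (fun x => complex.Im (f x)).
Proof.
move=> mD; split => [mf|[mr mi]].
  by split; [exact: (measurableT_comp measurable_Re)|exact: (measurableT_comp measurable_Im)].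
apply: measurability => // _ [B [] [C mC <-] <-]; rewrite !setTI.
  exact: mr.
exact: mi.
Qed.

Lemma measurable_funM_complex D f g : measurable D ->
  measurable_fun D f -> measurable_fun D g -> measurable_fun D (fun x => f x * g x).
Proof.
move=> mD /(measurable_fun_complexP f mD)[fr fi] /(measurable_fun_complexP g mD)[gr gi].
apply/(measurable_fun_complexP _ mD); split.
- apply: (eq_measurable_fun (fun x => complex.Re (f x) * complex.Re (g x) -
    complex.Im (f x) * complex.Im (g x))).
    by move=> x _; case: (f x) => a b; case: (g x).
  by apply: measurable_funB; exact: measurable_funM.
- apply: (eq_measurable_fun (fun x => complex.Re (f x) * complex.Im (g x) +
    complex.Im (f x) * complex.Re (g x))).
    by move=> x _; case: (f x) => a b; case: (g x).
  by apply: measurable_funD; exact: measurable_funM.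
Qed.

Lemma measurable_funD_complex D f g : measurable D ->
  measurable_fun D f -> measurable_fun D g -> measurable_fun D (fun x => f x + g x).
Proof.
move=> mD /(measurable_fun_complexP f mD)[fr fi] /(measurable_fun_complexP g mD)[gr gi].
apply/(measurable_fun_complexP _ mD); split.
- apply: (eq_measurable_fun (fun x => complex.Re (f x) + complex.Re (g x))).
    by move=> x _; case: (f x) => a b; case: (g x).
  exact: measurable_funD.
- apply: (eq_measurable_fun (fun x => complex.Im (f x) + complex.Im (g x))).
    by move=> x _; case: (f x) => a b; case: (g x).
  exact: measurable_funD.
Qed.

Lemma measurable_fun_conjc D f : measurable D ->
  measurable_fun D f -> measurable_fun D (fun x => conjc (f x)).
Proof.
move=> mD /(measurable_fun_complexP f mD)[fr fi].
apply/(measurable_fun_complexP _ mD); split.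
- by apply: (eq_measurable_fun (fun x => complex.Re (f x))) => // x _; case: (f x).
- apply: (eq_measurable_fun (fun x => - complex.Im (f x))).
    by move=> x _; case: (f x).
  exact: measurableT_comp.
Qed.

End complex_measurability.

(** * Boxes, null hyperplanes and rotations *)

Section lebesgue_Cn.
Variable R : realType.
Local Notation C := R[i].

Definition scale_coords n (u : 'I_n -> C) (z : 'rV[C]_n) : 'rV[C]_n :=
  \row_j (u j * z 0 j).

Lemma measurable_scale_coords n (u : 'I_n -> C) :
  measurable_fun setT (scale_coords u).
Proof.
apply: measurable_fun_matrix => i j.
apply: (eq_measurable_fun (fun z : 'rV[C]_n => u j * z 0 j)).
  by move=> z _; rewrite mxE.
by apply: measurable_funM_complex => //; exact: measurable_entry.
Qed.

Definition box n (I J : 'I_n -> set R) : set 'rV[C]_n :=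
  [set z | forall j, I j (complex.Re (z 0 j)) /\ J j (complex.Im (z 0 j))].

Lemma measurable_coord n j (A : set C) : measurable A ->
  measurable [set z : 'rV[C]_n | A (z 0 j)].
Proof.
move=> mA; have := @measurable_entry _ C 1 n 0 j measurableT A mA.
by rewrite setTI.
Qed.

Lemma measurable_box n (I J : 'I_n -> set R) :
  (forall j, measurable (I j)) -> (forall j, measurable (J j)) ->
  measurable (box I J).
Proof.
move=> mI mJ.
have -> : box I J = \bigcap_(j in [set: 'I_n])
   ([set z | ((@complex.Re R) @^-1` I j) (z 0 j)] `&`
    [set z | ((@complex.Im R) @^-1` J j) (z 0 j)]).
  by apply/seteqP; split => z H j; [move=> _; exact: H|exact: H].
apply: fin_bigcap_measurable => // j _; apply: measurableI; apply: measurable_coord.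
  by rewrite -[X in measurable X]setTI; exact: measurable_Re.
by rewrite -[X in measurable X]setTI; exact: measurable_Im.
Qed.

Lemma lebesgue_Cn_box n (I J : 'I_n -> set R) (a b : 'I_n -> R) :
  (forall j, measurable (I j)) -> (forall j, measurable (J j)) ->
  (forall j, lebesgue_measure (I j) = (a j)%:E) ->
  (forall j, lebesgue_measure (J j) = (b j)%:E) ->
  lebesgue_Cn R n (box I J) = (\prod_j (a j * b j))%:E.
Proof.
elim: n I J a b => [|n IH] I J a b mI mJ Ia Jb.
  by rewrite /= big_ord0 diracE mem_set// => -[].
rewrite /= /extend_measure /pushforward.
have -> : @add_coord R n @^-1` box I J =
    (box (I \o lift ord0) (J \o lift ord0) `*` I ord0) `*` J ord0.
  apply/seteqP; split => [[[p x] y] H|[[p x] y] [[/= H1 H2] H3]].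
    split=> [|/=]; last by have := (H ord0).2; rewrite mxE unlift_none.
    split=> /=; last by have := (H ord0).1; rewrite mxE unlift_none.
    by move=> j; have := H (lift ord0 j); rewrite !mxE liftK.
  move=> j; rewrite mxE; case: unliftP => [k ->|->]//=; exact: H1.
have mb : measurable (box (I \o lift ord0) (J \o lift ord0)).
  by apply: measurable_box => j; [exact: mI|exact: mJ].
have mI0 : @measurable _ (measurableTypeR R) (I ord0) := mI ord0.
have mJ0 : @measurable _ (measurableTypeR R) (J ord0) := mJ ord0.
rewrite (product_measure1E _ _ (measurableX mb mI0) mJ0).
rewrite [X in (X * _)%E](product_measure1E _ _ mb mI0).
rewrite (IH _ _ (a \o lift ord0) (b \o lift ord0) (fun j => mI _) (fun j => mJ _)
  (fun j => Ia _) (fun j => Jb _)).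
transitivity ((\prod_j (a (lift ord0 j) * b (lift ord0 j)))%:E * (a ord0)%:E * (b ord0)%:E)%E.
  by congr (_ * _ * _)%E; [exact: Ia|exact: Jb].
by rewrite -!EFinM big_ord_recl; congr (_%:E); ring.
Qed.

Definition cube n (p : 'rV[C]_n) (r : R) : set 'rV[C]_n :=
  box (fun j => ball (complex.Re (p 0 j)) r) (fun j => ball (complex.Im (p 0 j)) r).

Lemma measurable_cube n (p : 'rV[C]_n) r : measurable (cube p r).
Proof. by apply: measurable_box => j; exact: measurable_ball. Qed.

Lemma lebesgue_Cn_cube n (p : 'rV[C]_n) r : 0 <= r ->
  lebesgue_Cn R n (cube p r) = (\prod_(j < n) (r *+ 2 * r *+ 2))%:E.
Proof.
move=> r0; rewrite (@lebesgue_Cn_box _ _ _ (fun=> r *+ 2) (fun=> r *+ 2))//.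
- by rewrite mulrnAr.
- by move=> j; exact: measurable_ball.
- by move=> j; exact: measurable_ball.
- by move=> j; exact: lebesgue_measure_ball.
- by move=> j; exact: lebesgue_measure_ball.
Qed.

Lemma sigma_finite_lebesgue_Cn n : sigma_finite setT (lebesgue_Cn R n).
Proof.
exists (fun k => cube 0 k%:R); last first.
  by move=> k; split; [exact: measurable_cube|rewrite lebesgue_Cn_cube// ltry].
apply/esym/seteqP; split=> // z _.
pose M := \sum_j (`|complex.Re (z 0 j)| + `|complex.Im (z 0 j)|).
exists (Num.truncn M).+1 => // j.
have H : `|complex.Re (z 0 j)| + `|complex.Im (z 0 j)| < (Num.truncn M).+1%:R.
  apply: (le_lt_trans _ (truncnS_gt M)).
  by rewrite /M (bigD1 j)//= lerDl sumr_ge0// => i _; rewrite addr_ge0.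
rewrite !mxE /= /ball /= !sub0r !normrN; split.
- by apply: le_lt_trans H; rewrite lerDl.
- by apply: le_lt_trans H; rewrite lerDr.
Qed.

Lemma lebesgue_Cn_coord0 n (j : 'I_n) :
  lebesgue_Cn R n [set z : 'rV[C]_n | z 0 j = 0] = 0%E.
Proof.
have mz m (k : 'I_m) : measurable [set z : 'rV[C]_m | z 0 k = 0].
  apply: (measurable_coord k (A := [set 0])).
  rewrite (_ : [set 0] = (@complex.Re R) @^-1` [set 0] `&` (@complex.Im R) @^-1` [set 0]).
    by apply: measurableI; rewrite -[X in measurable X]setTI;
      [exact: measurable_Re|exact: measurable_Im].
  by apply/seteqP; split => [_ ->//|[x y] [/= -> ->]].
elim: n j => [[]//|n IH] j.
rewrite /= /extend_measure /pushforward.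
case: (unliftP ord0 j) => [k ->|->].
  have -> : @add_coord R n @^-1` [set z : 'rV[C]_n.+1 | z 0 (lift ord0 k) = 0] =
     ([set z : 'rV[C]_n | z 0 k = 0] `*` [set: R]) `*` [set: R].
    apply/seteqP; split => [[[p x] y] /=|[[p x] y] [[/= H _] _]]; rewrite mxE liftK//.
  have mT : @measurable _ (measurableTypeR R) [set: R] by exact: measurableT.
  rewrite (product_measure1E _ _ (measurableX (mz n k) mT) mT).
  rewrite [X in (X * _)%E](product_measure1E _ _ (mz n k) mT).
  by rewrite [X in (X * _ * _)%E]IH !mul0e.
have -> : @add_coord R n @^-1` [set z : 'rV[C]_n.+1 | z 0 ord0 = 0] =
    ([set: 'rV[C]_n] `*` [set (0 : R)]) `*` [set (0 : R)].
  apply/seteqP; split => [[[p x] y] /=|[[p x] y] [[/= _ ->] ->]]; rewrite mxE unlift_none//=.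
  by case=> -> ->.
have m0 : @measurable _ (measurableTypeR R) [set (0 : R)] by exact: measurable_set1.
rewrite (product_measure1E _ _ (measurableX measurableT m0) m0).
by rewrite [X in (_ * X)%E](lebesgue_measure_set1 (0 : R)) mule0.
Qed.

Definition rot2 n (c s : R) (q : 'rV[C]_n * R * R) : 'rV[C]_n * R * R :=
  ((q.1.1, c * q.1.2 - s * q.2), s * q.1.2 + c * q.2).

Section rotation.
Variables (n : nat) (mu : {sigma_finite_measure set 'rV[C]_n -> \bar R}).
Local Notation m1 := (mu \x @lebesgue_measure R)%E.
Local Notation m2 := (m1 \x @lebesgue_measure R)%E.

Let shear2 (b : R) :
  measure_preserving m2 (fun q => (q.1, q.2 + b * q.1.2)).
Proof.
have := @measure_preserving_skew1 _ _ _ _ R m1 (@lebesgue_measure R) id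
  (fun (q : 'rV[C]_n * R) (y : R) => y + b * q.2).
apply.
- exact: measure_preserving_id.
- by move=> q; exact: measure_preserving_translation.
- apply: measurable_funD; first exact: measurable_snd.
  apply: measurable_funM => //; apply: (measurableT_comp measurable_snd).
  exact: measurable_fst.
Qed.

Let shear1 (b : R) :
  measure_preserving m2 (fun q => ((q.1.1, q.1.2 + b * q.2), q.2)).
Proof.
have := @measure_preserving_skew2 _ _ _ _ R m1 (@lebesgue_measure R)
  (fun (y : R) (q : 'rV[C]_n * R) => (q.1, q.2 + b * y)).
apply.
- exact: sigma_finite_product_measure1.
- move=> y; have := @measure_preserving_skew1 _ _ _ _ R mu (@lebesgue_measure R) id
     (fun (p : 'rV[C]_n) (x : R) => x + b * y).
  apply.
  + exact: measure_preserving_id.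
  + by move=> q; exact: measure_preserving_translation.
  + by apply: measurable_funD => //; exact: measurable_snd.
- apply/measurable_fun_pairP; split => /=.
    exact: (measurableT_comp measurable_fst measurable_fst).
  apply: measurable_funD.
    exact: (measurableT_comp measurable_snd measurable_fst).
  by apply: measurable_funM => //; exact: measurable_snd.
Qed.

(** A rotation with nonzero sine is a product of three shears, [t] being minus the tangent of half
    the angle, and a shear translates each line. The half turn is the square of a quarter turn. *)
Lemma measure_preserving_rot2 (c s : R) : c ^+ 2 + s ^+ 2 = 1 ->
  measure_preserving m2 (rot2 c s).
Proof.
have gen (a b : R) : a ^+ 2 + b ^+ 2 = 1 -> b != 0 -> measure_preserving m2 (rot2 a b).
  move=> ab b0; pose t := - ((1 - a) / b).
  have := measure_preserving_comp (shear1 t)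
    (measure_preserving_comp (shear2 b) (shear1 t)).
  congr measure_preserving; apply/funext => -[[p x] y] /=; rewrite /rot2 /=.
  have b2 : b ^+ 2 = 1 - a ^+ 2 by rewrite -ab addrC addKr.
  have E : y + b * (x + t * y) = b * x + a * y.
    by rewrite /t; field.
  rewrite E; congr ((_, _), _).
  have -> : x + t * y + t * (b * x + a * y) = x * (1 + t * b) + t * (1 + a) * y by ring.
  have tb : t * b = a - 1 by rewrite /t; field.
  have -> : t * (1 + a) = - b.
    apply: (mulIf b0); transitivity (t * b * (1 + a)); first by ring.
    by rewrite tb; transitivity (- b ^+ 2); [rewrite b2; ring|ring].
  by rewrite tb; ring.
move=> cs; have [s0|] := eqVneq s 0; last exact: gen.
have /eqP : c ^+ 2 = 1 by rewrite -cs s0 expr0n addr0.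
rewrite sqrf_eq1 => /orP[/eqP c1|/eqP c1].
  have := measure_preserving_id m2; congr measure_preserving.
  by apply/funext => -[[p x] y]; rewrite /rot2 c1 s0 /= !mul1r !mul0r subr0 add0r.
have i0 : 0 ^+ 2 + 1 ^+ 2 = 1 :> R by rewrite expr0n add0r expr1n.
have := measure_preserving_comp (gen 0 1 i0 (oner_neq0 _)) (gen 0 1 i0 (oner_neq0 _)).
congr measure_preserving.
apply/funext => -[[p x] y]; rewrite /rot2 c1 s0 /=; congr ((_, _), _); ring.
Qed.

End rotation.

Lemma measure_preserving_rotation n (u : 'I_n -> C) :
  (forall j, complex.Re (u j) ^+ 2 + complex.Im (u j) ^+ 2 = 1) ->
  measure_preserving (lebesgue_Cn R n) (scale_coords u).
Proof.
elim: n u => [|n IH] u u1.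
  split; first exact: measurable_scale_coords.
  by move=> A mA; congr (lebesgue_Cn _ _ _); apply/seteqP; split => z; rewrite /preimage /= (thinmx0 (scale_coords u z)) (thinmx0 z).
split; first exact: measurable_scale_coords.
move=> A mA.
pose mu : {sigma_finite_measure set 'rV[C]_n -> \bar R} :=
  sigma_finite_measure_of (sigma_finite_lebesgue_Cn n).
pose S1 (q : 'rV[C]_n * R * R) := ((scale_coords (u \o lift ord0) q.1.1, q.1.2), q.2).
pose c := complex.Re (u ord0); pose s := complex.Im (u ord0).
have mpS1 : measure_preserving (mu \x @lebesgue_measure R \x @lebesgue_measure R)%E S1.
  have := @measure_preserving_skew1 _ _ _ _ R (mu \x @lebesgue_measure R)%E (@lebesgue_measure R)
    (fun q : 'rV[C]_n * R => (scale_coords (u \o lift ord0) q.1, q.2)) (fun _ (y : R) => y).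
  apply.
  - have := @measure_preserving_skew1 _ _ _ _ R mu (@lebesgue_measure R)
      (scale_coords (u \o lift ord0)) (fun _ (y : R) => y).
    apply.
    + by apply: IH => j; exact: u1.
    + by move=> _; exact: measure_preserving_id.
    + exact: measurable_snd.
  - by move=> _; exact: measure_preserving_id.
  - exact: measurable_snd.
have := measure_preserving_comp mpS1 (measure_preserving_rot2 mu (u1 ord0)).
move=> [_ H]; rewrite /= /extend_measure /pushforward.
have mB : measurable (@add_coord R n @^-1` A).
  by rewrite -[X in measurable X]setTI; exact: measurable_add_coord.
rewrite -(H _ mB); congr (_ _); apply/funext => -[[p x] y].
rewrite /preimage /=; congr (A _); apply/rowP => j.
rewrite !mxE; case: unliftP => [k ->|->] /=; first by rewrite mxE.
by case: (u ord0) => a b /=; rewrite [X in _ = _ +i* X]addrC.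
Qed.

End lebesgue_Cn.

(** * The real-valued modulus and the topology of C^n *)

Section complex_modulus.
Variable R : realType.
Implicit Types (z w : R[i]).

(** The norm of [z] is an element of [R[i]]; limits and estimates below are stated in [R]. *)
Definition cabs z : R := complex.Re `|z|.

Lemma normc_cabs z : `|z| = (cabs z)%:C.
Proof. by rewrite /cabs normc_def. Qed.

Lemma cabsE z : cabs z = Num.sqrt (complex.Re z ^+ 2 + complex.Im z ^+ 2).
Proof. by rewrite /cabs normc_def. Qed.

Lemma cabs_sqr z : cabs z ^+ 2 = complex.Re z ^+ 2 + complex.Im z ^+ 2.
Proof. by rewrite cabsE sqr_sqrtr// addr_ge0// sqr_ge0. Qed.

Lemma cabs_ge0 z : 0 <= cabs z.
Proof. by rewrite cabsE sqrtr_ge0. Qed.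

Lemma cabsM z w : cabs (z * w) = cabs z * cabs w.
Proof. by apply: complexI; rewrite rmorphM /= -!normc_cabs normrM. Qed.

Lemma cabsD z w : cabs (z + w) <= cabs z + cabs w.
Proof. by rewrite -lecR rmorphD /= -!normc_cabs ler_normD. Qed.

Lemma cabsN z : cabs (- z) = cabs z.
Proof. by apply: complexI; rewrite -!normc_cabs normrN. Qed.

Lemma cabsB z w : cabs (z - w) = cabs (w - z).
Proof. by rewrite -cabsN opprB. Qed.

Lemma cabsX z k : cabs (z ^+ k) = cabs z ^+ k.
Proof. by apply: complexI; rewrite rmorphXn /= -!normc_cabs normrX. Qed.

Lemma cabs0 : cabs 0 = 0.
Proof. by apply: complexI; rewrite -normc_cabs normr0. Qed.

Lemma cabs1 : cabs 1 = 1.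
Proof. by apply: complexI; rewrite -normc_cabs normr1. Qed.

Lemma cabs_eq0 z : (cabs z == 0) = (z == 0).
Proof. by rewrite -[RHS]normr_eq0 normc_cabs -(inj_eq (@complexI R)). Qed.

Lemma cabs_gt0 z : (0 < cabs z) = (z != 0).
Proof. by rewrite lt_neqAle cabs_ge0 andbT eq_sym cabs_eq0. Qed.

Lemma cabsV z : cabs z^-1 = (cabs z)^-1.
Proof. by apply: complexI; rewrite fmorphV /= -!normc_cabs normfV. Qed.

Lemma cabs_real (x : R) : cabs x%:C = `|x|.
Proof. by rewrite cabsE /= expr0n addr0 sqrtr_sqr. Qed.

Lemma cabsJ z : cabs (conjc z) = cabs z.
Proof. by rewrite !cabsE; case: z => a b /=; rewrite sqrrN. Qed.

Lemma Re_le_cabs z : `|complex.Re z| <= cabs z.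
Proof. by rewrite -ler_sqr ?nnegrE ?cabs_ge0// cabs_sqr real_normK ?num_real// lerDl sqr_ge0. Qed.

Lemma Im_le_cabs z : `|complex.Im z| <= cabs z.
Proof. by rewrite -ler_sqr ?nnegrE ?cabs_ge0// cabs_sqr real_normK ?num_real// lerDr sqr_ge0. Qed.

Lemma cabs_le_ReIm z : cabs z <= `|complex.Re z| + `|complex.Im z|.
Proof.
rewrite -ler_sqr ?nnegrE ?cabs_ge0 ?addr_ge0// cabs_sqr sqrrD !real_normK ?num_real//.
by rewrite addrAC lerDl mulrn_wge0// mulr_ge0.
Qed.

Lemma cabs_sum (I : Type) (r : seq I) (P : pred I) (F : I -> R[i]) :
  cabs (\sum_(i <- r | P i) F i) <= \sum_(i <- r | P i) cabs (F i).
Proof.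
elim/big_ind2 : _ => // [|x a y b xa yb]; first by rewrite cabs0.
exact: le_trans (cabsD _ _) (lerD xa yb).
Qed.

Lemma cabs_prod (I : Type) (r : seq I) (P : pred I) (F : I -> R[i]) :
  cabs (\prod_(i <- r | P i) F i) = \prod_(i <- r | P i) cabs (F i).
Proof.
elim/big_ind2 : _ => // [|x a y b xa yb]; first exact: cabs1.
by rewrite cabsM xa yb.
Qed.

Lemma mul_conjc_cabs z : z * conjc z = (cabs z ^+ 2)%:C.
Proof. by rewrite -sqr_normc normc_cabs -rmorphXn. Qed.

Lemma gt0_complexE (e : R[i]) : 0 < e -> exists2 r : R, 0 < r & e = r%:C.
Proof. by case: e => a b; rewrite ltcE /= => /andP[/eqP -> a0]; exists a. Qed.

End complex_modulus.

Section Cn_topology.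
Variables (R : realType) (n : nat).
Local Notation C := R[i].
Implicit Types (z w : 'rV[C]_n) (U : set 'rV[C]_n).

Definition polydisc z (r : R) : set 'rV[C]_n :=
  [set w : 'rV[C]_n | forall j, cabs (w 0 j - z 0 j) < r].

Lemma ball_polydisc z (r : R) : 0 < r -> ball z r%:C = polydisc z r.
Proof.
move=> r0; apply/seteqP; split => w; rewrite /ball /= /mx_ball.
  by move=> [_ H] j; have := H 0 j; rewrite /ball /= normc_cabs ltcR cabsB.
move=> H; split; first by rewrite ltcR.
by move=> i j; rewrite (ord1 i) /ball /= normc_cabs ltcR cabsB; exact: H.
Qed.

Lemma nbhs_polydisc z U : nbhs z U <-> exists2 r : R, 0 < r & polydisc z r `<=` U.
Proof.
split=> [/nbhs_ballP[e e0 eU]|[r r0 rU]].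
  have [r r0 er] := gt0_complexE e0.
  exists r; first exact: r0.
  rewrite -ball_polydisc; last exact: r0.
  by rewrite -er; exact: eU.
by apply/nbhs_ballP; exists r%:C; [rewrite /= ltcR|rewrite ball_polydisc].
Qed.

Lemma open_polydisc U z : open U -> U z -> exists2 r : R, 0 < r & polydisc z r `<=` U.
Proof. by move=> oU Uz; apply/nbhs_polydisc; apply: open_nbhs_nbhs; split. Qed.

Lemma cube_polydisc z (r : R) : cube z (r / 2) `<=` polydisc z r.
Proof.
move=> w H j; have [] := H j; rewrite /ball /= => H1 H2.
apply: (le_lt_trans (cabs_le_ReIm _)).
rewrite raddfB [complex.Im _]raddfB /= distrC [X in _ + X]distrC; lra.
Qed.

(** The sigma-algebra is generated by the coordinates and not by the topology, so [U] is written as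
    a countable union of cubes with rational centres. *)
Lemma open_measurable_Cn U : open U -> measurable U.
Proof.
move=> oU; pose rad (k : nat) : R := k.+1%:R^-1.
pose I := ({ffun 'I_n -> rat * rat} * nat)%type.
pose ctr (q : I) : 'rV[C]_n := \row_j (ratr (q.1 j).1 +i* ratr (q.1 j).2).
pose B (q : I) := if pselect (cube (ctr q) (rad q.2) `<=` U) then cube (ctr q) (rad q.2) else set0.
have -> : U = \bigcup_(k in [set: nat]) (if @unpickle I k is Some q then B q else set0).
  apply/seteqP; split => [z Uz|z [k _]]; last first.
    by case: unpickle => // q; rewrite /B; case: pselect => // /[apply].
  have [r r0 rU] := open_polydisc oU Uz.
  (* Points of the chosen cube differ from [z] by less than [2 rad k < r / 2] in each real
     coordinate, as [cube_polydisc] requires. *)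
  pose k := Num.truncn (4 / r).
  have kr : rad k < r / 4.
    rewrite /rad -[r / 4]invrK ltf_pV2 ?posrE ?invr_gt0 ?divr_gt0//.
    by rewrite invf_div; exact: truncnS_gt.
  have k0 : 0 < rad k by rewrite /rad invr_gt0.
  have /choice[q Hq] : forall j : 'I_n, exists q : rat * rat,
      `|ratr q.1 - complex.Re (z 0 j)| < rad k /\
      `|ratr q.2 - complex.Im (z 0 j)| < rad k.
    have ap (x : R) : exists q : rat, `|ratr q - x| < rad k.
      have lt : x - rad k < x + rad k by rewrite ltrD2l gtrN.
      have [q] := rat_in_itvoo lt; rewrite in_itv/= => q12; exists q; rewrite ltr_distl; exact: q12.
    move=> j; have [q1 H1] := ap (complex.Re (z 0 j)).
    by have [q2 H2] := ap (complex.Im (z 0 j)); exists (q1, q2).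
  pose p : I := ([ffun j => q j], k).
  exists (pickle p) => //; rewrite pickleK /B.
  have cz : cube (ctr p) (rad k) z.
    move=> j; have [H1 H2] := Hq j.
    by rewrite /ball /= !mxE ffunE /=; split.
  case: pselect => //= H; exfalso; apply: H => w wc; apply: rU; apply: cube_polydisc => j.
  have [H1 H2] := Hq j; have [] := wc j; rewrite /ball /= !mxE ffunE /= => H3 H4.
  split.
    apply: (@le_lt_trans _ _ (`|complex.Re (z 0 j) - ratr (q j).1| + `|ratr (q j).1 - complex.Re (w 0 j)|)).
      by apply: le_trans (ler_normD _ _); rewrite addrA subrK.
    by rewrite distrC; lra.
  apply: (@le_lt_trans _ _ (`|complex.Im (z 0 j) - ratr (q j).2| + `|ratr (q j).2 - complex.Im (w 0 j)|)).
    by apply: le_trans (ler_normD _ _); rewrite addrA subrK.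
  by rewrite distrC; lra.
apply: bigcup_measurable => k _; case: unpickle => // q.
by rewrite /B; case: (pselect _) => H /=; [exact: measurable_cube|exact: measurable0].
Qed.

Lemma lebesgue_Cn_open_gt0 U : open U -> U !=set0 -> (0 < lebesgue_Cn R n U)%E.
Proof.
move=> oU [z Uz]; have [r r0 rU] := open_polydisc oU Uz.
have H : cube z (r / 2) `<=` U by apply: subset_trans rU; exact: cube_polydisc.
apply: (@lt_le_trans _ _ (lebesgue_Cn R n (cube z (r / 2)))).
  rewrite lebesgue_Cn_cube ?divr_ge0 ?ltW// lte_fin prodr_gt0// => j _.
  by rewrite pmulrn_lgt0// mulr_gt0// ?pmulrn_lgt0// divr_gt0.
by apply: le_measure => //; rewrite inE; [exact: measurable_cube|exact: open_measurable_Cn].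
Qed.

Lemma bounded_set_cabs U : bounded_set U ->
  exists2 M : R, 0 < M & forall z, U z -> forall j, cabs (z 0 j) <= M.
Proof.
move=> [e [er He]].
pose M := `|complex.Re e| + 1.
exists (M + 1); first by rewrite addr_gt0// ltr_wpDl.
move=> z Uz j.
have eM : e < M%:C.
  rewrite -(RRe_real er) ltcR /M.
  by have := ler_norm (complex.Re e); lra.
have zM := He _ eM z Uz.
have : ball 0 (M + 1)%:C z.
  rewrite -ball_normE /ball_ /= sub0r normrN (le_lt_trans zM)// ltcR; lra.
rewrite ball_polydisc; last by rewrite addr_gt0// ltr_wpDl.
by move=> /(_ j); rewrite mxE subr0 => /ltW.
Qed.

Lemma lebesgue_Cn_bounded U : bounded_set U -> measurable U ->
  (lebesgue_Cn R n U < +oo)%E.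
Proof.
move=> /bounded_set_cabs[M M0 HM] mU.
apply: (@le_lt_trans _ _ (lebesgue_Cn R n (cube 0 (M + 1)))).
  apply: le_measure; rewrite ?inE//; first exact: measurable_cube.
  move=> z Uz j; have := HM z Uz j; rewrite /ball /= !mxE !sub0r !normrN => H.
  by split; [have := Re_le_cabs (z 0 j)|have := Im_le_cabs (z 0 j)]; lra.
by rewrite lebesgue_Cn_cube ?ltry// addr_ge0// ltW.
Qed.

End Cn_topology.

(** * Laurent coefficients on a Reinhardt domain *)

Section discrete_goursat.
Variable R : realType.
Local Notation C := R[i].
Variables (H : R -> R -> C) (A B : C).

Let pt (l a : nat) : R := a%:R / 2 ^+ l.

(* A discrete form of the contour integral around the cell with corner (a, b) of
   the grid of mesh 2^-m; it vanishes on affine functions with A dH/dx = B dH/dt. *)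
Let cell (F : R -> R -> C) m a b :=
  A * (F (pt m a.+1) (pt m b) - F (pt m a) (pt m b)) -
  B * (F (pt m a) (pt m b.+1) - F (pt m a) (pt m b)).

(** The cells of mesh [2^-(l+s)] in the dyadic square of side [2^-l]. The mesh is not a factor of
    [cell], so this is a Riemann sum of the contour integral multiplied by [2^(l+s)]. *)
Let S F l s a b := \sum_(i < 2 ^ s) \sum_(j < 2 ^ s)
  cell F (l + s) (a * 2 ^ s + i) (b * 2 ^ s + j).

(** Differentiability together with [A dH/dx = B dH/dt], the Cauchy-Riemann equation for a function
    of [B x + A t]. *)
Hypothesis dH : forall cx ct : R, 0 <= cx <= 1 -> 0 <= ct <= 1 ->
  forall e : R, 0 < e -> exists2 d : R, 0 < d & exists Lx Lt : C, A * Lx = B * Lt /\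
    forall x t : R, 0 <= x <= 1 -> 0 <= t <= 1 -> `|x - cx| + `|t - ct| < d ->
      cabs (H x t - H cx ct - ((x - cx)%:C * Lx + (t - ct)%:C * Lt)) <=
      e * (`|x - cx| + `|t - ct|).

Let S_split F l s a b : S F l s.+1 a b =
  S F l.+1 s a.*2 b.*2 + S F l.+1 s a.*2 b.*2.+1 +
  (S F l.+1 s a.*2.+1 b.*2 + S F l.+1 s a.*2.+1 b.*2.+1).
Proof.
have sp (G : nat -> C) c : \sum_(i < 2 ^ s.+1) G (c * 2 ^ s.+1 + i)%N =
    \sum_(i < 2 ^ s) G (c.*2 * 2 ^ s + i)%N + \sum_(i < 2 ^ s) G (c.*2.+1 * 2 ^ s + i)%N.
  rewrite expnS mul2n -addnn big_split_ord /=; congr (_ + _); apply: eq_bigr => i _.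
    by congr G; rewrite addnn -!mul2n; lia.
  by congr G; rewrite addnn -!mul2n; lia.
rewrite /S (sp (fun a' => \sum_(j < 2 ^ s.+1) cell F (l + s.+1) a' (b * 2 ^ s.+1 + j))).
by congr (_ + _); rewrite -big_split /=; apply: eq_bigr => i _;
  rewrite (sp (fun b' => cell F (l + s.+1) _ b')) addnS addSn.
Qed.

(** The sums telescope, so only boundary values remain: [2^s] on each side, which gives [2^s] in the
    bound instead of the [4^s] cells. *)
Let S_bound F l s a b (e : R) : 0 <= e ->
  (forall i j, (i <= 2 ^ s)%N -> (j <= 2 ^ s)%N ->
     cabs (F (pt (l + s) (a * 2 ^ s + i)) (pt (l + s) (b * 2 ^ s + j))) <= e) ->
  cabs (S F l s a b) <= 2 * e * (cabs A + cabs B) * 2 ^+ s.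
Proof.
move=> e0 HF.
have tele (G : nat -> C) M c : \sum_(i < M) (G (c + i.+1)%N - G (c + i)%N) = G (c + M)%N - G c.
  elim: M => [|M IH]; first by rewrite big_ord0 addn0 subrr.
  by rewrite big_ord_recr /= IH addrC subrKA.
have -> : S F l s a b =
    A * (\sum_(j < 2 ^ s) (F (pt (l + s) (a * 2 ^ s + 2 ^ s)) (pt (l + s) (b * 2 ^ s + j)) -
          F (pt (l + s) (a * 2 ^ s)) (pt (l + s) (b * 2 ^ s + j)))) -
    B * (\sum_(i < 2 ^ s) (F (pt (l + s) (a * 2 ^ s + i)) (pt (l + s) (b * 2 ^ s + 2 ^ s)) -
          F (pt (l + s) (a * 2 ^ s + i)) (pt (l + s) (b * 2 ^ s)))).
  rewrite /S /cell; under eq_bigr do rewrite sumrB.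
  rewrite sumrB; congr (_ - _).
    rewrite exchange_big mulr_sumr /=; apply: eq_bigr => j _.
    rewrite -mulr_sumr; congr (_ * _); under eq_bigr do rewrite -addnS.
    by rewrite (tele (fun i => F (pt (l + s) i) _)).
  rewrite mulr_sumr; apply: eq_bigr => i _.
  rewrite -mulr_sumr; congr (_ * _); under eq_bigr do rewrite -addnS.
  by rewrite (tele (fun j => F _ (pt (l + s) j))).
have sb (G1 G2 : nat -> C) : (forall i, (i <= 2 ^ s)%N -> cabs (G1 i) <= e) ->
    (forall i, (i <= 2 ^ s)%N -> cabs (G2 i) <= e) ->
    cabs (\sum_(i < 2 ^ s) (G1 i - G2 i)) <= 2 * e * 2 ^+ s.
  move=> h1 h2; apply: (le_trans (cabs_sum _ _ _)).
  apply: (@le_trans _ _ (\sum_(i < 2 ^ s) (2 * e))).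
    apply: ler_sum => i _; apply: (le_trans (cabsD _ _)); rewrite cabsN.
    have := h1 i (ltnW (ltn_ord i)); have := h2 i (ltnW (ltn_ord i)); lra.
  by rewrite sumr_const card_ord -[_ *+ _]mulr_natr natrX.
have z0 : (0 <= 2 ^ s)%N by [].
rewrite [leRHS](_ : _ = cabs A * (2 * e * 2 ^+ s) + cabs B * (2 * e * 2 ^+ s)); last by ring.
apply: (le_trans (cabsD _ _)); rewrite cabsN !cabsM; apply: lerD.
- apply: ler_wpM2l; first exact: cabs_ge0.
  apply: (sb (fun j => F _ (pt (l + s) (b * 2 ^ s + j))) (fun j => F _ (pt (l + s) (b * 2 ^ s + j)))) => j js.
    exact: HF.
  by have := HF 0%N j z0 js; rewrite addn0.
- apply: ler_wpM2l; first exact: cabs_ge0.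
  apply: (sb (fun i => F (pt (l + s) (a * 2 ^ s + i)) _) (fun i => F (pt (l + s) (a * 2 ^ s + i)) _)) => i si.
    exact: HF.
  by have := HF i 0%N si z0; rewrite addn0.
Qed.

(** Contour integral at most [e] times the area [4^-l] for fine meshes; in the scale of [S] this is
    [e 4^-l 2^(l+s) = e 2^s / 2^l]. *)
Let small (e : R) l a b := exists s0, forall s, (s0 <= s)%N ->
  cabs (S H l s a b) <= e * 2 ^+ s / 2 ^+ l.

Let small_split e l a b : small e l.+1 a.*2 b.*2 -> small e l.+1 a.*2 b.*2.+1 ->
  small e l.+1 a.*2.+1 b.*2 -> small e l.+1 a.*2.+1 b.*2.+1 -> small e l a b.
Proof.
move=> [s1 H1] [s2 H2] [s3 H3] [s4 H4].
exists (s1 + s2 + s3 + s4).+1%N => -[//|s] ss; rewrite S_split.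
have /H1 h1 : (s1 <= s)%N by lia.
have /H2 h2 : (s2 <= s)%N by lia.
have /H3 h3 : (s3 <= s)%N by lia.
have /H4 h4 : (s4 <= s)%N by lia.
apply: (@le_trans _ _ (4 * (e * 2 ^+ s / 2 ^+ l.+1))).
  apply: (le_trans (cabsD _ _)); apply: (le_trans (lerD (cabsD _ _) (cabsD _ _))).
  by lra.
rewrite le_eqVlt; apply/orP; left; apply/eqP; rewrite !exprS.
by field; rewrite expf_neq0.
Qed.

(** The affine part of [H] at [(cx, ct)] contributes nothing to any cell because [A Lx = B Lt]. The
    remainder is at most [2 e / 2^l] on the square, and [S_bound] applies to it. *)
Let small_local e l a b (cx ct : R) : 0 < e ->
  pt l a <= cx <= pt l a.+1 -> pt l b <= ct <= pt l b.+1 ->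
  forall d Lx Lt, A * Lx = B * Lt -> 2 / 2 ^+ l < d ->
  (a.+1 <= 2 ^ l)%N -> (b.+1 <= 2 ^ l)%N ->
  (forall x t : R, 0 <= x <= 1 -> 0 <= t <= 1 -> `|x - cx| + `|t - ct| < d ->
      cabs (H x t - H cx ct - ((x - cx)%:C * Lx + (t - ct)%:C * Lt)) <=
      e * (`|x - cx| + `|t - ct|)) ->
  small (4 * (cabs A + cabs B) * e) l a b.
Proof.
move=> e0 acx bct d Lx Lt AB ld al bl Hd; exists 0%N => s _.
pose E x t := H x t - H cx ct - ((x - cx)%:C * Lx + (t - ct)%:C * Lt).
have l0 : 0 < 2 ^+ l :> R by rewrite exprn_gt0.
have -> : S H l s a b = S E l s a b.
  apply: eq_bigr => i _; apply: eq_bigr => j _.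
  rewrite /cell /E.
  set m := (l + s)%N; set a' := (_ + i)%N; set b' := (_ + j)%N.
  have ptS k : pt m k.+1 = pt m k + (2 ^+ m)^-1 by rewrite /pt -natr1 mulrDl mul1r.
  rewrite !ptS; set u := (2 ^+ m)^-1.
  have e1 : (pt m a' + u - cx)%:C = (pt m a' - cx)%:C + u%:C by rewrite -rmorphD; congr (_%:C); ring.
  have e2 : (pt m b' + u - ct)%:C = (pt m b' - ct)%:C + u%:C by rewrite -rmorphD; congr (_%:C); ring.
  rewrite e1 e2.
  set r1 := (pt m a' - cx)%:C; set r2 := (pt m b' - ct)%:C; set r3 := u%:C.
  set h1 := H (pt m a' + u) _; set h2 := H (pt m a') (pt m b'); set h3 := H (pt m a') _.
  transitivity (A * (h1 - h2) - B * (h3 - h2) - r3 * (A * Lx - B * Lt)).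
    by rewrite AB subrr mulr0 subr0.
  ring.
have : cabs (S E l s a b) <= 2 * (2 * e / 2 ^+ l) * (cabs A + cabs B) * 2 ^+ s.
  apply: S_bound; first by rewrite divr_ge0 ?mulr_ge0// ltW.
  have bd c k (c0 : R) : pt l c <= c0 <= pt l c.+1 -> (c.+1 <= 2 ^ l)%N -> (k <= 2 ^ s)%N ->
      0 <= pt (l + s) (c * 2 ^ s + k) <= 1 /\
      `|pt (l + s) (c * 2 ^ s + k) - c0| <= (2 ^+ l)^-1.
    move=> /andP[c1 c2] cl ks.
    have -> : pt (l + s) (c * 2 ^ s + k) = pt l c + (k%:R / 2 ^+ s) / 2 ^+ l.
      rewrite /pt natrD natrM natrX exprD; field.
      by rewrite !expf_neq0.
    have k1 : 0 <= (k%:R / 2 ^+ s : R) <= 1.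
      rewrite divr_ge0//= ?exprn_ge0// ler_pdivrMr ?exprn_gt0// mul1r.
      by rewrite -natrX ler_nat.
    have ptS : pt l c.+1 = pt l c + 1 / 2 ^+ l by rewrite /pt -natr1 mulrDl.
    have k2 : 0 <= ((k%:R / 2 ^+ s) / 2 ^+ l : R) <= (2 ^+ l)^-1.
      case/andP: k1 => ? ?; rewrite divr_ge0//= ?(ltW l0)//.
      by rewrite -[leRHS]mul1r ler_wpM2r// invr_ge0 ltW.
    have pt0 : 0 <= pt l c by rewrite divr_ge0// ltW.
    have pt1 : pt l c.+1 <= 1 by rewrite ler_pdivrMr// mul1r -natrX ler_nat.
    rewrite ptS mul1r in c2 pt1.
    case/andP: k2; move: (k%:R / 2 ^+ s / 2 ^+ l) => v k2 k3.
    split; first by apply/andP; split; lra.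
    by rewrite ler_norml; apply/andP; split; lra.
  move=> i j si sj; have [x01 xc] := bd a i cx acx al si; have [t01 tc] := bd b j ct bct bl sj.
  have le2 : `|pt (l + s) (a * 2 ^ s + i) - cx| + `|pt (l + s) (b * 2 ^ s + j) - ct| <= 2 / 2 ^+ l.
    have -> : 2 / 2 ^+ l = (2 ^+ l)^-1 + (2 ^+ l)^-1 :> R by ring.
    exact: lerD.
  apply: (le_trans (Hd _ _ x01 t01 (le_lt_trans le2 ld))).
  by rewrite (mulrC 2) -mulrA ler_wpM2l// ltW.
move=> /le_trans; apply; rewrite le_eqVlt; apply/orP; left; apply/eqP.
by field; rewrite gt_eqF.
Qed.

(** Goursat's bisection: a square that is not [small] has a quarter that is not, and the nested
    quarters shrink to a point where [small_local] gives a contradiction. *)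
Lemma discrete_goursat (e : R) : 0 < e -> exists s0, forall s, (s0 <= s)%N ->
  cabs (A * (\sum_(j < 2 ^ s) (H 1 (j%:R / 2 ^+ s) - H 0 (j%:R / 2 ^+ s))) -
        B * (\sum_(i < 2 ^ s) (H (i%:R / 2 ^+ s) 1 - H (i%:R / 2 ^+ s) 0))) <= e * 2 ^+ s.
Proof.
move=> e0.
suff [s0 Hs] : small e 0 0 0.
  exists s0 => s /Hs; rewrite expr0 divr1.
  congr (cabs _ <= _); rewrite /S /cell; under eq_bigr do rewrite sumrB.
  have tele (G : nat -> C) M : \sum_(i < M) (G i.+1 - G i) = G M - G 0%N.
    elim: M => [|M IH]; first by rewrite big_ord0 subrr.
    by rewrite big_ord_recr /= IH addrC subrKA.
  have p1 : pt s (2 ^ s) = 1 by rewrite /pt natrX divff// expf_neq0.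
  have p0 : pt s 0 = 0 by rewrite /pt mul0r.
  rewrite sumrB; congr (_ - _).
    rewrite exchange_big mulr_sumr /=; apply: eq_bigr => j _.
    rewrite -mulr_sumr; congr (_ * _).
    by rewrite (tele (fun i => H (pt s i) _)) p1 p0.
  rewrite mulr_sumr; apply: eq_bigr => i _.
  rewrite -mulr_sumr; congr (_ * _).
  by rewrite (tele (fun j => H _ (pt s j))) p1 p0.
apply: contrapT => bad0.
pose st (p : nat * nat * nat) := (p.1.1, p.1.2, p.2).
have child p : ~ small e p.1 p.2.1 p.2.2 -> exists c : bool * bool,
    ~ small e p.1.+1 (p.2.1.*2 + c.1)%N (p.2.2.*2 + c.2)%N.
  move=> bad; apply: contrapT => /forallNP N; apply: bad; apply: small_split.
  - by apply: contrapT; have := N (false, false); rewrite !addn0.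
  - by apply: contrapT; have := N (false, true); rewrite addn0 addn1.
  - by apply: contrapT; have := N (true, false); rewrite addn0 addn1.
  - by apply: contrapT; have := N (true, true); rewrite !addn1.
have /choice[ch Hch] : forall p : nat * (nat * nat), exists c : bool * bool,
    ~ small e p.1 p.2.1 p.2.2 -> ~ small e p.1.+1 (p.2.1.*2 + c.1)%N (p.2.2.*2 + c.2)%N.
  move=> p; have [sm|/child[c Hc]] := pselect (small e p.1 p.2.1 p.2.2).
    by exists (false, false).
  by exists c.
pose q := fix q l : nat * nat := if l is l'.+1 then
  let p := q l' in let c := ch (l', p) in ((p.1.*2 + c.1)%N, (p.2.*2 + c.2)%N) else (0%N, 0%N).
have bad l : ~ small e l (q l).1 (q l).2.
  by elim: l => [//|l IH]; have := Hch (l, q l) IH.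
(* Along each axis the nested dyadic intervals share a point, the supremum of their left ends. *)
have nest (u : nat -> nat) (c : nat -> bool) : u 0%N = 0%N ->
    (forall l, u l.+1 = ((u l).*2 + c l)%N) ->
    exists2 x : R, 0 <= x <= 1 & forall l, pt l (u l) <= x <= pt l (u l).+1 /\ ((u l).+1 <= 2 ^ l)%N.
  move=> u0 uS.
  have half l (k : nat) : pt l.+1 k.*2 = pt l k.
    by rewrite /pt -mul2n natrM exprS; field; rewrite expf_neq0.
  have mono l k j : (k <= j)%N -> pt l k <= pt l j.
    by move=> kj; rewrite /pt ler_wpM2r ?ler_nat// invr_ge0 exprn_ge0.
  have up l j : pt l (u l) <= pt (l + j) (u (l + j)%N).
    elim: j => [|j IH]; first by rewrite addn0.
    rewrite addnS (le_trans IH)// uS -(half (l + j)%N (u _)); apply: mono; exact: leq_addr.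
  have dn l j : pt (l + j) (u (l + j)%N).+1 <= pt l (u l).+1.
    elim: j => [|j IH]; first by rewrite addn0.
    rewrite addnS; apply: le_trans IH; rewrite -(half (l + j)%N _.+1) uS doubleS; apply: mono.
    by case: (c _); rewrite ?addn1 ?addn0.
  have cross l j : pt l (u l) <= pt j (u j).+1.
    apply: (le_trans (up l j)); apply: (@le_trans _ _ (pt (l + j) (u (l + j)%N).+1)).
      by apply: mono.
    by rewrite [X in pt X _ <= _]addnC [X in u X]addnC; exact: dn.
  pose X := [set pt l (u l) | l in [set: nat]].
  have ub : has_ubound X by exists (pt 0 (u 0%N).+1) => _ [l _ <-]; exact: cross.
  have hs : has_sup X by split=> //; exists (pt 0 (u 0%N)), 0%N.
  have lo l : pt l (u l) <= sup X by apply: ub_le_sup => //; exists l.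
  have hi l : sup X <= pt l (u l).+1.
    by apply: ge_sup; [exact: hs.1|move=> _ [j _ <-]; exact: cross].
  exists (sup X).
    by have := lo 0%N; have := hi 0%N; rewrite u0 /pt expr0 !divr1 => -> ->.
  move=> l; rewrite lo hi; split=> //.
  elim: l => [|l IH]; first by rewrite u0.
  rewrite uS expnS; case: (c l) => /=; lia.
have [cx cx01 Hx] := nest (fun l => (q l).1) (fun l => (ch (l, q l)).1) erefl (fun=> erefl).
have [ct ct01 Ht] := nest (fun l => (q l).2) (fun l => (ch (l, q l)).2) erefl (fun=> erefl).
pose K := 4 * (cabs A + cabs B) + 1.
have K0 : 0 < K by rewrite ltr_wpDl// mulr_ge0// addr_ge0// cabs_ge0.
have eK : 0 < e / K by rewrite divr_gt0.
have [d d0 [Lx [Lt [AB Hd]]]] := dH cx01 ct01 eK.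
have [l ld] : exists l, 2 / 2 ^+ l < d.
  exists (Num.truncn (2 / d)).+1.
  rewrite ltr_pdivrMr ?exprn_gt0// mulrC -ltr_pdivrMr//.
  apply: (lt_trans (truncnS_gt _)).
  by rewrite -natrX ltr_nat; exact: ltn_expl.
have [bx xl] := Hx l; have [bt tl] := Ht l.
have [s0 Hs] := small_local eK bx bt AB ld xl tl Hd.
apply: (bad l); exists s0 => s /Hs /le_trans; apply.
rewrite ler_wpM2r ?invr_ge0 ?exprn_ge0// ler_wpM2r ?exprn_ge0//.
rewrite mulrA ler_pdivrMr// mulrC ler_wpM2l ?(ltW e0)// /K; lra.
Qed.

End discrete_goursat.

(** * The complex exponential and complex differentiability *)

Section complex_exponential.
Variable R : realType.
Local Notation C := R[i].
Implicit Types (z w h : C).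

Definition cexp z : C := (expR (complex.Re z))%:C * expi (complex.Im z).

Lemma expiD (s t : R) : expi (s + t) = expi s * expi t.
Proof. by rewrite /expi cosD sinD; congr (_ +i* _); ring. Qed.

Lemma expi0 : expi (0 : R) = 1.
Proof. by rewrite /expi cos0 sin0. Qed.

Lemma cabs_expi (t : R) : cabs (expi t) = 1.
Proof. by rewrite cabsE /expi /= cos2Dsin2 sqrtr1. Qed.

Lemma cexpD z w : cexp (z + w) = cexp z * cexp w.
Proof.
rewrite /cexp !raddfD /= expRD expiD rmorphM /=; ring.
Qed.

Lemma cexp0 : cexp 0 = 1.
Proof. by rewrite /cexp /= expR0 expi0 mulr1. Qed.

Lemma cexp_neq0 z : cexp z != 0.
Proof.
have /eqP := cexpD z (- z); rewrite subrr cexp0 => H.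
by apply: contraTneq H => ->; rewrite mul0r oner_eq0.
Qed.

Lemma cexpN z : cexp (- z) = (cexp z)^-1.
Proof.
by apply: (mulfI (cexp_neq0 z)); rewrite -cexpD subrr cexp0 divff// cexp_neq0.
Qed.

Lemma cexpMn z k : cexp (k%:R * z) = cexp z ^+ k.
Proof.
elim: k => [|k IH]; first by rewrite mul0r cexp0 expr0.
by rewrite -natr1 mulrDl mul1r cexpD IH exprSr.
Qed.

Lemma cexp_Im (t : R) : cexp (0 +i* t) = expi t.
Proof. by rewrite /cexp /= expR0 mul1r. Qed.

Lemma cexp_surj z : z != 0 -> exists w, cexp w = z.
Proof.
move=> z0; have c0 : 0 < cabs z by rewrite cabs_gt0.
pose u := z / (cabs z)%:C.
have cz : (cabs z)%:C != 0 by rewrite -normc_cabs normr_eq0.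
have u1 : complex.Re u ^+ 2 + complex.Im u ^+ 2 = 1.
  rewrite -cabs_sqr /u cabsM cabsV cabs_real ger0_norm ?cabs_ge0// divff ?gt_eqF//.
  by rewrite expr1n.
have [t [tc ts]] : exists t : R, cos t = complex.Re u /\ sin t = complex.Im u.
  have Re1 : -1 <= complex.Re u <= 1.
    rewrite -ler_norml -(@ler_pXn2r _ 2)// ?nnegrE// expr1n real_normK ?num_real//.
    by rewrite -u1 lerDl sqr_ge0.
  have [s0|s0] := leP 0 (complex.Im u).
    exists (acos (complex.Re u)); split; first exact: acosK.
    rewrite sin_acos//; rewrite -[1]u1 addrAC subrr add0r.
    by rewrite sqrtr_sqr ger0_norm.
  exists (- acos (complex.Re u)); split; first by rewrite cosN acosK.
  rewrite sinN sin_acos//; rewrite -[1]u1 addrAC subrr add0r.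
  by rewrite sqrtr_sqr ltr0_norm// opprK.
exists (ln (cabs z) +i* t); rewrite /cexp /= lnK ?posrE//.
have -> : expi t = u by rewrite /expi tc ts; case: (u).
by rewrite /u mulrC divfK.
Qed.

End complex_exponential.

Section differentiable_expansion.
Variable R : realType.
Local Notation C := R[i].

Lemma differentiable_littleo (K : numFieldType) (V W : normedModType K)
  (f : V -> W) (a : V) : differentiable f a ->
  forall e : K, 0 < e -> \forall h \near 0, `|f (a + h) - f a - 'd f a h| <= e * `|h|.
Proof.
move=> df e e0; have /eqaddoP/(_ e e0) := diff_locally df.
apply: filterS => h; rewrite -[(_ - _) h]/(f (h + a) - (f a + 'd f a h)).
by rewrite opprD addrA (addrC h).
Qed.

Lemma real_derive_expansion (f : R -> R) (d : R) : is_derive (0 : R) (1 : R) f d ->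
  forall e : R, 0 < e -> exists2 r : R, 0 < r &
    forall h, `|h| < r -> `|f h - f 0 - h * d| <= e * `|h|.
Proof.
move=> [df fd] e e0; have dif := (derivable1_diffP _ _).1 df.
have /nbhs_ballP[r r0 Hr] := differentiable_littleo dif e0; exists r => // h hr.
have := Hr h; rewrite /ball /= sub0r normrN => /(_ hr).
rewrite add0r; congr (`|_ - _| <= _).
have -> : 'd f 0 h = 'd f 0 (h *: (1 : R)) by congr ('d f _ _); exact/esym/mulr1.
by rewrite linearZ -fd deriveE.
Qed.

Lemma complex_differentiable_expansion (f : C -> C) (a : C) : differentiable f a ->
  exists d : C, forall e : R, 0 < e -> exists2 r : R, 0 < r &
    forall h, cabs h < r -> cabs (f (a + h) - f a - h * d) <= e * cabs h.
Proof.
move=> df; exists ('d f a 1) => e e0.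
have e0' : 0 < e%:C by rewrite ltcR.
have /nbhs_ballP[r0 /gt0_complexE[r rp ->] Hr] := differentiable_littleo df e0'.
exists r => // h hr; have := Hr h.
rewrite /ball /= sub0r normrN normc_cabs ltcR => /(_ hr).
rewrite !normc_cabs -rmorphM lecR; congr (cabs (_ - _) <= _).
have -> : 'd f a h = 'd f a (h *: (1 : C)) by congr ('d f _ _); exact/esym/mulr1.
by rewrite linearZ.
Qed.

Lemma cexp_expansion (e : R) : 0 < e -> exists2 r : R, 0 < r &
  forall h : C, cabs h < r -> cabs (cexp h - 1 - h) <= e * cabs h.
Proof.
move=> e0.
(* The errors of the real and imaginary parts add up to at most [9 e' |h|]. Products of two small
   terms are handled by [e' <= 1] and [|h| < e']. *)
have [e' [e'0 e'10 e'1]] : exists e' : R, [/\ 0 < e', e' <= e / 10 & e' <= 1].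
  exists (Num.min (e / 10) 1); split; last 2 first.
  - by rewrite ge_min lexx.
  - by rewrite ge_min lexx orbT.
  - by rewrite lt_min divr_gt0/=.
have [r1 r10 H1] := real_derive_expansion (is_derive_expR 0) e'0.
have [r2 r20 H2] := real_derive_expansion (is_derive_cos 0) e'0.
have [r3 r30 H3] := real_derive_expansion (is_derive_sin 0) e'0.
exists (Num.min (Num.min r1 r2) (Num.min r3 e')); first by rewrite !lt_min r10 r20 r30.
move=> [x y]; rewrite !lt_min => /andP[/andP[h1 h2] /andP[h3 h4]].
have xh : `|x| <= cabs (x +i* y) by exact: (Re_le_cabs (x +i* y)).
have yh : `|y| <= cabs (x +i* y) by exact: (Im_le_cabs (x +i* y)).
set c := cabs _ in h1 h2 h3 h4 xh yh *.
have := H1 x (le_lt_trans xh h1); have := H2 y (le_lt_trans yh h2).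
have := H3 y (le_lt_trans yh h3).
rewrite expR0 cos0 sin0 oppr0 mulr0 !mulr1 !subr0 ?addr0 => A3 A2 A1.
apply: (le_trans (cabs_le_ReIm _)); rewrite /cexp /expi /= !mul0r !subr0 addr0.
move: (expR x) (cos y) (sin y) A1 A2 A3 => u v w A1 A2 A3.
have x0 := normr_ge0 x; have y0 := normr_ge0 y.
have U : `|u - 1| <= 2 * `|x|.
  have -> : u - 1 = (u - 1 - x) + x by ring.
  by apply: (le_trans (ler_normD _ _)); nra.
have U1 : `|u| <= 3.
  have -> : u = (u - 1) + 1 by ring.
  apply: (le_trans (ler_normD _ _)); rewrite normr1; lra.
have W : `|w| <= 2 * `|y|.
  have -> : w = (w - y) + y by ring.
  by apply: (le_trans (ler_normD _ _)); nra.
have P1 : `|u * v - 1 - x| <= e' * `|x| + 3 * (e' * `|y|).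
  have -> : u * v - 1 - x = (u - 1 - x) + u * (v - 1) by ring.
  by apply: (le_trans (ler_normD _ _)); rewrite normrM lerD// ler_pM.
have P2 : `|u * w - y| <= (2 * e') * (2 * `|y|) + e' * `|y|.
  have -> : u * w - y = (u - 1) * w + (w - y) by ring.
  apply: (le_trans (ler_normD _ _)); rewrite normrM lerD// ler_pM//; lra.
have c0 : 0 <= c by apply: le_trans xh.
have : e' * `|x| <= e' * c by rewrite ler_wpM2l// ltW.
have : e' * `|y| <= e' * c by rewrite ler_wpM2l// ltW.
have : 10 * e' * c <= e * c by apply: ler_wpM2r => //; lra.
have : 0 <= e' * c by rewrite mulr_ge0// ltW.
lra.
Qed.

Lemma differentiable_cexp (a : C) : differentiable (@cexp R) a.
Proof.
apply/derivable1_diffP; apply/cvg_ex; exists (cexp a : C^o).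
apply/cvgrPdist_le => e' /gt0_complexE[e e0 ->].
have c0 : 0 < cabs (cexp a) by rewrite cabs_gt0 cexp_neq0.
have [r r0 Hr] := cexp_expansion (divr_gt0 e0 c0).
apply/nbhs_ballP; exists r%:C; first by rewrite /= ltcR.
move=> h; rewrite /ball /= sub0r normrN normc_cabs ltcR => hr h0.
rewrite normc_cabs lecR /= -[h *: 1]/(h * 1) mulr1 cexpD.
rewrite -[_ *: _]/(h^-1 * (cexp h * cexp a - cexp a)).
have -> : cexp a - h^-1 * (cexp h * cexp a - cexp a) = - (h^-1 * cexp a * (cexp h - 1 - h)).
  by field.
rewrite cabsN (cabsM (h^-1 * _)) (cabsM h^-1) cabsV.
rewrite -mulrA mulrC ler_pdivrMr ?cabs_gt0//.
apply: (le_trans (ler_wpM2l (ltW c0) (Hr h hr))).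
by rewrite mulrA mulrCA divff ?gt_eqF// mulr1.
Qed.

End differentiable_expansion.

(** * Logarithmic coordinates on a Reinhardt domain *)

Section log_coordinates.
Variables (R : realType) (n : nat).
Local Notation C := R[i].
Local Notation rot2pi t := (0 +i* (2 * pi * t)).
Implicit Types (z w : 'rV[C]_n) (t x : R) (q : 'rV[R]_n).

Lemma cexp_nat2pi (k : nat) : cexp (rot2pi k%:R : C) = 1.
Proof.
have -> : 2 * pi * k%:R = 0 + (pi *+ 2) *+ k :> R by rewrite add0r mulr_natl mulr_natr.
by rewrite cexp_Im /expi (periodicn (@cosD2pi R)) (periodicn (@sinD2pi R)) cos0 sin0.
Qed.

Lemma rot2piD x t : rot2pi x + rot2pi t = rot2pi (x + t) :> C.
Proof. by apply/eqP; rewrite eq_complex /= addr0 eqxx /=; apply/eqP; ring. Qed.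

Lemma rot2pi_scale x t : x%:C * rot2pi t = rot2pi (x * t) :> C.
Proof. by apply/eqP; rewrite eq_complex /= !mul0r mulr0 subr0 addr0 eqxx /=; apply/eqP; ring. Qed.

Definition mon (b : 'I_n -> nat) z : C := \prod_j z 0 j ^+ b j.

Definition log_map z w : 'rV[C]_n := \row_j (z 0 j * cexp (w 0 j)).

Definition angles q : 'rV[C]_n := \row_j rot2pi (q 0 j).

Lemma log_mapD z w w' : log_map z (w + w') = log_map (log_map z w) w'.
Proof. by apply/rowP => j; rewrite !mxE cexpD mulrA. Qed.

Lemma differentiable_log_map z w : differentiable (log_map z) w.
Proof.
have -> : log_map z = \sum_(j < n) (fun w => (z 0 j * cexp (w 0 j)) *: delta_mx 0 j).
  apply/funext => w'; rewrite fct_sumE; apply/rowP => j; rewrite mxE summxE (bigD1 j)//=.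
  by rewrite !mxE !eqxx mulr1 big1 ?addr0// => k kj; rewrite !mxE eq_sym (negbTE kj) andbF mulr0.
apply: differentiable_sum => j; apply: differentiableZl.
apply: differentiableM; first exact: differentiable_cst.
apply: (@differentiable_comp _ _ _ _ (fun w : 'rV[C]_n => w 0 j) (@cexp R)).
  exact: differentiable_coord.
exact: differentiable_cexp.
Qed.

Variables (Om : set 'rV[C]_n) (f : 'rV[C]_n -> C) (b : 'I_n -> nat).
Hypotheses (oOm : open Om) (rOm : reinhardt Om).
Hypothesis df : forall z, Om z -> differentiable f z.

Lemma reinhardt_angles z q : Om z -> Om (log_map z (angles q)).
Proof.
move=> /(rOm (fun j => 2 * pi * q 0 j)); congr Om.
by apply/rowP => j; rewrite !mxE cexp_Im mulrC.
Qed.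

(** For imaginary [w] this is the integrand of the Laurent coefficient of degree [b], times [z^b].
    It is holomorphic in [w] and periodic in the angles, so its angular mean does not depend on the
    real part of [w]. *)
Definition log_fun z w : C := f (log_map z w) * cexp (- \sum_j (b j)%:R * w 0 j).

Lemma differentiable_log_fun z w : Om (log_map z w) -> differentiable (log_fun z) w.
Proof.
move=> Ow; apply: differentiableM.
  by apply: differentiable_comp; [exact: differentiable_log_map|exact: df].
apply: (@differentiable_comp _ _ _ _ (fun w : 'rV[C]_n => - \sum_j (b j)%:R * w 0 j) (@cexp R)).
  apply: differentiableN.
  have -> : (fun w : 'rV[C]_n => \sum_j (b j)%:R * w 0 j) =
      \sum_(j < n) (fun w : 'rV[C]_n => (b j)%:R * w 0 j).
    by apply/funext => w'; rewrite fct_sumE.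
  apply: differentiable_sum => j; apply: differentiableM; first exact: differentiable_cst.
  exact: differentiable_coord.
exact: differentiable_cexp.
Qed.

Lemma log_fun_periodic z w i :
  log_fun z (w + rot2pi 1 *: delta_mx 0 i) = log_fun z w.
Proof.
have p1 : cexp (rot2pi 1 : C) = 1 by exact: (cexp_nat2pi 1).
rewrite /log_fun; congr (f _ * _).
  apply/rowP => j; rewrite !mxE eqxx cexpD /=; congr (_ * _).
  by case: (j == i); rewrite /= ?mulr0 ?cexp0 ?mulr1//; move: p1; rewrite mulr1 => ->; rewrite mulr1.
have -> : \sum_j (b j)%:R * (w + rot2pi 1 *: delta_mx 0 i) 0 j =
    \sum_j (b j)%:R * w 0 j + (b i)%:R * rot2pi 1.
  under eq_bigr do rewrite mxE mulrDr.
  rewrite big_split /=; congr (_ + _); rewrite (bigD1 i)//= big1 ?addr0.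
    by congr (_ * _); rewrite !mxE !eqxx; exact: mulr1.
  by move=> j ji; rewrite !mxE (negbTE ji) andbF !mulr0.
by rewrite opprD cexpD [X in _ * X]cexpN cexpMn p1 expr1n invr1 mulr1.
Qed.

(* Goursat in the coordinate w_i = x tau + 2 pi I t, with the other angles fixed. *)
Lemma angular_sum_cst z i (tau : C) q :
  (forall x, 0 <= x <= 1 -> Om (log_map z ((x%:C * tau) *: delta_mx 0 i))) ->
  forall e : R, 0 < e -> exists s0, forall s, (s0 <= s)%N ->
  cabs (\sum_(j < 2 ^ s)
    (log_fun z (tau *: delta_mx 0 i + angles (q + (j%:R / 2 ^+ s) *: delta_mx 0 i)) -
     log_fun z (angles (q + (j%:R / 2 ^+ s) *: delta_mx 0 i)))) <= e * 2 ^+ s.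
Proof.
move=> path e e0.
pose K (w : C) := log_fun z (angles q + w *: delta_mx 0 i).
pose H x t := K (x%:C * tau + rot2pi t).
have pi2 : 0 < 2 * pi :> R by rewrite mulr_gt0// pi_gt0.
have Kd (v : C) x : 0 <= x <= 1 -> complex.Re v = 0 -> differentiable K (x%:C * tau + v).
  move=> x01 w0; apply: (@differentiable_comp _ _ _ _ (fun w : C => angles q + w *: delta_mx 0 i) (log_fun z)).
    apply: differentiableD; first exact: differentiable_cst.
    by apply: differentiableZl; exact: ex_diff.
  apply: differentiable_log_fun.
  have -> : angles q + (x%:C * tau + v) *: delta_mx 0 i = (x%:C * tau) *: delta_mx 0 i +
      angles (q + (complex.Im v / (2 * pi)) *: delta_mx 0 i).
    rewrite scalerDl addrCA; congr (_ + _); apply/rowP => j; rewrite !mxE.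
    have vE : v = rot2pi (complex.Im v / (2 * pi)).
      rewrite mulrCA divff ?mulr1 ?gt_eqF//.
      by rewrite -[X in X +i* _]w0; case: (v).
    rewrite eqxx /=; case: (j == i); last by rewrite /= !mulr0 !addr0.
    by rewrite [in LHS]vE -rot2piD /= !mulr1.
  by rewrite log_mapD; apply: reinhardt_angles; exact: path.
have dH : forall cx ct : R, 0 <= cx <= 1 -> 0 <= ct <= 1 ->
  forall e : R, 0 < e -> exists2 d : R, 0 < d & exists Lx Lt : C,
    rot2pi 1 * Lx = tau * Lt /\
    forall x t : R, 0 <= x <= 1 -> 0 <= t <= 1 -> `|x - cx| + `|t - ct| < d ->
      cabs (H x t - H cx ct - ((x - cx)%:C * Lx + (t - ct)%:C * Lt)) <=
      e * (`|x - cx| + `|t - ct|).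
  move=> cx ct cx01 ct01 e1 e10.
  have [D HD] := complex_differentiable_expansion (Kd (rot2pi ct) cx cx01 erefl).
  pose M := cabs tau + 2 * pi + 1.
  have M0 : 0 < M by rewrite /M; have := cabs_ge0 tau; lra.
  have [r r0 Hr] := HD _ (divr_gt0 e10 M0).
  exists (r / M); first by rewrite divr_gt0.
  (* The chain rule for [K (x tau + 2 pi i t)], with [D] the derivative of [K]. *)
  exists (tau * D), (rot2pi 1 * D); split; first by rewrite mulrCA.
  move=> x t _ _; set N := `|x - cx| + `|t - ct| => xt.
  have N0 : 0 <= N by rewrite addr_ge0 ?normr_ge0.
  pose h := (x - cx)%:C * tau + rot2pi (t - ct).
  have hM : cabs h <= M * N.
    apply: (le_trans (cabsD _ _)); rewrite cabsM cabs_real.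
    have -> : cabs (rot2pi (t - ct)) = 2 * pi * `|t - ct|.
      by rewrite cabsE /= expr0n add0r sqrtr_sqr normrM ger0_norm// ltW.
    rewrite /N /M; have := cabs_ge0 tau; have := normr_ge0 (x - cx); have := normr_ge0 (t - ct).
    by move: (cabs tau) (`|x - cx|) (`|t - ct|) (2 * pi) pi2 => a b' c d; nra.
  have -> : H x t = K (cx%:C * tau + rot2pi ct + h).
    rewrite /H /h; congr K; rewrite addrACA -mulrDl -rmorphD rot2piD.
    have -> : cx + (x - cx) = x by ring.
    by have -> : ct + (t - ct) = t by ring.
  have -> : (x - cx)%:C * (tau * D) + (t - ct)%:C * (rot2pi 1 * D) = h * D.
    rewrite /h.
    have -> : rot2pi (t - ct) = (t - ct)%:C * rot2pi 1 :> C by rewrite rot2pi_scale mulr1.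
    by move: (rot2pi 1) => v; rewrite mulrDl !mulrA.
  apply: (le_trans (Hr h _)).
    by apply: (le_lt_trans hM); rewrite mulrC -ltr_pdivlMr.
  by rewrite mulrAC ler_pdivrMr// -mulrA ler_wpM2l ?(ltW e10)// mulrC.
have [s0 Hs] := discrete_goursat dH (mulr_gt0 pi2 e0).
(* The sides [t = 0] and [t = 1] cancel by periodicity; the sides [x = 0] and [x = 1] are the two
   angular sums to be compared. *)
exists s0 => s /Hs; rewrite [X in _ - X](_ : _ = 0) ?subr0; last first.
  rewrite big1 ?mulr0// => j _; apply/eqP; rewrite subr_eq0; apply/eqP.
  rewrite /H /K mulr0 scalerDl addrA log_fun_periodic.
  by rewrite -[0 +i* 0]/(0 : C) addr0.
rewrite cabsM.
have -> : cabs (rot2pi (1 : R)) = 2 * pi.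
  by rewrite cabsE /= expr0n add0r sqrtr_sqr mulr1 ger0_norm// ltW.
rewrite -[leRHS]mulrA ler_pM2l//; congr (cabs _ <= _); apply: eq_bigr => j _.
have aj : angles q + rot2pi (j%:R / 2 ^+ s) *: delta_mx 0 i =
    angles (q + (j%:R / 2 ^+ s) *: delta_mx 0 i).
  apply/rowP => k; rewrite !mxE eqxx -rot2piD; congr (_ + _).
  by case: (k == i); [rewrite !(mulr1 (_ / _)) mulr1|rewrite !mulr0].
rewrite /H /K mul1r mul0r add0r aj; congr (log_fun _ _ - _).
by rewrite scalerDl addrCA aj.
Qed.

End log_coordinates.

(** * Uniformity in the angles, and dyadic grids *)

Section torus_uniformity.
Variables (R : realType) (n : nat).
Local Notation C := R[i].
Implicit Types (q : 'rV[R]_n) (g : 'rV[R]_n -> C).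

Definition eps_continuous g := forall q0, forall e : R, 0 < e ->
  exists2 d : R, 0 < d & forall q, (forall j, `|q 0 j - q0 0 j| < d) -> cabs (g q - g q0) <= e.

Lemma compact_cube (M : R) : compact [set q : 'rV[R]_n | forall j, 0 <= q 0 j <= M].
Proof.
have := @rV_compact R n (fun=> `[0, M]%classic) (fun=> @segment_compact R 0 M).
congr compact; apply/seteqP; split => q H j; have := H j; rewrite /= in_itv/=; exact.
Qed.

(** Compactness as a covering property: what holds eventually and locally uniformly in [q] holds
    eventually on the whole cube. *)
Lemma cube_near_covering (M : R) (I : Type) (F : set_system I) (P : I -> 'rV[R]_n -> Prop) :
  Filter F ->
  (forall q0, (forall j, 0 <= q0 0 j <= M) -> exists2 d : R, 0 < d &
     \forall i \near F, forall q, (forall j, `|q 0 j - q0 0 j| < d) -> P i q) ->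
  \forall i \near F, forall q, (forall j, 0 <= q 0 j <= M) -> P i q.
Proof.
move=> FF H.
have /compact_near_coveringP/(_ I F P FF) N := @compact_cube M.
have : \forall i \near F, [set q : 'rV[R]_n | forall j, 0 <= q 0 j <= M] `<=` P i.
  apply: N => q0 q01; have [d d0 Hd] := H q0 q01.
  exists (ball q0 d, [set i | forall q, (forall j, `|q 0 j - q0 0 j| < d) -> P i q]).
    by split=> //=; apply/nbhs_ballP; exists d.
  move=> [q i] /= [[_ qd] Hi]; apply: Hi => j.
  by have := qd 0 j; rewrite /ball /= distrC.
by apply: filterS => i Hi q /Hi.
Qed.

(** Heine-Cantor, with only one of the two points confined to the cube. *)
Lemma eps_continuous_uniform g (M e : R) : eps_continuous g -> 0 < e ->
  exists2 d : R, 0 < d & forall q q', (forall j, 0 <= q 0 j <= M) ->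
    (forall j, `|q' 0 j - q 0 j| < d) -> cabs (g q' - g q) <= e.
Proof.
move=> cg e0.
have := @cube_near_covering M R (0^'+) (fun d q => forall q',
   (forall j, `|q' 0 j - q 0 j| < d) -> cabs (g q' - g q) <= e) _.
case.
- move=> q0 _; have [d d0 Hd] := cg q0 (e / 2) (divr_gt0 e0 (ltr0n _ 2)).
  exists (d / 2); first exact: divr_gt0.
  near=> r => q qd q' q'r.
  have -> : g q' - g q = (g q' - g q0) - (g q - g q0) by ring.
  apply: (le_trans (cabsD _ _)); rewrite cabsN.
  have := Hd q; have := Hd q'.
  have rd : r < d / 2 by near: r; exact: nbhs_right_lt (divr_gt0 d0 _).
  move=> /(_ _) H1 /(_ _) H2.
  have h1 : forall j, `|q' 0 j - q0 0 j| < d.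
    move=> j; have -> : q' 0 j - q0 0 j = (q' 0 j - q 0 j) + (q 0 j - q0 0 j) by ring.
    by apply: (le_lt_trans (ler_normD _ _)); have := qd j; have := q'r j; lra.
  have h2 : forall j, `|q 0 j - q0 0 j| < d by move=> j; have := qd j; lra.
  by have := H1 h1; have := H2 h2; lra.
- move=> r /= r0 Hr; exists (r / 2); first exact: divr_gt0.
  move=> q q' q0 qq'; apply: (Hr (r / 2)) => //=.
    by rewrite sub0r normrN ger0_norm ?divr_ge0 ?ltW// ltr_pdivrMr// ltr_pMr// ltr1n.
  exact: divr_gt0.
Unshelve. all: by end_near.
Qed.

Lemma eps_continuousB g1 g2 : eps_continuous g1 -> eps_continuous g2 ->
  eps_continuous (fun q => g1 q - g2 q).
Proof.
move=> c1 c2 q0 e e0; have e2 : 0 < e / 2 by exact: divr_gt0.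
have [d1 d10 H1] := c1 q0 _ e2; have [d2 d20 H2] := c2 q0 _ e2.
exists (Num.min d1 d2); first by rewrite lt_min d10.
move=> q Hq.
have -> : g1 q - g2 q - (g1 q0 - g2 q0) = (g1 q - g1 q0) - (g2 q - g2 q0) by ring.
apply: (le_trans (cabsD _ _)); rewrite cabsN.
have : cabs (g1 q - g1 q0) <= e / 2.
  by apply: H1 => j; have := Hq j; rewrite lt_min => /andP[].
have : cabs (g2 q - g2 q0) <= e / 2.
  by apply: H2 => j; have := Hq j; rewrite lt_min => /andP[].
by lra.
Qed.

Section grid.
Variable s : nat.
Implicit Types (k : {ffun 'I_n -> 'I_(2 ^ s)}).

Definition grid k : 'rV[R]_n := \row_j ((k j)%:R / 2 ^+ s).

Lemma grid_cube k j : 0 <= grid k 0 j <= 1.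
Proof.
rewrite mxE divr_ge0//= ?exprn_ge0// ler_pdivrMr ?exprn_gt0// mul1r.
by rewrite -natrX ler_nat ltnW.
Qed.

(** The grid is cut into lines parallel to the [i]-th axis, each represented by its point with
    [i]-th index 0, so that a one-angle estimate can be summed over the torus. *)
Lemma sum_grid_lines (V : zmodType) (F : 'rV[R]_n -> V) i :
  \sum_k F (grid k) =
  \sum_(k : {ffun 'I_n -> 'I_(2 ^ s)} | val (k i) == 0%N)
    \sum_(j < 2 ^ s) F (grid k + (j%:R / 2 ^+ s) *: delta_mx 0 i).
Proof.
have s0 : (0 < 2 ^ s)%N by rewrite expn_gt0.
pose upd k (j : 'I_(2 ^ s)) := [ffun l => if l == i then j else k l].
rewrite exchange_big /= (partition_big (fun k => k i) xpredT) //=.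
apply: eq_bigr => j _.
rewrite (reindex_onto (fun k => upd k j) (fun k => upd k (Ordinal s0))) /=; last first.
  move=> k /eqP kj; apply/ffunP => l; rewrite !ffunE; case: eqP => // ->.
  by rewrite kj.
apply: eq_big => [k|k].
  rewrite ffunE eqxx eqxx /=; apply/eqP/eqP => [<-|k0]; first by rewrite ffunE eqxx.
  apply/ffunP => l; rewrite !ffunE; case: eqP => // ->.
  by apply/val_inj; rewrite /= k0.
move=> /andP[_ /eqP kE]; congr F; apply/rowP => l; rewrite !mxE ffunE eqxx /=.
case: eqP => [->|_]; last by rewrite mulr0 addr0.
have -> : k i = Ordinal s0 by rewrite -[in LHS]kE ffunE eqxx.
by rewrite mul0r add0r mulr1.
Qed.

End grid.
End torus_uniformity.
Arguments grid {R n s} k.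

(** * Grid averages as approximate Laurent coefficients *)

Section averages.
Variables (R : realType) (n : nat).
Local Notation C := R[i].
Variables (Om : set 'rV[C]_n) (f : 'rV[C]_n -> C) (b : 'I_n -> nat).
Hypotheses (oOm : open Om) (rOm : reinhardt Om).
Hypothesis df : forall z, Om z -> differentiable f z.
Implicit Types (z w : 'rV[C]_n) (q : 'rV[R]_n).

Lemma eps_continuous_log_fun z w : (forall q, Om (log_map z (w + angles q))) ->
  eps_continuous (fun q => log_fun f b z (w + angles q)).
Proof.
move=> Oz q0 e e0.
have := differentiable_continuous (differentiable_log_fun b df (Oz q0)).
move=> /cvgrPdist_le/(_ e%:C); rewrite ltcR => /(_ e0)/nbhs_polydisc[r r0 Hr].
have pi2 : 0 < 2 * pi :> R by rewrite mulr_gt0// pi_gt0.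
exists (r / (2 * pi)); first exact: divr_gt0.
move=> q Hq; rewrite -lecR -normc_cabs -normrN opprB; apply: Hr => j.
rewrite !mxE opprD addrACA subrr add0r.
have -> : 0 +i* (2 * pi * q 0 j) - 0 +i* (2 * pi * q0 0 j) = 0 +i* (2 * pi * (q 0 j - q0 0 j)).
  by apply/eqP; rewrite eq_complex /= subr0 eqxx /=; apply/eqP; ring.
rewrite cabsE /= expr0n add0r sqrtr_sqr normrM ger0_norm ?ltW// mulrC.
by rewrite -ltr_pdivlMr.
Qed.

Definition grid_average s z : C :=
  ((2 ^+ s) ^+ n)^-1%:C * \sum_(k : {ffun 'I_n -> 'I_(2 ^ s)}) log_fun f b z (angles (grid k)).

Definition grid_quotient s z := grid_average s z / mon b z.

Lemma log_fun_shift z w w' : log_fun f b z (w + w') =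
  log_fun f b (log_map z w) w' * cexp (- \sum_j (b j)%:R * w 0 j).
Proof.
rewrite /log_fun log_mapD -mulrA; congr (_ * _); rewrite -cexpD; congr cexp.
rewrite -opprD; congr (- _); rewrite -big_split /=; apply: eq_bigr => j _.
by rewrite mxE mulrDr addrC.
Qed.

Lemma mon_log_map z w : mon b (log_map z w) = mon b z * cexp (\sum_j (b j)%:R * w 0 j).
Proof.
have cs (F : 'I_n -> C) (r : seq 'I_n) : cexp (\sum_(j <- r) F j) = \prod_(j <- r) cexp (F j).
  elim: r => [|j r IH]; first by rewrite !big_nil cexp0.
  by rewrite !big_cons cexpD IH.
rewrite /mon cs -big_split /=; apply: eq_bigr => j _.
by rewrite mxE exprMn cexpMn.
Qed.

(* In the limit grid_quotient is a Laurent coefficient of f; comparing two points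
   avoids having to prove that it converges. *)
Definition same_limit z z' := forall e : R, 0 < e -> exists s0, forall s, (s0 <= s)%N ->
  cabs (grid_quotient s z - grid_quotient s z') <= e.

Lemma same_limit_refl z : same_limit z z.
Proof. by move=> e e0; exists 0%N => s _; rewrite subrr cabs0 ltW. Qed.

Lemma same_limit_sym z z' : same_limit z z' -> same_limit z' z.
Proof. by move=> H e /H[s0 Hs]; exists s0 => s /Hs; rewrite cabsB. Qed.

Lemma same_limit_trans z z' z'' : same_limit z z' -> same_limit z' z'' -> same_limit z z''.
Proof.
move=> H1 H2 e e0; have e2 : 0 < e / 2 by exact: divr_gt0.
have [s1 Hs1] := H1 _ e2; have [s2 Hs2] := H2 _ e2.
exists (maxn s1 s2) => s; rewrite geq_max => /andP[/Hs1 h1 /Hs2 h2].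
have -> : grid_quotient s z - grid_quotient s z'' = (grid_quotient s z - grid_quotient s z') +
  (grid_quotient s z' - grid_quotient s z'') by ring.
by apply: (le_trans (cabsD _ _)); lra.
Qed.

(** The difference of the two averages is a sum over grid lines of the sums in [angular_sum_cst].
    That lemma fixes the other angles; compactness makes its rank [s0] independent of them. *)
Lemma same_limit_radial z i (tau : C) : mon b z != 0 ->
  (forall x : R, 0 <= x <= 1 -> Om (log_map z ((x%:C * tau) *: delta_mx 0 i))) ->
  same_limit z (log_map z (tau *: delta_mx 0 i)).
Proof.
move=> mz path e e0.
pose Phi q := log_fun f b z (tau *: delta_mx 0 i + angles q) - log_fun f b z (angles q).
have cPhi : eps_continuous Phi.
  apply: eps_continuousB.
    apply: eps_continuous_log_fun => q; rewrite log_mapD; apply: reinhardt_angles => //.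
    by have := path 1; rewrite mul1r lexx ler01; apply.
  have := @eps_continuous_log_fun z 0; under eq_fun do rewrite add0r; apply => q.
  rewrite add0r; apply: reinhardt_angles => //.
  have := path 0; rewrite lexx ler01 mul0r scale0r => /(_ isT); congr Om.
  by apply/rowP => j; rewrite !mxE cexp0 mulr1.
pose c := e * cabs (mon b z); have c0 : 0 < c by rewrite mulr_gt0// cabs_gt0.
have [s0 _ Hs] : \forall s \near \oo, forall q : 'rV[R]_n, (forall j, 0 <= q 0 j <= 1) ->
    cabs (\sum_(j < 2 ^ s) Phi (q + (j%:R / 2 ^+ s) *: delta_mx 0 i)) <= c * 2 ^+ s.
  have c2 : 0 < c / 2 by exact: divr_gt0.
  (* The side is 2 because a grid shift in [[0, 1]] is added to a point of the unit cube. *)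
  have [d d0 Hd] := eps_continuous_uniform 2 cPhi c2.
  apply: cube_near_covering => q0 q01; exists d => //.
  have [s0 Hs] := angular_sum_cst b rOm df q0 path c2.
  exists s0 => // s /= /Hs h1 q qd.
  have -> : \sum_(j < 2 ^ s) Phi (q + (j%:R / 2 ^+ s) *: delta_mx 0 i) =
     \sum_(j < 2 ^ s) Phi (q0 + (j%:R / 2 ^+ s) *: delta_mx 0 i) +
     \sum_(j < 2 ^ s) (Phi (q + (j%:R / 2 ^+ s) *: delta_mx 0 i) -
        Phi (q0 + (j%:R / 2 ^+ s) *: delta_mx 0 i)).
    by rewrite -big_split /=; apply: eq_bigr => j _; rewrite [RHS]addrC subrK.
  apply: (le_trans (cabsD _ _)).
  have h2 : cabs (\sum_(j < 2 ^ s) (Phi (q + (j%:R / 2 ^+ s) *: delta_mx 0 i) -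
        Phi (q0 + (j%:R / 2 ^+ s) *: delta_mx 0 i))) <= c / 2 * 2 ^+ s.
    apply: (le_trans (cabs_sum _ _ _)); apply: (@le_trans _ _ (\sum_(j < 2 ^ s) (c / 2))).
      apply: ler_sum => j _; apply: Hd => l; last first.
        by rewrite !mxE opprD addrACA subrr addr0; exact: qd.
      have /andP[q0l q1l] := q01 l; rewrite !mxE.
      have /andP[j0 j1] : 0 <= (j%:R / 2 ^+ s : R) <= 1.
        rewrite divr_ge0//= ?exprn_ge0// ler_pdivrMr ?exprn_gt0// mul1r.
        by rewrite -natrX ler_nat ltnW.
      by rewrite eqxx /=; case: (l == i); rewrite ?mulr1 ?mulr0; apply/andP; split; lra.
    by rewrite sumr_const card_ord -[(c / 2) *+ _]mulr_natr natrX.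
  by rewrite (le_trans (lerD h1 h2))// -mulrDl -splitr.
exists s0 => s /Hs{}Hs.
rewrite cabsB /grid_quotient mon_log_map.
have -> : \sum_j (b j)%:R * (tau *: delta_mx 0 i : 'rV[C]_n) 0 j = (b i)%:R * tau.
  rewrite (bigD1 i)//= !mxE !eqxx mulr1 big1 ?addr0// => j ji.
  by rewrite !mxE (negbTE ji) andbF !mulr0.
set ce := cexp _.
have -> : grid_average s (log_map z (tau *: delta_mx 0 i)) / (mon b z * ce) - grid_average s z / mon b z =
    ((2 ^+ s) ^+ n)^-1%:C * (\sum_(k : {ffun 'I_n -> 'I_(2 ^ s)}) Phi (grid k)) / mon b z.
  have mE (A A' m u : C) : A / (m * u) - A' / m = (A * u^-1 - A') / m.
    by rewrite invfM; ring.
  rewrite mE; congr (_ / _); rewrite /grid_average -mulrA -mulrBr; congr (_ * _).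
  rewrite mulr_suml /Phi sumrB; congr (_ - _); apply: eq_bigr => k _.
  rewrite log_fun_shift; congr (_ * _); rewrite -cexpN; congr (cexp (- _)).
  rewrite (bigD1 i)//= !mxE !eqxx mulr1 big1 ?addr0// => j ji.
  by rewrite !mxE (negbTE ji) andbF !mulr0.
rewrite !cabsM cabsV cabs_real ler_pdivrMr ?cabs_gt0// -/c.
have N0 : 0 < (2 ^+ s) ^+ n :> R by rewrite !exprn_gt0.
rewrite ger0_norm ?invr_ge0 ?(ltW N0)// ler_pdivrMl//.
rewrite (sum_grid_lines s Phi i).
apply: (le_trans (cabs_sum _ _ _)).
apply: (@le_trans _ _ (\sum_(k : {ffun 'I_n -> 'I_(2 ^ s)} | val (k i) == 0%N) c * 2 ^+ s)).
  by apply: ler_sum => k _; apply: Hs => j; exact: grid_cube.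
have := @sum_grid_lines R n s R (fun=> c) i.
have -> : \sum_(j < 2 ^ s) c = c * 2 ^+ s.
  by rewrite sumr_const card_ord -[c *+ _]mulr_natr natrX.
by move=> <-; rewrite sumr_const card_ffun !card_ord -[c *+ _]mulr_natl !natrX.
Qed.

End averages.

(** * Independence of the base point on a connected domain *)

Section reinhardt_connected.
Variables (R : realType) (n : nat).
Local Notation C := R[i].
Variables (Om : set 'rV[C]_n) (f : 'rV[C]_n -> C) (b : 'I_n -> nat).
Hypotheses (oOm : open Om) (cOm : connected Om) (rOm : reinhardt Om).
Hypothesis df : forall z, Om z -> differentiable f z.
Implicit Types (z w p : 'rV[C]_n).

Definition nonzero_coords z := forall j, z 0 j != 0.
Local Notation nz := nonzero_coords.
Local Notation same_limit := (same_limit f b).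

Lemma mon_neq0 z : nz z -> mon b z != 0.
Proof. by move=> zn; rewrite prodf_seq_neq0; apply/allP => j _; rewrite expf_neq0. Qed.

Lemma unit_expi (u : C) : cabs u = 1 -> exists t : R, u = expi t.
Proof.
move=> u1; have u0 : u != 0 by rewrite -cabs_eq0 u1 oner_eq0.
have [w wu] := cexp_surj u0; exists (complex.Im w).
rewrite -wu /cexp; have : cabs (cexp w) = 1 by rewrite wu.
by rewrite cabsM cabs_expi mulr1 cabs_real ger0_norm ?expR_ge0// => ->; rewrite mul1r.
Qed.

(** The squared modulus along the segment is a polynomial in the parameter, so the intermediate
    value theorem applies. *)
Lemma segment_cabs (a c : C) (v : R) : 0 <= v ->
  Num.min (cabs a) (cabs c) <= v <= Num.max (cabs a) (cabs c) ->
  exists2 y : R, 0 <= y <= 1 & cabs (a + y%:C * (c - a)) = v.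
Proof.
move=> v0 /andP[v1 v2].
pose P : {poly R} := ((complex.Re a)%:P + (complex.Re (c - a))%:P * 'X) ^+ 2 +
   ((complex.Im a)%:P + (complex.Im (c - a))%:P * 'X) ^+ 2.
have PE y : P.[y] = cabs (a + y%:C * (c - a)) ^+ 2.
  rewrite /P !hornerE cabs_sqr.
  move: (c - a) => dd; case: (a) => a1 a2; case: dd => d1 d2 /=.
  by congr (_ ^+ 2 + _ ^+ 2); ring.
have P0 : P.[0] = cabs a ^+ 2 by rewrite PE mul0r addr0.
have P1 : P.[1] = cabs c ^+ 2 by rewrite PE mul1r addrC subrK.
have [|||y y01 Py] := @IVT R (fun y => P.[y]) 0 1 (v ^+ 2).
- exact: ler01.
- by apply: continuous_subspaceT; exact: continuous_horner.
- rewrite P0 P1 ge_min le_max !ler_sqr ?nnegrE ?cabs_ge0//.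
  by rewrite -ge_min -le_max v1.
exists y; first by move: y01; rewrite in_itv/=.
by apply/eqP; rewrite -(@eqrXn2 _ 2)// ?cabs_ge0// -PE Py.
Qed.

Definition set_coord z i (c : C) : 'rV[C]_n := \row_j (if j == i then c else z 0 j).

(** The segment may pass through 0, where the logarithm breaks down, so the path [z_i exp (x tau)]
    is followed instead. Its moduli lie between those of the ends, hence occur on the segment, and
    rotation invariance puts the path in [Om]. *)
Lemma same_limit_coord z i (c : C) : nz z -> c != 0 ->
  (forall y : R, 0 <= y <= 1 -> Om (set_coord z i (z 0 i + y%:C * (c - z 0 i)))) ->
  same_limit z (set_coord z i c).
Proof.
move=> zn c0 Hy; have zi := zn i.
have [tau tE] : exists tau, cexp tau = c / z 0 i.
  by apply: cexp_surj; rewrite mulf_neq0// invr_eq0.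
have logE (u : C) : log_map z (u *: delta_mx 0 i) = set_coord z i (z 0 i * cexp u).
  apply/rowP => j; rewrite !mxE eqxx /=; case: eqP => [->|_]; first by rewrite mulr1.
  by rewrite mulr0 cexp0 mulr1.
have -> : set_coord z i c = log_map z (tau *: delta_mx 0 i).
  by rewrite logE tE mulrC divfK.
apply: (same_limit_radial rOm df (mon_neq0 zn)).
move=> x /andP[x0 x1]; rewrite logE.
set v := z 0 i * _.
have vE : cabs v = cabs (z 0 i) * expR (x * complex.Re tau).
  rewrite /v cabsM /cexp cabsM cabs_expi mulr1 cabs_real ger0_norm ?expR_ge0//.
  by case: (tau) => t1 t2 /=; rewrite mul0r subr0.
have cE : cabs c = cabs (z 0 i) * expR (complex.Re tau).
  have -> : c = z 0 i * cexp tau by rewrite tE mulrC divfK.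
  by rewrite cabsM /cexp cabsM cabs_expi mulr1 cabs_real ger0_norm ?expR_ge0.
have z0 : 0 <= cabs (z 0 i) by exact: cabs_ge0.
have [|y y01 yv] := @segment_cabs (z 0 i) c (cabs v) (cabs_ge0 _).
  rewrite vE cE ge_min le_max.
  have [t0|t0] := leP 0 (complex.Re tau).
    apply/andP; split; apply/orP; [left|right].
      by rewrite ler_peMr// -expR0 ler_expR mulr_ge0.
    by rewrite ler_wpM2l// ler_expR; nra.
  apply/andP; split; apply/orP; [right|left].
    by rewrite ler_wpM2l// ler_expR; nra.
  by rewrite ler_piMr// -expR0 ler_expR mulr_ge0_le0// ltW.
set u := z 0 i + _ in yv.
have v0 : v != 0 by rewrite mulf_neq0// cexp_neq0.
have u0 : u != 0 by rewrite -cabs_eq0 yv cabs_eq0.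
have [t tu] : exists t : R, v / u = expi t.
  by apply: unit_expi; rewrite cabsM cabsV yv divff// cabs_eq0.
have /(rOm (fun j => if j == i then t else 0)) := Hy y y01.
congr Om; apply/rowP => j; rewrite !mxE; case: eqP => _; last by rewrite expi0 mul1r.
by rewrite -tu divfK.
Qed.

(** Coordinates are exchanged one at a time through hybrids of [z] and [z']; the discs are convex,
    so the segments stay inside. *)
Lemma same_limit_polydisc p (r : R) z z' : polydisc p r `<=` Om ->
  polydisc p r z -> polydisc p r z' -> nz z -> nz z' -> same_limit z z'.
Proof.
move=> pOm pz pz' zn z'n.
pose hyb k : 'rV[C]_n := \row_j (if (j < k)%N then z' 0 j else z 0 j).
suff H k : (k <= n)%N -> same_limit z (hyb k).
  have -> : z' = hyb n by apply/rowP => j; rewrite mxE ltn_ord.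
  exact: H.
elim: k => [_|k IH kn].
  have -> : hyb 0%N = z by apply/rowP => j; rewrite mxE.
  exact: same_limit_refl.
apply: same_limit_trans (IH (ltnW kn)) _.
pose i := Ordinal kn.
have hi : hyb k 0 i = z 0 i by rewrite mxE ltnn.
have -> : hyb k.+1 = set_coord (hyb k) i (z' 0 i).
  apply/rowP => j; rewrite !mxE ltnS (leq_eqVlt j k).
  by case: (eqVneq j i) => [->|ji]; [rewrite eqxx|rewrite (_ : (j == k :> nat) = false)//; apply/negbTE; apply: contra ji => /eqP jk; apply/eqP/val_inj].
apply: same_limit_coord => //; first by move=> j; rewrite mxE; case: ifP.
move=> y /andP[y0 y1]; apply: pOm => j; rewrite !mxE; case: eqP => [->|_]; last first.
  by case: ifP => _; [exact: pz'|exact: pz].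
rewrite ltnn.
have -> : z 0 i + y%:C * (z' 0 i - z 0 i) - p 0 i =
   (1 - y)%:C * (z 0 i - p 0 i) + y%:C * (z' 0 i - p 0 i).
  by rewrite rmorphB /=; ring.
apply: (le_lt_trans (cabsD _ _)); rewrite !cabsM !cabs_real !ger0_norm ?subr_ge0//.
move: (pz i) (pz' i); set A := cabs _; set A' := cabs _ => Ar A'r.
apply: (@le_lt_trans _ _ (Num.max A A')); last by rewrite gt_max Ar.
have AM : A <= Num.max A A' by rewrite le_max lexx.
have A'M : A' <= Num.max A A' by rewrite le_max lexx orbT.
by move: (Num.max A A') AM A'M => M AM A'M; nra.
Qed.

Lemma nonzero_coords_dense p (r : R) : 0 < r -> exists2 z, polydisc p r z & nz z.
Proof.
move=> r0; exists (\row_j (if p 0 j == 0 then (r / 2)%:C else p 0 j)) => j; rewrite mxE.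
  case: eqP => [->|_]; last by rewrite subrr cabs0.
  by rewrite subr0 cabs_real ger0_norm ?divr_ge0 ?ltW// ltr_pdivrMr// ltr_pMr// ltr1n.
case: ifPn => // _; rewrite -cabs_eq0 cabs_real gt_eqF// normr_gt0 gt_eqF// divr_gt0//.
Qed.

Lemma same_limit_all z z' : Om z -> Om z' -> nz z -> nz z' -> same_limit z z'.
Proof.
move=> Oz Oz' zn z'n.
(* Connectedness is applied to all of [Om], while quotients make sense only off the coordinate
   hyperplanes. So [B] tests a point through its neighbours with nonzero coordinates, which are
   dense. *)
pose B := [set p | Om p /\ exists2 r : R, 0 < r &
  forall w, polydisc p r w -> Om w -> nz w -> same_limit w z].
have local p : Om p -> exists2 r : R, 0 < r & polydisc p r `<=` Om /\
    forall w w', polydisc p r w -> polydisc p r w' -> nz w -> nz w' -> same_limit w w'.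
  move=> Op; have [r r0 rO] := open_polydisc oOm Op.
  by exists r => //; split=> // w w'; exact: same_limit_polydisc.
have center p (r : R) : 0 < r -> polydisc p r p by move=> r0 j; rewrite subrr cabs0.
have half p p' (r : R) : polydisc p (r / 2) p' -> polydisc p' (r / 2) `<=` polydisc p r.
  move=> pp' w p'w j.
  have -> : w 0 j - p 0 j = (w 0 j - p' 0 j) + (p' 0 j - p 0 j) by rewrite addrA subrK.
  by apply: (le_lt_trans (cabsD _ _)); rewrite [r]splitr; apply: ltrD; [exact: p'w|exact: pp'].
have key p p' (r : R) : 0 < r -> polydisc p r `<=` Om ->
    (forall w w', polydisc p r w -> polydisc p r w' -> nz w -> nz w' -> same_limit w w') ->
    (exists2 w, polydisc p r w & nz w /\ same_limit w z) -> polydisc p (r / 2) p' -> B p'.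
  move=> r0 rO H [w pw [wn wz]] pp'; have sub := half _ _ _ pp'.
  have r2 : 0 < r / 2 by exact: divr_gt0.
  split; first by apply: rO; apply: sub; exact: center.
  exists (r / 2); first exact: r2.
  move=> w' pw' _ w'n; apply: same_limit_trans wz.
  by apply: H => //; exact: sub.
have mono p (r r' : R) : r <= r' -> polydisc p r `<=` polydisc p r'.
  by move=> rr' w pw j; apply: lt_le_trans (pw j) rr'.
have BE : B = Om.
  apply: cOm.
  - exists z; split=> //; have [r r0 [rO H]] := local z Oz.
    exists r; first exact: r0.
    by move=> w pw _ wn; apply: H => //; exact: center.
  - exists B; last by apply/seteqP; split => [p Bp|p [] //]; split=> //; exact: Bp.1.
    rewrite openE => p Bp; apply/nbhs_polydisc.
    have [r r0 [rO H]] := local p Bp.1; have [_ [r1 r10 H1]] := Bp.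
    exists (r / 2); first exact: divr_gt0.
    have m0 : 0 < Num.min r r1 by rewrite lt_min r0.
    have [w pw wn] := nonzero_coords_dense p m0.
    have pwr : polydisc p r w by apply: mono pw; rewrite ge_min lexx.
    move=> p'; apply: (key p p' r r0 rO H); exists w; first exact: pwr.
    split=> //; apply: H1 => //; last exact: rO.
    by apply: mono pw; rewrite ge_min lexx orbT.
  - exists (closure B); first exact: closed_closure.
    apply/seteqP; split => [p Bp|p [Op cB]].
      by split; [exact: Bp.1|exact: subset_closure].
    have [r r0 [rO H]] := local p Op.
    have r2 : 0 < r / 2 by exact: divr_gt0.
    have nb : nbhs p (polydisc p (r / 2)).
      by apply/nbhs_polydisc; exists (r / 2); [exact: r2|exact: subset_refl].
    have [p' [Bp' pp']] := cB _ nb.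
    have [Op' [r1 r10 H1]] := Bp'.
    have m0 : 0 < Num.min (r / 2) r1 by rewrite lt_min r2.
    have [w pw wn] := nonzero_coords_dense p' m0.
    have pwr : polydisc p r w.
      by apply: (half _ _ _ pp'); apply: mono pw; rewrite ge_min lexx.
    apply: (key p p r r0 rO H); last exact: center.
    exists w; first exact: pwr.
    split=> //; apply: H1 => //; last exact: rO.
    by apply: mono pw; rewrite ge_min lexx orbT.
have : B z' by rewrite BE.
move=> [_ [r r0 Hr]]; apply: same_limit_sym; apply: Hr => //; exact: center.
Qed.

End reinhardt_connected.

(** * Homogeneous functions and their projections *)

Section ae_eq_integral_nonmeasurable.
Context d (T : measurableType d) (R : realType).
Variable mu : {measure set T -> \bar R}.
Local Open Scope ereal_scope.
Import HBNNSimple.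

(* No measurability of the integrands is needed, because the integral of a nonnegative
   function is a supremum over simple functions. *)
Let ge0_le (N : set T) (f g : T -> \bar R) : measurable N -> mu N = 0 ->
  (forall x, 0 <= f x) -> (forall x, 0 <= g x) -> (forall x, ~ N x -> f x <= g x) ->
  \int[mu]_x f x <= \int[mu]_x g x.
Proof.
move=> mN N0 f0 g0 fg; rewrite !ge0_integralTE//.
apply: ge_ereal_sup => _ [h hf <-].
have mNc : measurable (~` N) by exact: measurableC.
apply: (@le_trans _ _ (sintegral mu (proj_nnsfun h mNc))); last first.
  apply: ereal_sup_ubound; exists (proj_nnsfun h mNc) => //= x.
  rewrite mindicE; case: (boolP (x \in ~` N)) => [|_]; last by rewrite mulr0.
  by rewrite inE mulr1 => /fg; apply: le_trans; exact: hf.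
rewrite -!integralT_nnsfun le_eqVlt; apply/orP; left; apply/eqP.
apply: ge0_ae_eq_integral => //.
- by apply/measurable_EFinP.
- by apply/measurable_EFinP.
- by move=> x _; rewrite lee_fin.
- by move=> x _; rewrite lee_fin.
- exists N; split=> //= x /= H; apply: contrapT => Nx; apply: H => _.
  by rewrite mindicE mem_set// mulr1.
Qed.

Lemma ae_eq_integral_nonmeasurable (D : set T) (f g : T -> \bar R) :
  {ae mu, forall x, D x -> f x = g x} ->
  \int[mu]_(x in D) f x = \int[mu]_(x in D) g x.
Proof.
move=> [N [mN N0 fg]].
have E x : ~ N x -> (f \_ D) x = (g \_ D) x.
  move=> Nx; rewrite !patchE; case: ifPn => //; rewrite inE => Dx.
  by apply: contrapT => H; apply: Nx; apply: fg => /= /(_ Dx).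
rewrite !(integral_mkcond D) integralE [RHS]integralE; congr (_ - _);
  apply/eqP; rewrite eq_le; apply/andP; split; apply: (ge0_le mN N0) => // x /E; rewrite ?funeposE ?funenegE => ->//.
Qed.

End ae_eq_integral_nonmeasurable.

(** * Integrals of complex-valued functions *)

Section complex_integral.
Variables (R : realType) (n : nat) (Om : set 'rV[R[i]]_n).
Local Notation C := R[i].
Local Notation mu := (lebesgue_Cn R n).
Hypothesis mOm : measurable Om.
Implicit Types (h g : 'rV[C]_n -> C).

Definition cintegrable h :=
  mu.-integrable Om (EFin \o (fun z => complex.Re (h z))) /\
  mu.-integrable Om (EFin \o (fun z => complex.Im (h z))).

Lemma cintegrable_measurable h : cintegrable h -> measurable_fun Om h.
Proof.
move=> [hr hi]; apply/(measurable_fun_complexP _ mOm); split.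
  by apply/measurable_EFinP; exact: (measurable_int mu).
by apply/measurable_EFinP; exact: (measurable_int mu).
Qed.

Lemma cintegrable_dominated h (G : 'rV[C]_n -> R) : measurable_fun Om h ->
  mu.-integrable Om (EFin \o G) -> (forall z, Om z -> cabs (h z) <= G z) ->
  cintegrable h.
Proof.
move=> /(measurable_fun_complexP _ mOm)[mr mi] iG hG; split.
- apply: (le_integrable mOm _ _ iG); first exact/measurable_EFinP.
  by move=> z Oz /=; rewrite lee_fin (le_trans (Re_le_cabs _))// (le_trans (hG z Oz))// ler_norm.
- apply: (le_integrable mOm _ _ iG); first exact/measurable_EFinP.
  by move=> z Oz /=; rewrite lee_fin (le_trans (Im_le_cabs _))// (le_trans (hG z Oz))// ler_norm.
Qed.

Lemma eq_cintegrable h g : (forall z, Om z -> h z = g z) -> cintegrable h -> cintegrable g.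
Proof.
move=> hg [hr hi]; split; [apply: eq_integrable hr|apply: eq_integrable hi] => // z;
  by rewrite inE => Oz /=; rewrite hg.
Qed.

Lemma cintegrableD h g : cintegrable h -> cintegrable g -> cintegrable (fun z => h z + g z).
Proof.
move=> [hr hi] [gr gi]; split.
- have := integrableD mOm hr gr; apply: eq_integrable => // z _ /=.
  by rewrite -EFinD; case: (h z) (g z) => [a b] [a1 b1].
- have := integrableD mOm hi gi; apply: eq_integrable => // z _ /=.
  by rewrite -EFinD; case: (h z) (g z) => [a b] [a1 b1].
Qed.

Lemma CintegralD h g : cintegrable h -> cintegrable g ->
  Cintegral Om (fun z => h z + g z) = Cintegral Om h + Cintegral Om g.
Proof.
move=> [hr hi] [gr gi]; rewrite /Cintegral.
under [X in X +i* _]eq_Rintegral do rewrite raddfD.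
under [X in _ +i* X]eq_Rintegral do rewrite raddfD.
by rewrite !RintegralD.
Qed.

Lemma cintegrableZ (c : C) h : cintegrable h -> cintegrable (fun z => c * h z).
Proof.
case: c => a b [hr hi]; split.
- have := integrableB mOm (integrableZl mOm a hr) (integrableZl mOm b hi).
  by apply: eq_integrable => // z _ /=; case: (h z).
- have := integrableD mOm (integrableZl mOm a hi) (integrableZl mOm b hr).
  by apply: eq_integrable => // z _ /=; case: (h z).
Qed.

Lemma CintegralZ (c : C) h : cintegrable h ->
  Cintegral Om (fun z => c * h z) = c * Cintegral Om h.
Proof.
case: c => a b [hr hi]; rewrite /Cintegral.
have iz (k : R) (v : 'rV[C]_n -> R) : mu.-integrable Om (EFin \o v) ->
    mu.-integrable Om (EFin \o (fun z => k * v z)).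
  by move=> iv; have := integrableZl mOm k iv; apply: eq_integrable.
rewrite [RHS]/GRing.mul /=; congr (_ +i* _).
- rewrite -!RintegralZl// -RintegralB//; try exact: iz.
  by apply: eq_Rintegral => z _; case: (h z).
- rewrite -!RintegralZl// -RintegralD//; try exact: iz.
  by apply: eq_Rintegral => z _; case: (h z).
Qed.

Lemma cintegrable0 : cintegrable (fun=> 0).
Proof. by split; have := integrable0 mu Om; apply: eq_integrable. Qed.

Lemma Cintegral0 : Cintegral Om (fun=> 0) = 0.
Proof. by rewrite /Cintegral /= !Rintegral_cst// !mul0r. Qed.

Lemma cintegrable_sum (I : Type) (r : seq I) (h : I -> 'rV[C]_n -> C) :
  (forall i, cintegrable (h i)) -> cintegrable (fun z => \sum_(i <- r) h i z).
Proof.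
move=> ih; elim: r => [|i r IH].
  by apply: eq_cintegrable cintegrable0 => z _; rewrite big_nil.
by apply: eq_cintegrable (cintegrableD (ih i) IH) => z _; rewrite big_cons.
Qed.

Lemma eq_Cintegral h g : (forall z, Om z -> h z = g z) -> Cintegral Om h = Cintegral Om g.
Proof.
by move=> hg; congr (_ +i* _); apply: eq_Rintegral => z; rewrite inE => Oz; rewrite hg.
Qed.

Lemma Cintegral_sum (I : Type) (r : seq I) (h : I -> 'rV[C]_n -> C) :
  (forall i, cintegrable (h i)) ->
  Cintegral Om (fun z => \sum_(i <- r) h i z) = \sum_(i <- r) Cintegral Om (h i).
Proof.
move=> ih; elim: r => [|i r IH].
  by rewrite big_nil -[RHS]Cintegral0; apply: eq_Cintegral => z _; rewrite big_nil.
rewrite big_cons -IH -CintegralD//; last exact: cintegrable_sum.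
by apply: eq_Cintegral => z _; rewrite big_cons.
Qed.

Lemma ae_eq_Cintegral h g : {ae mu, forall z, Om z -> h z = g z} ->
  Cintegral Om h = Cintegral Om g.
Proof.
move=> hg; rewrite /Cintegral /Rintegral; congr (fine _ +i* fine _);
  by apply: ae_eq_integral_nonmeasurable; apply: filterS hg => z /[apply] ->.
Qed.

Lemma Cintegral_dominated (h_ : nat -> 'rV[C]_n -> C) h (G : 'rV[C]_n -> R) :
  (forall k, measurable_fun Om (h_ k)) -> measurable_fun Om h ->
  mu.-integrable Om (EFin \o G) -> (forall k z, Om z -> cabs (h_ k z) <= G z) ->
  {ae mu, forall z, Om z -> (fun k => cabs (h_ k z - h z)) @ \oo --> (0 : R)} ->
  (fun k => cabs (Cintegral Om (h_ k) - Cintegral Om h)) @ \oo --> (0 : R).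
Proof.
move=> mh_ mh iG hG hcv.
have part (p : C -> R) : (forall c c', p (c - c') = p c - p c') -> (forall c, `|p c| <= cabs c) ->
    (forall k, measurable_fun Om (fun z => p (h_ k z))) -> measurable_fun Om (fun z => p (h z)) ->
    (fun k => \int[mu]_(z in Om) p (h_ k z)) @ \oo --> \int[mu]_(z in Om) p (h z).
  move=> pB pl mp_ mp.
  have [||| | |ip _ H] := @dominated_convergence _ _ _ mu _ mOm
    (fun k => EFin \o (fun z => p (h_ k z))) (EFin \o (fun z => p (h z))) (EFin \o G).
  - by move=> k; exact/measurable_EFinP.
  - exact/measurable_EFinP.
  - apply: filterS hcv => z Hz Oz; apply: cvg_EFin; first exact: nearW.
    apply/subr_cvg0; apply: norm_cvg0.
    apply: (squeeze_cvgr _ (cvg_cst 0) (Hz Oz)); apply: nearW => k.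
    by rewrite normr_ge0 /= -pB pl.
  - exact: iG.
  - by apply: aeW => z k Oz; rewrite /= lee_fin (le_trans (pl _))// hG.
  by move: H; rewrite -(fineK (integrable_fin_num mOm ip)) => /fine_cvg.
have m_ k := (measurable_fun_complexP _ mOm).1 (mh_ k).
have [mr mi] := (measurable_fun_complexP _ mOm).1 mh.
have cr := part (@complex.Re R) (raddfB _) (@Re_le_cabs R) (fun k => (m_ k).1) mr.
have ci := part (@complex.Im R) (raddfB _) (@Im_le_cabs R) (fun k => (m_ k).2) mi.
have cr0 : (fun k => `|\int[mu]_(z in Om) complex.Re (h_ k z) - \int[mu]_(z in Om) complex.Re (h z)|) @ \oo --> (0 : R).
  by apply/norm_cvg0P/subr_cvg0.
have ci0 : (fun k => `|\int[mu]_(z in Om) complex.Im (h_ k z) - \int[mu]_(z in Om) complex.Im (h z)|) @ \oo --> (0 : R).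
  by apply/norm_cvg0P/subr_cvg0.
have H := cvgD cr0 ci0; rewrite addr0 in H.
refine (squeeze_cvgr _ (cvg_cst (0 : R)) (H _)); apply: nearW => k.
by rewrite cabs_ge0 /= (le_trans (cabs_le_ReIm _)).
Qed.

End complex_integral.

Section pushforward_invariance.
Context d (T : measurableType d) (R : realType) (mu : {measure set T -> \bar R}).
Local Open Scope ereal_scope.

Lemma measure_preserving_integral (phi : T -> T) (D : set T) (f : T -> \bar R) :
  measurable D -> measure_preserving mu phi -> (forall x, D (phi x) <-> D x) ->
  measurable_fun D f -> \int[mu]_(x in D) f (phi x) = \int[mu]_(x in D) f x.
Proof.
move=> mD [mphi pphi] Dphi mf.
have ge0 (g : T -> \bar R) : measurable_fun D g -> (forall x, 0 <= g x) ->
    \int[mu]_(x in D) g (phi x) = \int[mu]_(x in D) g x.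
  move=> mg g0; have DE : phi @^-1` D = D by apply/seteqP; split => x /=; rewrite Dphi.
  rewrite -{1}DE -[LHS](ge0_integral_pushforward mphi)//.
  by apply: eq_measure_integral => A mA _; exact: pphi.
rewrite integralE [RHS]integralE; congr (_ - _).
- rewrite -(ge0 f^\+ (measurable_funepos mf) (funepos_ge0 f)).
  by apply: eq_integral => x _; rewrite !funeposE.
- rewrite -(ge0 f^\- (measurable_funeneg mf) (funeneg_ge0 f)).
  by apply: eq_integral => x _; rewrite !funenegE.
Qed.

End pushforward_invariance.

(** * Invariance under rotations and homogeneity *)

Section rotations.
Variables (R : realType) (n : nat) (Om : set 'rV[R[i]]_n).
Local Notation C := R[i].
Local Notation mu := (lebesgue_Cn R n).
Hypotheses (mOm : measurable Om) (rOm : reinhardt Om).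
Implicit Types (h u v : 'rV[C]_n -> C) (th : 'I_n -> R).

Definition rotate th (z : 'rV[C]_n) := scale_coords (fun j => expi (th j)) z.

Lemma rotateK th z : rotate (fun j => - th j) (rotate th z) = z.
Proof. by apply/rowP => j; rewrite !mxE mulrA -expiD addNr expi0 mul1r. Qed.

Lemma reinhardt_rotate th z : Om (rotate th z) <-> Om z.
Proof.
split; last exact: rOm.
by move=> Oz; rewrite -(rotateK th z); exact: rOm.
Qed.

Lemma measure_preserving_rotate th : measure_preserving mu (rotate th).
Proof. by apply: measure_preserving_rotation => j; rewrite /expi /= cos2Dsin2. Qed.

Lemma measurable_rotate th h : measurable_fun Om h -> measurable_fun Om (h \o rotate th).
Proof.
move=> mh; apply: (measurable_comp mOm _ mh).
  by move=> _ [z Oz <-]; exact/reinhardt_rotate.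
by apply: measurable_funTS; exact: (measure_preserving_rotate th).1.
Qed.

Lemma Cintegral_rotate th h : measurable_fun Om h ->
  Cintegral Om (fun z => h (rotate th z)) = Cintegral Om h.
Proof.
move=> /(measurable_fun_complexP _ mOm)[mr mi].
rewrite /Cintegral /Rintegral; congr (fine _ +i* fine _).
- apply: (measure_preserving_integral (f := EFin \o (fun z => complex.Re (h z)))) => //.
  + exact: measure_preserving_rotate.
  + exact: reinhardt_rotate.
  + exact/measurable_EFinP.
- apply: (measure_preserving_integral (f := EFin \o (fun z => complex.Im (h z)))) => //.
  + exact: measure_preserving_rotate.
  + exact: reinhardt_rotate.
  + exact/measurable_EFinP.
Qed.

Lemma ae_rotate th (P : 'rV[C]_n -> Prop) : {ae mu, forall z, Om z -> P z} ->
  {ae mu, forall z, Om z -> P (rotate th z)}.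
Proof.
move=> [N [mN N0 PN]]; have [mr pr] := measure_preserving_rotate th.
exists (rotate th @^-1` N); split.
- by rewrite -[X in measurable X]setTI; exact: mr.
- by rewrite pr.
- move=> z H; apply: PN => /= K; apply: H => /= Oz; apply: K; exact/reinhardt_rotate.
Qed.

(** The null set may depend on [th], so the notion is stable under changes on null sets; each
    integral identity uses one rotation at a time. *)
Definition ae_homogeneous (k : 'I_n -> int) u := forall th,
  {ae mu, forall z, Om z -> u (rotate th z) = expi (\sum_j (k j)%:~R * th j) * u z}.

Lemma ae_homogeneousM k k' u v : ae_homogeneous k u -> ae_homogeneous k' v ->
  ae_homogeneous (fun j => k j + k' j) (fun z => u z * v z).
Proof.
move=> hu hv th; apply: filterS2 (hu th) (hv th) => z Hu Hv Oz.
rewrite (Hu Oz) (Hv Oz) mulrACA -expiD -big_split /=.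
by congr (expi _ * _); apply: eq_bigr => j _; rewrite rmorphD mulrDl.
Qed.

Lemma conjc_expi (t : R) : conjc (expi t) = expi (- t).
Proof. by rewrite /expi /= cosN sinN. Qed.

Lemma ae_homogeneous_conjc k u : ae_homogeneous k u ->
  ae_homogeneous (fun j => - k j) (fun z => conjc (u z)).
Proof.
move=> hu th; apply: filterS (hu th) => z Hu Oz.
rewrite (Hu Oz); transitivity (conjc (expi (\sum_j (k j)%:~R * th j)) * conjc (u z)).
  exact: (rmorphM (@conjc R)).
rewrite conjc_expi -sumrN.
by congr (expi _ * _); apply: eq_bigr => j _; rewrite rmorphN mulNr.
Qed.

Lemma expiMn (t : R) m : expi (m%:R * t) = expi t ^+ m.
Proof.
elim: m => [|m IH]; first by rewrite mul0r expi0 expr0.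
by rewrite -natr1 mulrDl mul1r expiD IH exprSr.
Qed.

Lemma expi_sum (F : 'I_n -> R) : expi (\sum_j F j) = \prod_j expi (F j).
Proof.
have H (r : seq 'I_n) : expi (\sum_(j <- r) F j) = \prod_(j <- r) expi (F j).
  elim: r => [|j r IH]; first by rewrite !big_nil expi0.
  by rewrite !big_cons expiD IH.
exact: H.
Qed.

Lemma mon_rotate (b : 'I_n -> nat) th z :
  mon b (rotate th z) = expi (\sum_j (b j)%:R * th j) * mon b z.
Proof.
rewrite expi_sum /mon -big_split /=; apply: eq_bigr => j _.
by rewrite mxE exprMn expiMn.
Qed.

Lemma ae_homogeneous_mon (b : 'I_n -> nat) : ae_homogeneous (fun j => (b j)%:Z) (mon b).
Proof. by move=> th; apply: aeW => z _; exact: mon_rotate. Qed.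

Lemma eq_ae_homogeneous k u v : {ae mu, forall z, Om z -> u z = v z} ->
  ae_homogeneous k u -> ae_homogeneous k v.
Proof.
move=> uv hu th; apply: filterS3 (hu th) uv (ae_rotate th uv) => z Hu H1 H2 Oz.
by rewrite -(H2 Oz) -(H1 Oz) Hu.
Qed.

Lemma ae_homogeneousD k u v : ae_homogeneous k u -> ae_homogeneous k v ->
  ae_homogeneous k (fun z => u z + v z).
Proof.
by move=> hu hv th; apply: filterS2 (hu th) (hv th) => z Hu Hv Oz; rewrite Hu// Hv// mulrDr.
Qed.

Lemma Cintegral_homogeneous0 k u j : ae_homogeneous k u -> k j != 0 ->
  cintegrable Om u -> Cintegral Om u = 0.
Proof.
move=> hu kj iu.
(* The angle makes the character equal to -1, so that the integral equals its opposite. *)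
pose th i : R := if i == j then pi / (k j)%:~R else 0.
have E : expi (\sum_i (k i)%:~R * th i) = -1.
  rewrite (bigD1 j)//= {1}/th eqxx big1 ?addr0; last first.
    by move=> i ij; rewrite /th (negbTE ij) mulr0.
  rewrite mulrCA divff ?intr_eq0// mulr1 /expi cospi sinpi.
  by apply/eqP; rewrite eq_complex /= oppr0 !eqxx.
have mu' := cintegrable_measurable mOm iu.
have := Cintegral_rotate th mu'; rewrite (ae_eq_Cintegral (hu th)) E CintegralZ//.
by rewrite mulN1r => /eqP; rewrite eq_sym -subr_eq0 opprK -mulr2n mulrn_eq0 => /eqP.
Qed.

End rotations.

Section complex_limits.
Variable R : realType.
Local Notation C := R[i].
Implicit Types (a : nat -> C) (l : C).

Definition ccvg a l := (fun k => cabs (a k - l)) @ \oo --> (0 : R).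

Lemma ccvg_le a l (e : nat -> R) : (forall k, cabs (a k - l) <= e k) ->
  e @ \oo --> (0 : R) -> ccvg a l.
Proof.
move=> ae e0; apply: (squeeze_cvgr _ (cvg_cst 0) e0); apply: nearW => k.
by rewrite cabs_ge0 ae.
Qed.

Lemma ccvg_cst l : ccvg (fun=> l) l.
Proof. by rewrite /ccvg subrr cabs0; exact: cvg_cst. Qed.

Lemma ccvgB a l a' l' : ccvg a l -> ccvg a' l' -> ccvg (fun k => a k - a' k) (l - l').
Proof.
move=> al al'; apply: (@ccvg_le _ _ (fun k => cabs (a k - l) + cabs (a' k - l'))).
  move=> k; rewrite (_ : _ - _ = (a k - l) - (a' k - l')); last by ring.
  by rewrite (le_trans (cabsD _ _))// cabsN.
by rewrite -[X in _ --> X]addr0; exact: (cvgD al al').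
Qed.

Lemma ccvgM a l a' l' : ccvg a l -> ccvg a' l' -> ccvg (fun k => a k * a' k) (l * l').
Proof.
move=> al al'; apply: (@ccvg_le _ _ (fun k => cabs (a k - l) * cabs (a' k - l') +
   cabs (a k - l) * cabs l' + cabs l * cabs (a' k - l'))).
  move=> k; rewrite (_ : _ - _ = (a k - l) * (a' k - l') + (a k - l) * l' + l * (a' k - l')).
    rewrite (le_trans (cabsD _ _))// cabsM lerD2r (le_trans (cabsD _ _))// !cabsM//.
  by ring.
have -> : (0 : R) = 0 * 0 + 0 * cabs l' + cabs l * 0 by rewrite !mul0r mulr0 !addr0.
apply: cvgD; last by apply: cvgM => //; exact: cvg_cst.
apply: cvgD; first exact: cvgM.
by apply: cvgM => //; exact: cvg_cst.
Qed.

Lemma ccvg_unique a l l' : ccvg a l -> ccvg a l' -> l = l'.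
Proof.
move=> al al'; have := ccvgB al al'; rewrite /ccvg.
under eq_fun do rewrite subrr sub0r cabsN.
move=> H; have /eqP : cabs (l - l') = 0 by exact: (cvg_unique _ (cvg_cst _) H).
by rewrite cabs_eq0 subr_eq0 => /eqP.
Qed.

End complex_limits.

Lemma ae_nonzero_coords (R : realType) (n : nat) :
  {ae lebesgue_Cn R n, forall z : 'rV[R[i]]_n, nonzero_coords z}.
Proof.
apply: filter_forall => j; exists [set z : 'rV[R[i]]_n | z 0 j = 0]; split.
- have := @measurable_coord R n j [set 0]; apply.
  rewrite (_ : [set 0] = [set c : R[i] | complex.Re c = 0] `&` [set c | complex.Im c = 0]).
    apply: measurableI; rewrite -[X in measurable X]setTI.
      exact: (measurable_Re measurableT (measurable_set1 0)).
    exact: (measurable_Im measurableT (measurable_set1 0)).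
  by apply/seteqP; split => [c ->//|[x y] /= [-> ->]].
- exact: lebesgue_Cn_coord0.
- by move=> z /= /negP; rewrite negbK => /eqP.
Qed.

(** * Holomorphic functions: measurability, orbits and truncation *)

Section holomorphic.
Variables (R : realType) (n : nat).
Local Notation C := R[i].
Local Notation mu := (lebesgue_Cn R n).
Variables (Om : set 'rV[C]_n) (f : 'rV[C]_n -> C).
Hypotheses (oOm : open Om) (rOm : reinhardt Om).
Hypothesis df : forall z, Om z -> differentiable f z.

Lemma differentiable_polydisc z (e : R) : Om z -> 0 < e ->
  exists2 r : R, 0 < r & forall w, polydisc z r w -> Om w /\ cabs (f w - f z) <= e.
Proof.
move=> Oz e0; have := differentiable_continuous (df Oz).
move=> /cvgrPdist_le/(_ e%:C); rewrite ltcR => /(_ e0)/nbhs_polydisc[r r0 Hr].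
have [r' r'0 Hr'] := open_polydisc oOm Oz.
exists (Num.min r r'); first by rewrite lt_min r0.
move=> w Hw; split.
  by apply: Hr' => j; apply: (lt_le_trans (Hw j)); rewrite ge_min lexx orbT.
have /Hr : polydisc z r w.
  by move=> j; apply: (lt_le_trans (Hw j)); rewrite ge_min lexx.
by rewrite /= normc_cabs lecR cabsB.
Qed.

Lemma open_superlevel (p : C -> R) (a : R) :
  (forall c c', `|p c - p c'| <= cabs (c - c')) ->
  open [set z | Om z /\ a < p (f z)].
Proof.
move=> pl; rewrite openE => z [Oz az]; apply/nbhs_polydisc.
have e0 : 0 < (p (f z) - a) / 2 by rewrite divr_gt0// subr_gt0.
have [r r0 Hr] := differentiable_polydisc Oz e0.
exists r => // w /Hr[Ow fw]; split => //.
have := pl (f w) (f z); rewrite ler_norml => /andP[H _].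
have : a < p (f z) := az; move: fw H; set x := cabs _; lra.
Qed.

Lemma measurable_differentiable : measurable_fun Om f.
Proof.
have mOm := open_measurable_Cn oOm.
have part (p : C -> R) : (forall c c', `|p c - p c'| <= cabs (c - c')) ->
    measurable_fun Om (p \o f).
  move=> pl; apply: (measurability (@RGenOInfty.G R)); first exact: RGenOInfty.measurableE.
  move=> _ [_ [a ->] <-]; apply: open_measurable_Cn.
  rewrite (_ : _ `&` _ = [set z | Om z /\ a < p (f z)]); first exact: open_superlevel.
  by apply/seteqP; split => z /=; rewrite in_itv/= andbT.
apply/(measurable_fun_complexP _ mOm); split.
  by apply: part => c c'; rewrite -raddfB; exact: Re_le_cabs.
by apply: part => c c'; rewrite -[_ - _](raddfB (@complex.Im R)); exact: Im_le_cabs.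
Qed.

Lemma rotateD th th' z : rotate th (rotate th' z) = rotate (fun j => th j + th' j) z :> 'rV[C]_n.
Proof. by apply/rowP => j; rewrite !mxE mulrA expiD. Qed.

Lemma log_map_angles (q : 'rV[R]_n) (z : 'rV[C]_n) :
  log_map z (angles q) = rotate (fun j => 2 * pi * q 0 j) z.
Proof. by apply/rowP => j; rewrite !mxE cexp_Im mulrC. Qed.

Lemma expi_floor (t : R) : exists2 q : R, 0 <= q <= 1 & expi t = expi (2 * pi * q).
Proof.
have p2 : 2 * pi != 0 :> R by rewrite mulf_neq0// gt_eqF// pi_gt0.
have E2 : expi (2 * pi : R) = 1 by have := @cexp_nat2pi R 1; rewrite mulr1 cexp_Im.
pose m := Num.floor (t / (2 * pi)); exists (t / (2 * pi) - m%:~R).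
  have := mem_rg1_floor (t / (2 * pi)); rewrite -/m => /andP[h1 h2].
  by rewrite subr_ge0 h1/= lerBlDl ltW.
have E : expi (- (m%:~R * (2 * pi)) : R) = 1.
  case: (m) => k; last rewrite NegzE rmorphN mulNr opprK /=.
    by rewrite -mulrN expiMn -conjc_expi E2 conjc1 expr1n.
  by rewrite expiMn E2 expr1n.
by rewrite mulrBr mulrC divfK// expiD mulrC [2 * pi * _]mulrC E mul1r.
Qed.

(** The orbit of [z] is parametrised by a compact cube of angles, on which [log_fun] with exponent
    zero is [f] itself. *)
Lemma rotations_bounded z : Om z -> exists M : R, forall th, cabs (f (rotate th z)) <= M.
Proof.
move=> Oz; have rz q : Om (log_map z (0 + angles q)).
  by rewrite add0r; exact: reinhardt_angles.
have cg := eps_continuous_log_fun (fun=> 0%N) df rz.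
have E q : cabs (log_fun f (fun=> 0%N) z (0 + angles q)) = cabs (f (log_map z (angles q))).
  by rewrite /log_fun add0r big1 ?oppr0 ?cexp0 ?mulr1// => j _; rewrite mul0r.
have := @cube_near_covering R n 1 R (pinfty_nbhs R)
  (fun M q => cabs (f (log_map z (angles q))) <= M).
case.
  move=> q0 _; have [d d0 Hd] := cg q0 1 ltr01; exists d => //.
  near=> M => q /Hd H; rewrite -E.
  have -> : log_fun f (fun=> 0%N) z (0 + angles q) =
    (log_fun f (fun=> 0%N) z (0 + angles q) - log_fun f (fun=> 0%N) z (0 + angles q0)) +
    log_fun f (fun=> 0%N) z (0 + angles q0) by rewrite subrK.
  apply: (le_trans (cabsD _ _)); apply: (le_trans (lerD H (lexx _))).
  by near: M; apply: nbhs_pinfty_ge; rewrite num_real.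
move=> M0 [_ HM]; exists (M0 + 1) => th.
pose q : 'rV[R]_n := \row_j sval (cid2 (expi_floor (th j))).
have -> : rotate th z = log_map z (angles q).
  rewrite log_map_angles; apply/rowP => j; rewrite !mxE.
  by case: cid2 => x _ /= ->.
by apply: HM; [rewrite ltrDl|move=> j; rewrite mxE; case: cid2].
Unshelve. all: by end_near. Qed.

(** A rotation invariant set on which [f], and hence each of its grid averages, is bounded by [M].
    Invariance lets the truncation commute with rotations. *)
Definition rotation_sublevel (M : R) :=
  [set z | Om z /\ forall th, cabs (f (rotate th z)) <= M].

(** Uncountably many angles are involved, but the complement in [Om] is open: one angle with a large
    value serves for nearby points as well. *)
Lemma measurable_rotation_sublevel M : measurable (rotation_sublevel M).
Proof.
rewrite (_ : rotation_sublevel M = Om `\` [set z | Om z /\ exists th, M < cabs (f (rotate th z))]).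
  apply: measurableD; first exact: open_measurable_Cn.
  apply: open_measurable_Cn; rewrite openE => z [Oz [th Mz]]; apply/nbhs_polydisc.
  have Orz : Om (rotate th z) by exact: rOm.
  have e0 : 0 < (cabs (f (rotate th z)) - M) / 2 by rewrite divr_gt0// subr_gt0.
  have [r r0 Hr] := differentiable_polydisc Orz e0.
  exists r => // w zw; have /Hr[Ow fw] : polydisc (rotate th z) r (rotate th w).
    by move=> j; rewrite !mxE -mulrBr cabsM cabs_expi mul1r; exact: zw.
  split; first exact: (reinhardt_rotate rOm th w).1 Ow.
  exists th; have := cabsD (f (rotate th w)) (f (rotate th z) - f (rotate th w)).
  by rewrite addrCA subrr addr0 cabsB; move: fw Mz; set x := cabs _; lra.
apply/seteqP; split => z.
  by move=> [Oz H]; split => // -[_ [th]]; rewrite ltNge H.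
move=> [Oz H]; split => // th; rewrite leNgt; apply/negP => H'; apply: H; split => //.
by exists th.
Qed.

Lemma rotation_sublevel_rotate M th z :
  rotation_sublevel M (rotate th z) <-> rotation_sublevel M z.
Proof.
have H th' z' : rotation_sublevel M z' -> rotation_sublevel M (rotate th' z').
  by move=> [Oz Hz]; split; [exact: rOm|move=> t; rewrite rotateD].
by split; [move=> /(H (fun j => - th j)); rewrite rotateK|exact: H].
Qed.

End holomorphic.

(** * Inner products with homogeneous functions *)

Section homogeneous_projection.
Variables (R : realType) (n : nat).
Local Notation C := R[i].
Local Notation mu := (lebesgue_Cn R n).
Variables (Om : set 'rV[C]_n) (f : 'rV[C]_n -> C) (b : 'I_n -> nat).
Hypotheses (oOm : open Om) (rOm : reinhardt Om) (cOm : connected Om) (neOm : Om !=set0).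
Hypotheses (bOm : bounded_set Om) (df : forall z, Om z -> differentiable f z).

Let mOm : measurable Om := open_measurable_Cn oOm.
Let finOm : (mu Om < +oo)%E := lebesgue_Cn_bounded bOm mOm.
Let mf : measurable_fun Om f := measurable_differentiable oOm df.

Lemma integrable_cst_domain (c : R) : mu.-integrable Om (EFin \o (fun=> c)).
Proof.
apply/integrableP; split; first exact: measurable_cst.
by rewrite /= integral_cst//= lte_mul_pinfty.
Qed.

Lemma cintegrable_bounded (h : 'rV[C]_n -> C) (c : R) : measurable_fun Om h ->
  (forall z, Om z -> cabs (h z) <= c) -> cintegrable Om h.
Proof.
move=> mh hc; apply: (cintegrable_dominated mOm (G := fun=> c)) => //.
exact: integrable_cst_domain.
Qed.

Lemma mon_bounded : exists2 B : R, 0 <= B & forall z : 'rV[C]_n, Om z -> cabs (mon b z) <= B.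
Proof.
have [M M0 HM] := bounded_set_cabs bOm.
exists (\prod_j M ^+ b j); first by apply: prodr_ge0 => j _; rewrite exprn_ge0// ltW.
move=> z Oz; rewrite cabs_prod; apply: ler_prod => j _; rewrite cabs_ge0 cabsX /=.
by rewrite lerXn2r ?nnegrE ?cabs_ge0// ?HM// ltW.
Qed.

Lemma measurable_mon : measurable_fun Om (mon b : 'rV[C]_n -> C).
Proof.
have H (r : seq 'I_n) : measurable_fun Om (fun z : 'rV[C]_n => \prod_(j <- r) z 0 j ^+ b j).
  elim: r => [|j r IH].
    by apply: (eq_measurable_fun (fun _ : 'rV[C]_n => 1 : C)) => [z _|]; [rewrite big_nil|exact: measurable_cst].
  apply: (eq_measurable_fun (fun z : 'rV[C]_n => z 0 j ^+ b j * \prod_(j <- r) z 0 j ^+ b j)).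
    by move=> z _; rewrite big_cons.
  apply: measurable_funM_complex => //.
  elim: (b j) => [|k IHk].
    by apply: (eq_measurable_fun (fun _ : 'rV[C]_n => 1 : C)) => [z _|]; [rewrite expr0|exact: measurable_cst].
  apply: (eq_measurable_fun (fun z : 'rV[C]_n => z 0 j * z 0 j ^+ k)) => [z _|]; first by rewrite exprS.
  apply: measurable_funM_complex => //.
  by apply: measurable_funTS; exact: measurable_entry.
exact: H.
Qed.

Lemma grid_rotation (z : 'rV[C]_n) (q : 'rV[R]_n) : log_fun f b z (angles q) =
  f (rotate (fun j => 2 * pi * q 0 j) z) * expi (- \sum_j (b j)%:R * (2 * pi * q 0 j)).
Proof.
rewrite /log_fun log_map_angles; congr (_ * _); rewrite -cexp_Im; congr cexp.
have H (r : seq 'I_n) : \sum_(j <- r) (b j)%:R * angles q 0 j =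
    0 +i* \sum_(j <- r) (b j)%:R * (2 * pi * q 0 j) :> C.
  elim: r => [|j r IH]; first by rewrite !big_nil.
  rewrite !big_cons IH !mxE -(rmorph_nat (real_complex R)); apply/eqP; rewrite eq_complex /=.
  by rewrite !(mulr0, addr0, mul0r) subr0 !eqxx.
by rewrite H; apply/eqP; rewrite eq_complex /= oppr0 !eqxx.
Qed.

Section truncated.
Variables (M : R) (z0 : 'rV[C]_n).
Local Notation K := (rotation_sublevel Om f M).
Hypotheses (Kz0 : K z0) (nz0 : nonzero_coords z0).
Implicit Types (u : 'rV[C]_n -> C).

Let trunc u (g : 'rV[C]_n -> C) z : C := (\1_K z : R)%:C * (u z * conjc (g z)).

Let M0 : 0 <= M.
Proof. by have [_ /(_ (fun=> 0))] := Kz0; apply: le_trans; exact: cabs_ge0. Qed.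

Let measurable_trunc u g : measurable_fun Om u -> measurable_fun Om g ->
  measurable_fun Om (trunc u g).
Proof.
move=> mu' mg; apply: measurable_funM_complex => //.
  apply/measurable_fun_complexP => //; split => /=; last exact: (measurable_cst (0 : R)).
  by apply: measurable_funTS; apply: measurable_indic; exact: measurable_rotation_sublevel.
by apply: measurable_funM_complex => //; exact: measurable_fun_conjc.
Qed.

Let trunc_le u g (B G : R) z : 0 <= B -> 0 <= G -> cabs (u z) <= B -> (K z -> cabs (g z) <= G) ->
  cabs (trunc u g z) <= B * G.
Proof.
move=> B0 G0 uB gG; rewrite /trunc !cabsM cabsJ cabs_real indicE.
case: (boolP (z \in K)) => [|_]; last by rewrite normr0 mul0r mulr_ge0.
by rewrite inE normr1 mul1r => Kz; apply: ler_pM; rewrite ?cabs_ge0// gG.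
Qed.

Let measurable_grid (q : 'rV[R]_n) : measurable_fun Om (fun z => log_fun f b z (angles q)).
Proof.
apply: (eq_measurable_fun (fun z : 'rV[C]_n => f (rotate (fun j => 2 * pi * q 0 j) z) *
   expi (- \sum_j (b j)%:R * (2 * pi * q 0 j)))) => [z _|]; first by rewrite grid_rotation.
apply: measurable_funM_complex => //; exact: measurable_rotate.
Qed.

Let grid_le (q : 'rV[R]_n) z : K z -> cabs (log_fun f b z (angles q)) <= M.
Proof. by move=> [_ Kz]; rewrite grid_rotation cabsM cabs_expi mulr1. Qed.

Let average_le s z : K z -> cabs (grid_average f b s z) <= M.
Proof.
move=> Kz; rewrite /grid_average cabsM cabs_real.
rewrite ger0_norm ?invr_ge0 ?exprn_ge0// mulrC ler_pdivrMr ?exprn_gt0//.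
apply: (le_trans (cabs_sum _ _ _)); apply: (@le_trans _ _ (\sum_(k : {ffun 'I_n -> 'I_(2 ^ s)}) M)).
  by apply: ler_sum => k _; exact: grid_le.
by rewrite sumr_const card_ffun !card_ord -(mulr_natr M) !natrX.
Qed.

(** Rotating [u] produces a character that cancels the one in the average of [f], so each grid point
    contributes the same integral. *)
Let average_integral u (B : R) s : measurable_fun Om u -> 0 <= B ->
  (forall z, Om z -> cabs (u z) <= B) -> ae_homogeneous Om (fun j => (b j)%:Z) u ->
  Cintegral Om (trunc u (grid_average f b s)) = Cintegral Om (trunc u f).
Proof.
move=> mu' B0 uB hu.
pose L (k : {ffun 'I_n -> 'I_(2 ^ s)}) z := log_fun f b z (angles (grid k)).
have iL k : cintegrable Om (trunc u (L k)).
  apply: (@cintegrable_bounded _ (B * M)); first exact: (measurable_trunc mu' (measurable_grid (grid k))).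
  move=> z Oz; apply: (trunc_le B0 M0 (uB z Oz)); exact: grid_le.
have EL k : Cintegral Om (trunc u (L k)) = Cintegral Om (trunc u f).
  pose th j : R := 2 * pi * grid k 0 j.
  rewrite -(Cintegral_rotate mOm rOm th (measurable_trunc mu' mf)).
  apply: ae_eq_Cintegral; apply: filterS (hu th) => z H Oz.
  rewrite /trunc (H Oz) /L grid_rotation.
  have -> : (\1_K (rotate th z) : R) = \1_K z.
    rewrite !indicE; congr ((nat_of_bool _)%:R).
    by apply/idP/idP; rewrite !inE => /(rotation_sublevel_rotate f rOm).
  have -> : conjc (f (rotate th z) * expi (- \sum_j (b j)%:R * th j)) =
      conjc (f (rotate th z)) * expi (\sum_j (b j)%:R * th j).
    have -> : expi (\sum_j (b j)%:R * th j) = conjc (expi (- \sum_j (b j)%:R * th j)).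
      by rewrite conjc_expi opprK.
    exact: (rmorphM (@conjc R)).
  by congr (_ * _); rewrite mulrA mulrC mulrA.
pose N : C := ((2 ^+ s) ^+ n)^-1%:C.
have -> : Cintegral Om (trunc u (grid_average f b s)) =
    Cintegral Om (fun z => N * \sum_k trunc u (L k) z).
  apply: eq_Cintegral => z _; rewrite /trunc /grid_average.
  have -> : conjc (N * \sum_k L k z) = N * \sum_k conjc (L k z).
    transitivity (conjc N * conjc (\sum_k L k z)); first exact: (rmorphM (@conjc R)).
    rewrite conjc_real; congr (_ * _); exact: (rmorph_sum (@conjc R)).
  by rewrite -!mulr_sumr; ring.
rewrite CintegralZ//; last exact: cintegrable_sum.
rewrite Cintegral_sum//; under eq_bigr do rewrite EL.
rewrite sumr_const card_ffun !card_ord.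
have nz2 : (2 ^+ s) ^+ n != 0 :> R by rewrite !expf_neq0.
have E2 : (((2 ^ s) ^ n)%N%:R : C) = ((2 ^+ s) ^+ n)%:C.
  by rewrite -(rmorph_nat (real_complex R)) /= !natrX.
have E3 : N * ((2 ^ s) ^ n)%N%:R = 1 by rewrite E2 -rmorphM /= mulVf.
by rewrite -[X in N * X]mulr_natl mulrA E3 mul1r.
Qed.

(** [f] may be replaced by its averages, and these are close to [Q s] times [z^b] wherever no
    coordinate is zero. As [z0] lies in [K], [Q s] is bounded and dominated convergence applies,
    although [Q s] itself is not known to converge. *)
Let asymptotics u (B : R) : measurable_fun Om u -> 0 <= B ->
  (forall z, Om z -> cabs (u z) <= B) -> ae_homogeneous Om (fun j => (b j)%:Z) u ->
  ccvg (fun s => Cintegral Om (trunc u f) -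
    conjc (grid_quotient f b s z0) * Cintegral Om (trunc u (mon b))) 0.
Proof.
move=> mu' B0 uB hu; have [D D0 HD] := mon_bounded.
pose Q s := grid_quotient f b s z0.
have nm : 0 < cabs (mon b z0) by rewrite cabs_gt0 mon_neq0.
pose q := M / cabs (mon b z0).
have q0 : 0 <= q by rewrite divr_ge0// ltW.
have Qq s : cabs (Q s) <= q.
  by rewrite /Q /grid_quotient cabsM cabsV ler_pM2r ?invr_gt0// average_le.
pose g s z := grid_average f b s z - Q s * mon b z.
have mg s : measurable_fun Om (g s).
  apply: (eq_measurable_fun (fun z : 'rV[C]_n => grid_average f b s z + (- Q s) * mon b z)).
    by move=> z _; rewrite mulNr.
  apply: measurable_funD_complex => //; last first.
    exact: (measurable_funM_complex mOm (measurable_cst (- Q s)) measurable_mon).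
  apply: measurable_funM_complex => //.
  have H (r : seq {ffun 'I_n -> 'I_(2 ^ s)}) :
      measurable_fun Om (fun z => \sum_(k <- r) log_fun f b z (angles (grid k))).
    elim: r => [|k r IH].
      by apply: (eq_measurable_fun (fun _ : 'rV[C]_n => 0 : C)) => [z _|]; [rewrite big_nil|exact: measurable_cst].
    apply: (eq_measurable_fun (fun z : 'rV[C]_n => log_fun f b z (angles (grid k)) +
       \sum_(k <- r) log_fun f b z (angles (grid k)))); first by move=> z _; rewrite big_cons.
    exact: measurable_funD_complex.
  exact: H.
have gle s z : Om z -> K z -> cabs (g s z) <= M + q * D.
  move=> Oz Kz; apply: (le_trans (cabsD _ _)); rewrite cabsN cabsM.
  by apply: lerD; [exact: average_le|apply: ler_pM; rewrite ?cabs_ge0// HD].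
have tb s z : Om z -> cabs (trunc u (g s) z) <= B * (M + q * D).
  have G0 : 0 <= M + q * D by rewrite addr_ge0// mulr_ge0.
  by move=> Oz; apply: (trunc_le B0 G0 (uB z Oz)); exact: gle.
have E s : Cintegral Om (trunc u f) - conjc (Q s) * Cintegral Om (trunc u (mon b)) =
    Cintegral Om (trunc u (g s)).
  have im : cintegrable Om (trunc u (mon b)).
    apply: (@cintegrable_bounded _ (B * D)); first exact: (measurable_trunc mu' measurable_mon).
    by move=> z Oz; apply: (trunc_le B0 D0 (uB z Oz)) => _; exact: HD.
  have ig : cintegrable Om (trunc u (g s)).
    by apply: cintegrable_bounded (tb s); exact: measurable_trunc.
  rewrite -(average_integral s mu' B0 uB hu) -CintegralZ//.
  apply/eqP; rewrite subr_eq -CintegralD//; last exact: cintegrableZ.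
  apply/eqP; apply: eq_Cintegral => z _; rewrite /trunc /g.
  have -> : conjc (grid_average f b s z - Q s * mon b z) =
      conjc (grid_average f b s z) - conjc (Q s) * conjc (mon b z).
    transitivity (conjc (grid_average f b s z) - conjc (Q s * mon b z)).
      exact: (rmorphB (@conjc R)).
    by congr (_ - _); exact: (rmorphM (@conjc R)).
  ring.
rewrite /ccvg; under eq_fun do rewrite E.
rewrite -(Cintegral0 mOm).
apply: (@Cintegral_dominated _ _ _ mOm _ _ (fun=> B * (M + q * D))).
- by move=> s; exact: measurable_trunc.
- exact: measurable_cst.
- exact: integrable_cst_domain.
- by move=> s z Oz; exact: tb.
apply: filterS (ae_nonzero_coords R n) => z nz Oz; apply/cvgrPdist_le => e e0.
have [Kz|Kz] := pselect (K z); last first.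
  apply: nearW => s; rewrite sub0r normrN subr0 /trunc indicE memNset//.
  by rewrite mul0r cabs0 normr0 ltW.
have c0 : 0 < B * D + 1 by rewrite ltr_wpDl// mulr_ge0.
have Oz0 : Om z0 by case: Kz0.
have [s0 Hs] := same_limit_all b oOm cOm rOm df Oz Oz0 nz nz0 (divr_gt0 e0 c0).
exists s0 => // s /= /Hs {}Hs.
rewrite sub0r normrN subr0 ger0_norm ?cabs_ge0//.
have gE : g s z = mon b z * (grid_quotient f b s z - Q s).
  by rewrite /g /grid_quotient mulrBr mulrCA divff ?mulr1 ?mon_neq0// [_ * Q s]mulrC.
have ge : cabs (g s z) <= D * (e / (B * D + 1)).
  by rewrite gE cabsM; apply: ler_pM; rewrite ?cabs_ge0// HD.
have ez : 0 <= e / (B * D + 1) by rewrite divr_ge0 ?ltW.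
apply: (le_trans (@trunc_le u (g s) B (D * (e / (B * D + 1))) z B0 _ (uB z Oz) (fun _ => ge))).
  exact: mulr_ge0.
by rewrite !mulrA ler_pdivrMr// mulrC ler_pM2l// lerDl.
Qed.

(* The averages of f are asymptotic to Q_s z^b with Q_s independent of z, so that the
   two inner products with f are in the ratio of those with z^b. Restricting to K
   makes the averages bounded, hence dominated convergence applicable. *)
Lemma truncated_identity u (B : R) : measurable_fun Om u -> 0 <= B ->
  (forall z, Om z -> cabs (u z) <= B) -> ae_homogeneous Om (fun j => (b j)%:Z) u ->
  Cintegral Om (fun z => (\1_K z : R)%:C * (u z * conjc (f z))) *
  Cintegral Om (fun z => (\1_K z : R)%:C * (mon b z * conjc (mon b z))) =
  Cintegral Om (fun z => (\1_K z : R)%:C * (u z * conjc (mon b z))) *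
  Cintegral Om (fun z => (\1_K z : R)%:C * (mon b z * conjc (f z))).
Proof.
move=> mu' B0 uB hu; have [D D0 HD] := mon_bounded.
have A1 := asymptotics mu' B0 uB hu.
have A2 := asymptotics measurable_mon D0 HD (ae_homogeneous_mon Om b).
(* This combination eliminates the quotients. What remains is independent of [s], hence equal to its
   limit 0. *)
have H := ccvgB (ccvgM A1 (ccvg_cst (Cintegral Om (trunc (mon b) (mon b)))))
  (ccvgM A2 (ccvg_cst (Cintegral Om (trunc u (mon b))))).
apply/eqP; rewrite -subr_eq0; apply/eqP; apply: (ccvg_unique (ccvg_cst _)).
move: H; rewrite !mul0r subrr; congr (ccvg _ 0); apply/funext => s; rewrite /trunc; ring.
Qed.

End truncated.
End homogeneous_projection.

Section differentiable_mon.
Variables (R : realType) (n : nat).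
Local Notation C := R[i].
Local Notation mu := (lebesgue_Cn R n).

Lemma differentiable_mon (b : 'I_n -> nat) (z : 'rV[C]_n) : differentiable (mon b) z.
Proof.
have H (r : seq 'I_n) : differentiable (fun z : 'rV[C]_n => \prod_(j <- r) z 0 j ^+ b j) z.
  elim: r => [|j r IH].
    have -> : (fun z : 'rV[C]_n => \prod_(j <- [::]) z 0 j ^+ b j) = cst 1.
      by apply/funext => w; rewrite big_nil.
    exact: differentiable_cst.
  have -> : (fun z : 'rV[C]_n => \prod_(j <- j :: r) z 0 j ^+ b j) =
      (fun z => z 0 j ^+ b j) * (fun z => \prod_(j <- r) z 0 j ^+ b j).
    by apply/funext => w; rewrite big_cons.
  apply: differentiableM; last exact: IH.
  elim: (b j) => [|k IHk].
    have -> : (fun z : 'rV[C]_n => z 0 j ^+ 0) = cst 1 by apply/funext => w; rewrite expr0.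
    exact: differentiable_cst.
  have -> : (fun z : 'rV[C]_n => z 0 j ^+ k.+1) = (fun z => z 0 j) * (fun z => z 0 j ^+ k).
    by apply/funext => w; rewrite exprS.
  by apply: differentiableM => //; exact: differentiable_coord.
exact: H.
Qed.

End differentiable_mon.

Section inner_product.
Variables (R : realType) (n : nat).
Local Notation C := R[i].
Local Notation mu := (lebesgue_Cn R n).
Variable Om : set 'rV[C]_n.
Hypothesis oOm : open Om.
Let mOm : measurable Om := open_measurable_Cn oOm.
Implicit Types (f g v : 'rV[C]_n -> C).

Lemma measurable_cabs_sqr v : measurable_fun Om v -> measurable_fun Om (fun z => cabs (v z) ^+ 2).
Proof.
move=> /(measurable_fun_complexP _ mOm)[mr mi].
apply: (eq_measurable_fun (fun z => complex.Re (v z) ^+ 2 + complex.Im (v z) ^+ 2)).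
  by move=> z _; rewrite cabs_sqr.
by apply: measurable_funD; exact: measurable_funX.
Qed.

Lemma L2_dot_eq0 v : measurable_fun Om v -> L2_dot Om v v = 0 ->
  mu.-integrable Om (EFin \o (fun z => cabs (v z) ^+ 2)) ->
  {ae mu, forall z, Om z -> v z = 0}.
Proof.
move=> mv v0 iv.
have /(congr1 (@complex.Re R)) := v0; rewrite /L2_dot /Cintegral /= => H.
have : \int[mu]_(z in Om) (cabs (v z) ^+ 2) = 0.
  by rewrite -[RHS]H; apply: eq_Rintegral => z _; rewrite mul_conjc_cabs.
rewrite /Rintegral => H0.
have {H0} : (\int[mu]_(z in Om) `|(EFin \o (fun z => cabs (v z) ^+ 2)%R) z| = 0)%E.
  under eq_integral do rewrite /= ger0_norm ?exprn_ge0 ?cabs_ge0//.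
  by rewrite -(fineK (integrable_fin_num mOm iv)) H0.
move=> /(ae_eq_integral_abs mu mOm (measurable_int mu iv)).1.
apply: filterS => z Hz Oz; move: (Hz Oz) => /= [] /eqP.
by rewrite expf_eq0/= cabs_eq0 => /eqP.
Qed.

Lemma ae_eq0_differentiable f : (forall z, Om z -> differentiable f z) ->
  {ae mu, forall z, Om z -> f z = 0} -> forall z, Om z -> f z = 0.
Proof.
move=> df f0 z Oz; apply: contrapT => /eqP; rewrite -cabs_gt0 => fz.
have fz2 : 0 < cabs (f z) / 2 by rewrite divr_gt0.
have [r r0 Hr] := differentiable_polydisc oOm df Oz fz2.
pose U := (polydisc z r)^°.
have Uz : U z by apply/nbhs_polydisc; exists r.
have := @lebesgue_Cn_open_gt0 R n U (open_interior _) (ex_intro _ z Uz).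
suff -> : lebesgue_Cn R n U = 0%E by rewrite ltxx.
apply/negligibleP; first exact: open_measurable_Cn (open_interior _).
apply: negligibleS f0 => w /interior_subset /Hr[Ow fw] /= /(_ Ow) fw0.
by move: fw; rewrite fw0 sub0r cabsN; lra.
Qed.

End inner_product.

Section homogeneous_projection.
Variables (R : realType) (n : nat).
Local Notation C := R[i].
Local Notation mu := (lebesgue_Cn R n).
Variables (Om : set 'rV[C]_n).
Hypotheses (oOm : open Om) (rOm : reinhardt Om) (cOm : connected Om) (neOm : Om !=set0).
Hypotheses (bOm : bounded_set Om).
Let mOm : measurable Om := open_measurable_Cn oOm.

Section truncation_limit.
Variables (f v g : 'rV[C]_n -> C) (M1 : R) (G : 'rV[C]_n -> R).
Hypothesis df : forall z, Om z -> differentiable f z.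
Hypotheses (mv : measurable_fun Om v) (mg : measurable_fun Om g).
Hypotheses (iG : mu.-integrable Om (EFin \o G)).
Hypotheses (vG : forall z, Om z -> cabs (v z * conjc (g z)) <= G z).

(** By [rotations_bounded] the sublevel sets exhaust [Om]. Starting at [M1] lets the caller have a
    given point in all of them. *)
Lemma truncation_limit : ccvg (fun k => Cintegral Om (fun z =>
  (\1_(rotation_sublevel Om f (M1 + k%:R)) z : R)%:C * (v z * conjc (g z)))) (L2_dot Om v g).
Proof.
have mvg : measurable_fun Om (fun z => v z * conjc (g z)).
  by apply: measurable_funM_complex => //; exact: measurable_fun_conjc.
apply: (Cintegral_dominated mOm _ _ iG) => //.
- move=> k; apply: measurable_funM_complex => //.
  apply/measurable_fun_complexP => //; split; last exact: measurable_cst.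
  by apply: measurable_funTS; apply: measurable_indic; exact: measurable_rotation_sublevel.
- move=> k z Oz; rewrite cabsM (le_trans _ (vG Oz))//.
  by rewrite ler_piMl ?cabs_ge0// cabs_real indicE; case: (_ \in _); rewrite ?normr1 ?normr0.
- apply: aeW => z Oz.
  have [M HM] := rotations_bounded rOm df Oz.
  apply: cvg_near_cst; exists (Num.truncn `|M - M1|).+1 => // k /= Hk.
  rewrite indicE mem_set/= ?mul1r ?subrr ?cabs0//; split=> // th.
  apply: (le_trans (HM th)); rewrite -lerBlDl.
  apply: (le_trans (ler_norm _)); apply: ltW; apply: (lt_le_trans (truncnS_gt _)).
  by rewrite ler_nat.
Qed.

End truncation_limit.

Variables (f : 'rV[C]_n -> C) (b : 'I_n -> nat).
Hypothesis df : forall z, Om z -> differentiable f z.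
Hypothesis if2 : mu.-integrable Om (EFin \o (fun z => cabs (f z) ^+ 2)).

(** Against holomorphic functions, [u] acts as its multiple of [z^b]. The identity is
    [truncated_identity] in the limit, with [1 + |f|^2] as the dominating function. *)
Lemma homogeneous_inner u (B : R) : measurable_fun Om u -> 0 <= B ->
  (forall z, Om z -> cabs (u z) <= B) -> ae_homogeneous Om (fun j => (b j)%:Z) u ->
  L2_dot Om u f * L2_dot Om (mon b) (mon b) = L2_dot Om u (mon b) * L2_dot Om (mon b) f.
Proof.
move=> mu' B0 uB hu.
have [D D0 HD] := mon_bounded b bOm.
have [z0 Oz0 nz0] : exists2 z, Om z & nonzero_coords z.
  case: neOm => p Op; have [r r0 rO] := open_polydisc oOm Op.
  have [z pz nz] := nonzero_coords_dense p r0; exists z => //; exact: rO.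
have [M1 HM1] := rotations_bounded rOm df Oz0.
have mf := measurable_differentiable oOm df.
have mm := @measurable_mon _ _ Om b oOm.
have iB c : mu.-integrable Om (EFin \o (fun z => c * (1 + cabs (f z) ^+ 2))).
  have := integrableZl mOm c (integrableD mOm (integrable_cst_domain oOm bOm 1) if2).
  exact: eq_integrable.
have ub v c : 0 <= c -> (forall z, Om z -> cabs (v z) <= c) -> forall z, Om z ->
    cabs (v z * conjc (f z)) <= c * (1 + cabs (f z) ^+ 2).
  move=> c0 vc z Oz; rewrite cabsM cabsJ; apply: ler_pM; rewrite ?cabs_ge0 ?vc//.
  have := sqr_ge0 (cabs (f z) - 1); have := sqr_ge0 (cabs (f z)); rewrite sqrrB1.
  by set x := cabs (f z); move: (cabs_ge0 (f z)); rewrite -/x => *; nra.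
have bb v c : 0 <= c -> (forall z, Om z -> cabs (v z) <= c) -> forall z, Om z ->
    cabs (v z * conjc (mon b z)) <= c * D.
  by move=> c0 vc z Oz; rewrite cabsM cabsJ; apply: ler_pM; rewrite ?cabs_ge0 ?vc ?HD.
have T1 := truncation_limit M1 df mu' mf (iB B) (ub u B B0 uB).
have T2 := truncation_limit M1 df mm mm (integrable_cst_domain oOm bOm _) (bb _ D D0 HD).
have T3 := truncation_limit M1 df mu' mm (integrable_cst_domain oOm bOm _) (bb u B B0 uB).
have T4 := truncation_limit M1 df mm mf (iB D) (ub _ D D0 HD).
apply: (ccvg_unique (ccvgM T1 T2)); move: (ccvgM T3 T4); congr (ccvg _ _).
apply/funext => k; apply/esym; apply: (@truncated_identity _ _ _ _ _ oOm rOm cOm bOm df _ z0 _ nz0 u B) => //.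
by split=> // th; rewrite (le_trans (HM1 th))// lerDl.
Qed.

End homogeneous_projection.

(** * The Bergman space and its projection *)

Section bergman.
Variables (R : realType) (n : nat).
Local Notation C := R[i].
Local Notation mu := (lebesgue_Cn R n).
Variable Om : set 'rV[C]_n.
Hypotheses (oOm : open Om) (bOm : bounded_set Om).
Let mOm : measurable Om := open_measurable_Cn oOm.
Implicit Types (f g h v : 'rV[C]_n -> C).

Definition square_integrable v :=
  measurable_fun Om v /\ mu.-integrable Om (EFin \o (fun z => cabs (v z) ^+ 2)).

Lemma square_integrableB v g : square_integrable v -> square_integrable g ->
  square_integrable (fun z => v z - g z).
Proof.
move=> [mv iv] [mg ig].
have mvg : measurable_fun Om (fun z => v z - g z).
  apply: (eq_measurable_fun (fun z => v z + (-1) * g z)) => [z _|]; first by rewrite mulN1r.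
  by apply: measurable_funD_complex => //; exact: measurable_funM_complex.
split=> //; have i2 := integrableZl mOm 2 (integrableD mOm iv ig).
apply: (le_integrable mOm _ _ i2); first by apply/measurable_EFinP; exact: measurable_cabs_sqr.
move=> z Oz; rewrite /= lee_fin !ger0_norm ?exprn_ge0 ?cabs_ge0//; last first.
  by rewrite mulr_ge0// addr_ge0// exprn_ge0// cabs_ge0.
have := cabsD (v z) (- g z); rewrite cabsN.
have := cabs_ge0 (v z - g z); have := cabs_ge0 (v z); have := cabs_ge0 (g z).
by have := sqr_ge0 (cabs (v z) - cabs (g z)); nra.
Qed.

Lemma cintegrable_dot v g : square_integrable v -> square_integrable g ->
  cintegrable Om (fun z => v z * conjc (g z)).
Proof.
move=> [mv iv] [mg ig]; apply: (cintegrable_dominated mOm _ (integrableD mOm iv ig)).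
  by apply: measurable_funM_complex => //; exact: measurable_fun_conjc.
move=> z Oz; rewrite cabsM cabsJ.
by have := sqr_ge0 (cabs (v z) - cabs (g z)); have := sqr_ge0 (cabs (v z) + cabs (g z)); nra.
Qed.

Lemma square_integrable_bounded v (B : R) : measurable_fun Om v ->
  (forall z, Om z -> cabs (v z) <= B) -> square_integrable v.
Proof.
move=> mv vB; split=> //.
apply: (le_integrable mOm _ _ (integrable_cst_domain oOm bOm (B ^+ 2))).
  by apply/measurable_EFinP; exact: measurable_cabs_sqr.
move=> z Oz; rewrite /= lee_fin !ger0_norm ?sqr_ge0//.
have B0 : 0 <= B := le_trans (cabs_ge0 _) (vB z Oz).
by rewrite lerXn2r ?nnegrE ?cabs_ge0// vB.
Qed.

Lemma bergmanP f : bergman_space Om f <->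
  (forall z, Om z -> differentiable f z) /\ square_integrable f.
Proof.
split=> [[[_ f2] df]|[df [mf if2]]].
  have mf := measurable_differentiable oOm df.
  split=> //; split=> //; apply/integrableP; split.
    by apply/measurable_EFinP; exact: measurable_cabs_sqr.
  apply: le_lt_trans f2; rewrite le_eqVlt; apply/orP; left; apply/eqP.
  by apply: eq_integral => z _; rewrite /= ger0_norm// exprn_ge0// cabs_ge0.
split=> //; split; first by exists f => //; exact: aeW.
have /integrableP[_] := if2; apply: le_lt_trans.
rewrite le_eqVlt; apply/orP; left; apply/eqP.
by apply: eq_integral => z _; rewrite /= ger0_norm// exprn_ge0// cabs_ge0.
Qed.

(** Two candidates differ by a holomorphic function orthogonal to itself, which is zero almost
    everywhere and then everywhere by continuity. A measurable [h0] replaces [h] because a symbol is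
    known only up to a null set. *)
Lemma bergman_projection_eq h h0 g : square_integrable h0 ->
  {ae mu, forall z, Om z -> h z = h0 z} -> bergman_space Om g ->
  (forall f, bergman_space Om f -> L2_dot Om (fun z => h0 z - g z) f = 0) ->
  forall z, Om z -> bergman_projection Om h z = g z.
Proof.
move=> sh0 hh0 bg g0.
have dot f f' : L2_dot Om (fun z => h z - f z) f' = L2_dot Om (fun z => h0 z - f z) f'.
  by apply: ae_eq_Cintegral; apply: filterS hh0 => z H /H ->.
rewrite /bergman_projection; set P := (X in xget _ X).
have : P (xget (cst 0) P).
  by apply: (@xgetI _ _ _ g); split=> // f bf; rewrite dot; exact: g0.
move: (xget (cst 0) P) => g' [bg' g'0].
have [dg sg] := (bergmanP g).1 bg; have [dg' sg'] := (bergmanP g').1 bg'.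
pose d z := g' z - g z.
have sd : square_integrable d by exact: square_integrableB.
have dd z : Om z -> differentiable d z.
  by move=> Oz; apply: differentiableB; [exact: dg'|exact: dg].
have bd : bergman_space Om d by apply/bergmanP.
have d0 : L2_dot Om d d = 0.
  have := g0 d bd; have := g'0 d bd; rewrite dot /L2_dot => H1 H2.
  transitivity (Cintegral Om (fun z => (h0 z - g z) * conjc (d z)) +
                (-1) * Cintegral Om (fun z => (h0 z - g' z) * conjc (d z))); last first.
    by rewrite H1 H2 mulr0 addr0.
  have i1 := cintegrable_dot (square_integrableB sh0 sg) sd.
  have i2 := cintegrable_dot (square_integrableB sh0 sg') sd.
  rewrite -CintegralZ// -CintegralD//; last exact: cintegrableZ.
  by apply: eq_Cintegral => z _; rewrite /d; ring.
have [md id2] := sd.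
move=> z Oz; apply/eqP; rewrite -subr_eq0; apply/eqP.
exact: (ae_eq0_differentiable oOm dd (L2_dot_eq0 oOm md d0 id2)).
Qed.

(** Exponents may repeat in [T]: terms are never collected, and only the leading exponent has to be
    unique. *)
Definition polyf (T : seq (C * {ffun 'I_n -> nat})) (z : 'rV[C]_n) : C :=
  \sum_(t <- T) t.1 * mon t.2 z.

Lemma polyf_bounded T : exists2 B : R, 0 <= B & forall z, Om z -> cabs (polyf T z) <= B.
Proof.
elim: T => [|t T [B B0 HB]]; first by exists 0 => // z _; rewrite /polyf big_nil cabs0.
have [D D0 HD] := mon_bounded t.2 bOm.
exists (cabs t.1 * D + B); first by rewrite addr_ge0// mulr_ge0// cabs_ge0.
move=> z Oz; rewrite /polyf big_cons (le_trans (cabsD _ _))// cabsM.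
by apply: lerD; [rewrite ler_wpM2l ?cabs_ge0// HD|exact: HB].
Qed.

Lemma differentiable_polyf T z : differentiable (polyf T) z.
Proof.
elim: T => [|t T IH].
  have -> : polyf [::] = cst 0 by apply/funext => w; rewrite /polyf big_nil.
  exact: differentiable_cst.
have -> : polyf (t :: T) = (fun w => t.1 * mon t.2 w) + polyf T.
  by apply/funext => w; rewrite /polyf big_cons.
apply: differentiableD => //.
have -> : (fun w : 'rV[C]_n => t.1 * mon t.2 w) = cst t.1 * mon t.2 by [].
by apply: differentiableM; [exact: differentiable_cst|exact: differentiable_mon].
Qed.

Lemma bergman_polyf T : bergman_space Om (polyf T).
Proof.
have [B _ HB] := polyf_bounded T.
apply/bergmanP; split=> [z _|]; first exact: differentiable_polyf.
apply: square_integrable_bounded HB.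
by apply: measurable_differentiable => // z _; exact: differentiable_polyf.
Qed.

Lemma L2_dot_mon_neq0 b : Om !=set0 -> L2_dot Om (mon b) (mon b) != 0.
Proof.
move=> [p Op]; apply/eqP => b0.
have [B _ HB] := mon_bounded b bOm.
have mm := @measurable_mon _ _ _ b oOm.
have [_ i2] := square_integrable_bounded mm HB.
have [r r0 rO] := open_polydisc oOm Op.
have [z pz nz] := nonzero_coords_dense p r0; have Oz : Om z by exact: rO.
have dm z' : Om z' -> differentiable (mon b) z' by move=> _; exact: differentiable_mon.
have /eqP := ae_eq0_differentiable oOm dm (L2_dot_eq0 oOm mm b0 i2) Oz.
by rewrite (negbTE (mon_neq0 b nz)).
Qed.

End bergman.

(** * Toeplitz operators on polynomials *)

Section toeplitz_polynomial.
Variables (R : realType) (n : nat).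
Local Notation C := R[i].
Local Notation mu := (lebesgue_Cn R n).
Variable Om : set 'rV[C]_n.

(** A Borel representative of a homogeneous component: bounded everywhere on [Om], homogeneous only
    almost everywhere. *)
Record hom_fun := HomFun {
  degree : 'I_n -> int;
  hom_val :> 'rV[C]_n -> C;
  hom_measurable : measurable_fun Om hom_val;
  hom_bounded : exists2 B : R, 0 <= B & forall z, Om z -> cabs (hom_val z) <= B;
  hom_homogeneous : ae_homogeneous Om degree hom_val }.

(** The absolute value is a default for negative sums; [shiftable] below guards against them. *)
Definition shift (e : {ffun 'I_n -> nat}) (k : 'I_n -> int) : {ffun 'I_n -> nat} :=
  [ffun j => absz ((e j)%:Z + k j)].

Definition shift_coef (p : hom_fun) (e : {ffun 'I_n -> nat}) : C :=
  L2_dot Om (fun z => p z * mon e z) (mon (shift e (degree p))) /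
  L2_dot Om (mon (shift e (degree p))) (mon (shift e (degree p))).

Definition shift_poly (s : seq hom_fun) (T : seq (C * {ffun 'I_n -> nat})) :=
  [seq (t.1 * shift_coef p t.2, shift t.2 (degree p)) | p <- s, t <- T].

Definition shiftable (e : {ffun 'I_n -> nat}) (k : 'I_n -> int) :=
  [forall j, 0 <= (e j)%:Z + k j].

Hypotheses (oOm : open Om) (rOm : reinhardt Om) (cOm : connected Om) (neOm : Om !=set0).
Hypotheses (bOm : bounded_set Om).
Let mOm : measurable Om := open_measurable_Cn oOm.
Implicit Types (p : hom_fun) (e : {ffun 'I_n -> nat}) (f : 'rV[C]_n -> C).

Let square_integrable_mul p e : square_integrable Om (fun z => p z * mon e z).
Proof.
have [B B0 HB] := hom_bounded p; have [D D0 HD] := mon_bounded e bOm.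
apply: (square_integrable_bounded oOm bOm (B := B * D)).
  by apply: measurable_funM_complex => //; [exact: hom_measurable|exact: measurable_mon].
by move=> z Oz; rewrite cabsM ler_pM ?cabs_ge0 ?HB ?HD.
Qed.

Let square_integrable_mon e : square_integrable Om (mon e).
Proof.
have [D D0 HD] := mon_bounded e bOm.
by apply: (square_integrable_bounded oOm bOm (B := D)) => //; exact: measurable_mon.
Qed.

Let square_integrable_shift p e : square_integrable Om
  (fun z => p z * mon e z - shift_coef p e * mon (shift e (degree p)) z).
Proof.
apply: square_integrableB => //.
have [D D0 HD] := mon_bounded (shift e (degree p)) bOm.
apply: (square_integrable_bounded oOm bOm (B := cabs (shift_coef p e) * D)).
  by apply: measurable_funM_complex => //; exact: measurable_mon.
by move=> z Oz; rewrite cabsM ler_wpM2l ?cabs_ge0 ?HD.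
Qed.

(** [p z^e] is homogeneous of degree [e + degree p], so [homogeneous_inner] applies, and dividing by
    the squared norm of the monomial makes the projection explicit. *)
Lemma hom_projection p e f : shiftable e (degree p) -> bergman_space Om f ->
  L2_dot Om (fun z => p z * mon e z - shift_coef p e * mon (shift e (degree p)) z) f = 0.
Proof.
move=> /forallP ek bf; have [df sf] := (bergmanP oOm f).1 bf.
set e' := shift e _; pose u z := p z * mon e z.
have hu : ae_homogeneous Om (fun j => (e' j)%:Z) u.
  have := ae_homogeneousM (hom_homogeneous p) (ae_homogeneous_mon Om e).
  congr (ae_homogeneous _ _ _); apply/funext => j.
  by rewrite ffunE gez0_abs ?ek// addrC.
have [B B0 HB] := hom_bounded p; have [D D0 HD] := mon_bounded e bOm.
have uB z : Om z -> cabs (u z) <= B * D.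
  by move=> Oz; rewrite cabsM ler_pM ?cabs_ge0 ?HB ?HD.
have [mu' _] := square_integrable_mul p e.
have H := homogeneous_inner oOm rOm cOm neOm bOm df sf.2 mu' (mulr_ge0 B0 D0) uB hu.
have N0 := L2_dot_mon_neq0 oOm bOm e' neOm.
have iu := cintegrable_dot oOm (square_integrable_mul p e) sf.
have im := cintegrable_dot oOm (square_integrable_mon e') sf.
transitivity (L2_dot Om u f + (- shift_coef p e) * L2_dot Om (mon e') f).
  rewrite /L2_dot -CintegralZ// -CintegralD//; last exact: cintegrableZ.
  by apply: eq_Cintegral => z _; rewrite /u; ring.
by apply: (mulIf N0); rewrite mul0r mulrDl H /shift_coef -/e' -/u mulNr mulrAC mulNr divfK// subrr.
Qed.

Lemma sum_all0 (A : Type) (P : pred A) (s : seq A) (F : A -> C) : all P s ->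
  (forall x, P x -> F x = 0) -> \sum_(x <- s) F x = 0.
Proof.
move=> + F0; elim: s => [|x s IH /= /andP[Px Ps]]; first by rewrite big_nil.
by rewrite big_cons F0// IH// addr0.
Qed.

Lemma toeplitz_polyf (phi g : 'rV[C]_n -> C) (s : seq hom_fun) T :
  {ae mu, forall z, Om z -> phi z = \sum_(p <- s) p z} ->
  (forall z, Om z -> g z = polyf T z) ->
  all (fun p => all (fun t => shiftable t.2 (degree p)) T) s ->
  forall z, Om z -> toeplitz Om phi g z = polyf (shift_poly s T) z.
Proof.
move=> phis gT sT.
have [D D0 HD] := polyf_bounded bOm T.
have [B B0 HB] : exists2 B : R, 0 <= B & forall z, Om z -> cabs (\sum_(p <- s) p z) <= B.
  elim: (s) => [|p s' [B B0 HB]]; first by exists 0 => // z _; rewrite big_nil cabs0.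
  have [B' B'0 HB'] := hom_bounded p; exists (B' + B); first exact: addr_ge0.
  by move=> z Oz; rewrite big_cons (le_trans (cabsD _ _))// lerD ?HB ?HB'.
have ms : measurable_fun Om (fun z => \sum_(p <- s) p z).
  elim: (s) => [|p s' IH].
    by apply: (eq_measurable_fun (fun _ : 'rV[C]_n => 0 : C)) => [z _|]; rewrite ?big_nil.
  apply: (eq_measurable_fun (fun z => p z + \sum_(p <- s') p z)) => [z _|].
    by rewrite big_cons.
  by apply: measurable_funD_complex => //; exact: hom_measurable.
have mT : measurable_fun Om (polyf T).
  by apply: measurable_differentiable => // z _; exact: differentiable_polyf.
apply: (@bergman_projection_eq _ _ _ oOm _ (fun z => (\sum_(p <- s) p z) * polyf T z)).
- apply: (square_integrable_bounded oOm bOm (B := B * D)).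
    exact: measurable_funM_complex.
  by move=> z Oz; rewrite cabsM ler_pM ?cabs_ge0 ?HB ?HD.
- by apply: filterS phis => z H Oz; rewrite H// gT.
- exact: bergman_polyf.
move=> f bf; have [df sf] := (bergmanP oOm f).1 bf.
pose F p (t : C * {ffun 'I_n -> nat}) z :=
  t.1 * ((p z * mon t.2 z - shift_coef p t.2 * mon (shift t.2 (degree p)) z) * conjc (f z)).
have iF p t : cintegrable Om (F p t).
  by apply: cintegrableZ => //; exact: cintegrable_dot.
transitivity (Cintegral Om (fun z => \sum_(p <- s) \sum_(t <- T) F p t z)).
  apply: eq_Cintegral => z _; rewrite /polyf /shift_poly big_allpairs_dep /=.
  rewrite mulr_suml -sumrB mulr_suml; apply: eq_bigr => p _.
  rewrite mulr_sumr -sumrB mulr_suml; apply: eq_bigr => t _.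
  by rewrite /F; ring.
rewrite Cintegral_sum//; last by move=> p; exact: cintegrable_sum.
apply: (sum_all0 sT) => p pT; rewrite Cintegral_sum//.
apply: (sum_all0 pT) => t tp; rewrite CintegralZ//; last exact: cintegrable_dot.
by rewrite [X in _ * X](hom_projection tp bf) mulr0.
Qed.

Lemma mon_orthogonal e e' : e != e' -> L2_dot Om (mon e) (mon e') = 0.
Proof.
move=> ee'; have [j ej] : exists j, e j != e' j.
  by apply/existsP; apply: contraNT ee' => /existsPn H; apply/eqP/ffunP => j; apply/eqP/negPn/H.
have h := ae_homogeneousM (ae_homogeneous_mon Om e) (ae_homogeneous_conjc (ae_homogeneous_mon Om e')).
apply: (Cintegral_homogeneous0 mOm rOm (j := j) h).
  by rewrite subr_eq0 eqz_nat.
exact: cintegrable_dot.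
Qed.

Lemma polyf_coef c e T : (forall t, t \in T -> t.2 != e) ->
  (forall z, Om z -> polyf ((c, e) :: T) z = 0) -> c = 0.
Proof.
move=> Te g0; have N0 := L2_dot_mon_neq0 oOm bOm e neOm.
have : L2_dot Om (polyf ((c, e) :: T)) (mon e) = 0.
  rewrite -[RHS](Cintegral0 mOm); apply: eq_Cintegral => z Oz; by rewrite g0// mul0r.
have -> : L2_dot Om (polyf ((c, e) :: T)) (mon e) =
    \sum_(t <- (c, e) :: T) t.1 * L2_dot Om (mon t.2) (mon e).
  transitivity (Cintegral Om (fun z => \sum_(t <- (c, e) :: T) t.1 * (mon t.2 z * conjc (mon e z)))).
    by apply: eq_Cintegral => z _; rewrite mulr_suml; apply: eq_bigr => t _; rewrite mulrA.
  rewrite Cintegral_sum//; last by move=> t; apply: cintegrableZ => //; exact: cintegrable_dot.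
  by apply: eq_bigr => t _; rewrite CintegralZ//; exact: cintegrable_dot.
rewrite big_cons big1_seq ?addr0/=; last first.
  by move=> t tT; rewrite mon_orthogonal ?mulr0 ?Te.
by move=> /eqP; rewrite mulf_eq0 (negbTE N0) orbF => /eqP.
Qed.

End toeplitz_polynomial.

(** * Vanishing moments *)

Section vanishing_moments.
Variables (R : realType) (n : nat).
Local Notation C := R[i].
Local Notation mu := (lebesgue_Cn R n).
Variable Om : set 'rV[C]_n.
Hypotheses (oOm : open Om) (rOm : reinhardt Om) (bOm : bounded_set Om).
Let mOm : measurable Om := open_measurable_Cn oOm.
Local Notation bmeas := (bounded_measurable_on Om).
Implicit Types (V P w : 'rV[C]_n -> R) (a b : 'I_n -> nat).

Definition real_coord (c : bool * 'I_n) (z : 'rV[C]_n) : R :=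
  if c.1 then complex.Re (z 0 c.2) else complex.Im (z 0 c.2).

Lemma measurable_real_coord c : measurable_fun setT (real_coord c).
Proof.
rewrite /real_coord; case: c => [[] j] /=.
  exact: (measurableT_comp (@measurable_Re R) (measurable_entry 0 j)).
exact: (measurableT_comp (@measurable_Im R) (measurable_entry 0 j)).
Qed.

(** Built one real coordinate at a time, so that indicators of cylinders can be reached by
    multiplying by one indicator after the other. *)
Inductive cylinder : set 'rV[C]_n -> Prop :=
| cylinder_setT : cylinder setT
| cylinder_setI c A B : measurable A -> cylinder B ->
    cylinder (real_coord c @^-1` A `&` B).

Lemma measurable_real_coord_preimage c A : measurable A -> measurable (real_coord c @^-1` A).
Proof. by move=> mA; rewrite -[X in measurable X]setTI; exact: measurable_real_coord. Qed.

Lemma measurable_cylinder B : cylinder B -> measurable B.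
Proof.
elim=> [|c A {}B mA _ mB]; first exact: measurableT.
by apply: measurableI => //; exact: measurable_real_coord_preimage.
Qed.

Lemma cylinderI : setI_closed cylinder.
Proof.
move=> A B; elim=> [|c A' A'' mA' _ IH] cB; first by rewrite setTI.
by rewrite -setIA; apply: cylinder_setI => //; exact: IH.
Qed.

Lemma measurable_cylinderE : @measurable _ 'rV[C]_n = <<s cylinder >>.
Proof.
apply/seteqP; split => [A mA|]; last first.
  by apply: smallest_sub; [exact: sigma_algebra_measurable|exact: measurable_cylinder].
have mid : measurable_fun setT (id : g_sigma_algebraType cylinder -> 'rV[C]_n).
  apply: measurable_fun_matrix => i j; rewrite ord1.
  have part c : measurable_fun setT (real_coord c : g_sigma_algebraType cylinder -> R).
    move=> _ B mB; rewrite setTI; apply: sub_sigma_algebra.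
    by rewrite -[_ @^-1` _]setIT; apply: cylinder_setI => //; exact: cylinder_setT.
  apply/measurable_fun_complexP => //; split.
    exact: (part (true, j)).
  exact: (part (false, j)).
by have := mid measurableT A mA; rewrite setTI.
Qed.

(** Multiplying a mixed monomial by a real coordinate thus gives a combination of two mixed
    monomials. *)
Lemma real_coord_linear c : exists l l' : C, forall z : 'rV[C]_n,
  (real_coord c z)%:C = l * z 0 c.2 + l' * conjc (z 0 c.2).
Proof.
case: c => [[] j]; rewrite /real_coord /=.
  exists (2^-1 : R)%:C, (2^-1 : R)%:C => z; case: (z 0 j) => x y.
  by apply/eqP; rewrite eq_complex /=; apply/andP; split; apply/eqP; field.
exists (0 -i* 2^-1), (0 +i* 2^-1) => z; case: (z 0 j) => x y.
by apply/eqP; rewrite eq_complex /=; apply/andP; split; apply/eqP; field.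
Qed.

Let mixed a b z : C := mon a z * conjc (mon b z).

Let incr a (j : 'I_n) : 'I_n -> nat := fun i => (a i + (i == j))%N.

Let mon_incr a j (z : 'rV[C]_n) : mon (incr a j) z = z 0 j * mon a z.
Proof.
rewrite /mon (bigD1 j)//= [in RHS](bigD1 j)//= mulrA -exprS /incr eqxx addn1.
by congr (_ * _); apply: eq_bigr => i /negbTE ->; rewrite addn0.
Qed.

Let measurable_mixed a b : measurable_fun Om (mixed a b).
Proof.
apply: measurable_funM_complex => //; first exact: measurable_mon.
by apply: measurable_fun_conjc => //; exact: measurable_mon.
Qed.

Let mixed_bounded a b : exists2 B : R, 0 <= B & forall z, Om z -> cabs (mixed a b z) <= B.
Proof.
have [A A0 HA] := mon_bounded a bOm; have [B B0 HB] := mon_bounded b bOm.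
exists (A * B); first exact: mulr_ge0.
by move=> z Oz; rewrite cabsM cabsJ ler_pM ?cabs_ge0 ?HA ?HB.
Qed.

Let cintegrable_mixed P a b : bmeas P -> cintegrable Om (fun z => (P z)%:C * mixed a b z).
Proof.
move=> [mP [M HM]]; have [B B0 HB] := mixed_bounded a b.
apply: (cintegrable_bounded oOm bOm (c := M * B)).
  apply: measurable_funM_complex => //.
  by apply/measurable_fun_complexP => //; split => //=; exact: measurable_cst.
move=> z Oz; rewrite cabsM cabs_real ler_pM ?cabs_ge0 ?HB ?HM//.
Qed.

Let bmeas_real_coord c : bmeas (real_coord c).
Proof.
have [M M0 HM] := bounded_set_cabs bOm; split.
  by apply: measurable_funTS; exact: measurable_real_coord.
exists M => z Oz; rewrite /real_coord; case: c.1.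
  exact: le_trans (Re_le_cabs _) (HM z Oz _).
exact: le_trans (Im_le_cabs _) (HM z Oz _).
Qed.

Let bmeas_part (p : C -> R) a b : (forall c, `|p c| <= cabs c) ->
  (forall h, measurable_fun Om h -> measurable_fun Om (fun z => p (h z))) ->
  bmeas (fun z => p (mixed a b z)).
Proof.
move=> pc mp; have [B B0 HB] := mixed_bounded a b.
split; first by apply: mp; exact: measurable_mixed.
by exists B => z Oz; rewrite (le_trans (pc _))// HB.
Qed.

Let bmeas_Re a b : bmeas (fun z => complex.Re (mixed a b z)).
Proof.
apply: bmeas_part; first exact: Re_le_cabs.
by move=> h /(measurable_fun_complexP _ mOm)[].
Qed.

Let bmeas_Im a b : bmeas (fun z => complex.Im (mixed a b z)).
Proof.
apply: bmeas_part; first exact: Im_le_cabs.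
by move=> h /(measurable_fun_complexP _ mOm)[].
Qed.

Let integrable_bmeas_domain P : bmeas P -> mu.-integrable Om (EFin \o P).
Proof.
move=> bP; have := integrable_bmeas mOm (integrable_cst_domain oOm bOm 1) bP.
by apply: eq_integrable => // z _; rewrite /= mul1r.
Qed.

Section annihilator.
Variable V : 'rV[C]_n -> R.
Hypothesis bV : bmeas V.

(** The multipliers [P] for which [V P] has no mixed moment. Quantifying over all [a] and [b] is
    what makes the class stable under multiplication by coordinates. *)
Let annih P := bmeas P /\
  forall a b, Cintegral Om (fun z => (V z * P z)%:C * mixed a b z) = 0.

Let annih_real_coord c P : annih P -> annih (fun z => P z * real_coord c z).
Proof.
move=> [bP P0]; split; first exact: bmeasM.
move=> a b; have [l [l' ll']] := real_coord_linear c.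
have bVP : bmeas (fun z => V z * P z) by exact: bmeasM.
transitivity (Cintegral Om (fun z => l * ((V z * P z)%:C * mixed (incr a c.2) b z) +
                                    l' * ((V z * P z)%:C * mixed a (incr b c.2) z))).
  apply: eq_Cintegral => z _; rewrite /mixed !mon_incr.
  have -> : (V z * (P z * real_coord c z))%:C =
      (V z * P z)%:C * (l * z 0 c.2 + l' * conjc (z 0 c.2)) by rewrite -ll' -rmorphM /= mulrA.
  have -> : conjc (z 0 c.2 * mon b z) = conjc (z 0 c.2) * conjc (mon b z).
    exact: (rmorphM (@conjc R)).
  by ring.
rewrite CintegralD//; try by apply: cintegrableZ => //; exact: cintegrable_mixed.
by rewrite !CintegralZ//; try exact: cintegrable_mixed; rewrite !P0 !mulr0 addr0.
Qed.

Let annih_exp c P k : annih P -> annih (fun z => P z * real_coord c z ^+ k).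
Proof.
move=> aP; elim: k => [|k IH].
  by rewrite (_ : (fun z => _) = P)//; apply/funext => z; rewrite expr0 mulr1.
have := annih_real_coord c IH; congr annih; apply/funext => z.
by rewrite exprSr mulrA.
Qed.

Let Re_mul (r : R) (c : C) : complex.Re (r%:C * c) = r * complex.Re c.
Proof. by case: c => x y /=; rewrite mul0r subr0. Qed.

Let Im_mul (r : R) (c : C) : complex.Im (r%:C * c) = r * complex.Im c.
Proof. by case: c => x y /=; rewrite mul0r addr0. Qed.

(** Stability under powers of one coordinate becomes stability under its indicators by
    [moments_determine], applied to the real and imaginary parts. *)
Let annih_indic c P A : measurable A -> annih P ->
  annih (fun z => P z * \1_A (real_coord c z)).
Proof.
move=> mA [bP P0]; split.
  apply: bmeasM => //; split.
    by apply: (measurableT_comp (measurable_indic mA)); case: (bmeas_real_coord c).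
  by exists 1 => z _; rewrite indicE; case: (_ \in _); rewrite ?normr1 ?normr0.
move=> a b; rewrite /Cintegral; apply/eqP; rewrite eq_complex /=; apply/andP; split; apply/eqP.
- transitivity (\int[mu]_(z in Om) ((V z * P z * complex.Re (mixed a b z)) * \1_A (real_coord c z))).
    by apply: eq_Rintegral => z _; rewrite Re_mul; ring.
  apply: (moments_determine mOm) => //.
    by apply: integrable_bmeas_domain; apply: bmeasM => //; exact: bmeasM.
  move=> k; have [_ /(_ a b)] := annih_exp c k (conj bP P0).
  move=> /(congr1 (@complex.Re R)) /= H; rewrite -[RHS]H.
  by apply: eq_Rintegral => z _; rewrite Re_mul; ring.
- transitivity (\int[mu]_(z in Om) ((V z * P z * complex.Im (mixed a b z)) * \1_A (real_coord c z))).
    by apply: eq_Rintegral => z _; rewrite Im_mul; ring.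
  apply: (moments_determine mOm) => //.
    by apply: integrable_bmeas_domain; apply: bmeasM => //; exact: bmeasM.
  move=> k; have [_ /(_ a b)] := annih_exp c k (conj bP P0).
  move=> /(congr1 (@complex.Im R)) /= H; rewrite -[RHS]H.
  by apply: eq_Rintegral => z _; rewrite Im_mul; ring.
Qed.

Lemma mixed_moments_eq0 :
  (forall a b, Cintegral Om (fun z => (V z)%:C * (mon a z * conjc (mon b z))) = 0) ->
  {ae mu, forall z, Om z -> V z = 0}.
Proof.
move=> V0.
have annih1 : annih (fun=> 1).
  by split; [exact: bmeas_cst|move=> a b; under eq_Cintegral do rewrite mulr1; exact: V0].
have cyl B : cylinder B -> annih \1_B.
  elim=> [|c A {}B mA _ IH].
    by move: annih1; congr annih; apply/funext => z; rewrite indicE in_setT.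
  have := annih_indic c mA IH; congr annih; apply/funext => z.
  have tA : (z \in real_coord c @^-1` A) = (real_coord c z \in A) by apply/idP/idP; rewrite !inE.
  by rewrite !indicE in_setI tA -natrM mulnb andbC.
have iV : mu.-integrable Om (EFin \o V) by exact: integrable_bmeas_domain.
pose P A := (\int[mu]_(z in Om `&` A) (V z)%:E = 0)%E.
have PE A : measurable A -> \int[mu]_(z in Om) (V z * \1_A z) = 0 <-> P A.
  move=> mA.
  have -> : \int[mu]_(z in Om) (V z * \1_A z) = \int[mu]_(z in Om `&` A) V z.
    rewrite [RHS]Rintegral_mkcondr; apply: eq_Rintegral => z _.
    by rewrite patchE indicE; case: ifP; rewrite ?mulr1 ?mulr0.
  rewrite /P /Rintegral; split => [|->//].
  have iA : mu.-integrable (Om `&` A) (EFin \o V).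
    by apply: (integrableS _ _ _ iV) => //; exact: measurableI.
  have := integrable_fin_num (measurableI _ _ mOm mA) iA.
  by move=> /fineK {2}<- ->.
have cyl0 B : cylinder B -> P B.
  move=> cB; apply/PE; first exact: measurable_cylinder.
  have [_ /(_ (fun=> 0%N) (fun=> 0%N))] := cyl _ cB.
  move=> /(congr1 (@complex.Re R)) /= H; rewrite -[RHS]H.
  apply: eq_Rintegral => z _; rewrite Re_mul /mixed.
  have -> : mon (fun=> 0%N) z = 1 by rewrite /mon big1.
  by rewrite mul1r /= mulr1.
have all0 A : measurable A -> P A.
  move=> mA; have sA : <<s cylinder >> A by rewrite -measurable_cylinderE.
  apply: (@dynkin_induction _ _ cylinder P) sA => //.
  - exact: measurable_cylinderE.
  - exact: cylinderI.
  - by apply: cyl0; exact: cylinder_setT.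
  - move=> S mS PS; apply/PE; first exact: measurableC.
    have : \int[mu]_(z in Om) (V z * \1_setT z - V z * \1_S z) = 0.
      have bS (S' : set 'rV[C]_n) : measurable S' -> bmeas (\1_S' : 'rV[C]_n -> R).
        move=> mS'; split; first by apply: measurable_funTS; exact: measurable_indic.
        by exists 1 => z _; rewrite indicE; case: (_ \in _); rewrite ?normr1 ?normr0.
      rewrite RintegralB//; try by apply: integrable_bmeas => //; exact: bS.
      rewrite (PE _ mS).2// (PE _ measurableT).2 ?subr0//.
      by apply: cyl0; exact: cylinder_setT.
    apply: etrans; apply: eq_Rintegral => z _; rewrite !indicE in_setC in_setT.
    by case: (_ \in _); rewrite /= ?mulr1 ?mulr0 ?subr0 ?subrr.
  - move=> F mF tF PF; rewrite /P setI_bigcupr integral_bigcup//.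
    + by rewrite eseries0// => i _ _; exact: PF.
    + apply/trivIsetP => i j _ _ ij; rewrite -subset0 => x [[_ xi] [_ xj]].
      by have /trivIsetP/(_ i j I I ij) := tF; rewrite -subset0; apply; split; [exact: xi|].
    + by move=> k; exact: measurableI.
    + rewrite -setI_bigcupr; apply: (integrableS _ _ _ iV) => //.
      by apply: measurableI => //; exact: bigcup_measurable.
have := @integral_ae_eq _ _ _ mu Om mOm (cst 0%E) (EFin \o V) iV (measurable_cst _).
case.
  move=> E EO mE; rewrite integral0; have := all0 E mE.
  by rewrite /P setIC setIidl.
move=> N [mN N0 HN]; exists N; split => // z /= H; apply: HN => /= H'; apply: H => Oz.
by have [] := H' Oz.
Qed.

End annihilator.

Lemma radial_moments_eq0 w : bmeas w -> ae_homogeneous Om (fun=> 0) (fun z => (w z)%:C) ->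
  (forall g : nat -> nat,
    \int[mu]_(z in Om) (w z * \prod_(j < n) (cabs (z 0 j) ^+ 2) ^+ (g j).+1) = 0) ->
  {ae mu, forall z, Om z -> w z = 0}.
Proof.
move=> bw hw w0.
(* The hypothesis covers only exponents [(g j).+1]; the extra factor supplies the missing unit and
   vanishes only on coordinate hyperplanes. *)
pose V z := w z * \prod_(j < n) cabs (z 0 j) ^+ 2.
have VE z : (V z)%:C = (w z)%:C * (mon (fun=> 1%N) z * conjc (mon (fun=> 1%N) z)).
  rewrite mul_conjc_cabs -rmorphM /= /V /mon cabs_prod -prodrXl.
  by congr ((_ * _)%:C); apply: eq_bigr => j _; rewrite expr1.
have bV : bmeas V.
  have := bmeasM bw (bmeas_Re (fun=> 1%N) (fun=> 1%N)).
  apply: eq_bmeas => z; rewrite /mixed mul_conjc_cabs /= /V /mon cabs_prod -prodrXl.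
  by congr (_ * _); apply: eq_bigr => j _; rewrite expr1.
have hV : ae_homogeneous Om (fun=> 0) (fun z => (V z)%:C).
  have h1 := ae_homogeneousM (ae_homogeneous_mon Om (fun=> 1%N))
    (ae_homogeneous_conjc (ae_homogeneous_mon Om (fun=> 1%N))).
  have := ae_homogeneousM hw h1; congr (ae_homogeneous _ _ _).
  by apply/funext => z; rewrite VE.
have V0 : {ae mu, forall z, Om z -> V z = 0}.
  apply: mixed_moments_eq0 => // a b.
  have [ab|/existsNP[j /eqP ab]] := pselect (forall j, a j = b j).
    have {ab} -> : b = a by apply/funext => j; rewrite ab.
    (* [a] extended by 0 to all integers, the form in which the hypothesis takes exponents. *)
    pose g k := oapp a 0%N (insub k).
    have gE (j : 'I_n) : g j = a j by rewrite /g valK.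
    have E z : (V z)%:C * (mon a z * conjc (mon a z)) =
        (w z * \prod_(j < n) (cabs (z 0 j) ^+ 2) ^+ (g j).+1)%:C.
      rewrite mul_conjc_cabs -rmorphM /= /V -mulrA; congr ((_ * _)%:C).
      rewrite /mon cabs_prod -prodrXl -big_split /=; apply: eq_bigr => j _.
      by rewrite gE [RHS]exprS; congr (_ * _); rewrite cabsX -!exprM mulnC.
    rewrite /Cintegral; apply/eqP; rewrite eq_complex /=; apply/andP; split; apply/eqP.
      by rewrite -[RHS](w0 g); apply: eq_Rintegral => z _; rewrite E.
    by under eq_Rintegral do rewrite E /=; rewrite Rintegral_cst// mul0r.
  have h := ae_homogeneousM hV (ae_homogeneousM (ae_homogeneous_mon Om a)
    (ae_homogeneous_conjc (ae_homogeneous_mon Om b))).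
  apply: (Cintegral_homogeneous0 mOm rOm (j := j) h).
    by rewrite add0r subr_eq0 eqz_nat.
  exact: cintegrable_mixed.
apply: filterS2 V0 (ae_nonzero_coords R n) => z Vz nz Oz.
have /eqP := Vz Oz; rewrite /V mulf_eq0 => /orP[/eqP//|].
rewrite prodf_seq_eq0 => /hasP[j _]; rewrite /= expf_eq0/= cabs_eq0.
by rewrite (negbTE (nz j)).
Qed.

End vanishing_moments.

(** * Leading terms *)

Section lexicographic.
Variable n : nat.
Implicit Types (k : 'I_n -> int) (e : {ffun 'I_n -> nat}).

(** A strict total order compatible with addition, so the leading terms of a symbol and of a
    polynomial give the leading term of the result, without cancellation. *)
Definition lex k k' :=
  [exists i : 'I_n, [forall j : 'I_n, (j < i)%N ==> (k j == k' j)] && (k i < k' i)].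

Definition eqdeg k k' := [forall j, k j == k' j].

Lemma eqdegP k k' : reflect (k = k') (eqdeg k k').
Proof.
by apply: (iffP forallP) => [H|-> //]; apply/funext => j; exact/eqP.
Qed.

Lemma lexP k k' : reflect
  (exists i : 'I_n, (forall j : 'I_n, (j < i)%N -> k j = k' j) /\ k i < k' i) (lex k k').
Proof.
apply: (iffP existsP) => [[i /andP[/forallP H1 H2]]|[i [H1 H2]]]; exists i.
  by split=> // j ji; apply/eqP; exact: (implyP (H1 j)).
by rewrite H2 andbT; apply/forallP => j; apply/implyP => ji; rewrite H1.
Qed.

Lemma lex_irr k : lex k k = false.
Proof. by apply/negbTE/negP => /lexP[i [_]]; rewrite ltxx. Qed.

Lemma lex_trans k2 k1 k3 : lex k1 k2 -> lex k2 k3 -> lex k1 k3.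
Proof.
move=> /lexP[i [i1 i2]] /lexP[j [j1 j2]]; apply/lexP.
have [ij|ji|/val_inj ij] := ltngtP (val i) (val j).
- exists i; split; last by rewrite -j1.
  by move=> l li; rewrite i1// j1//; exact: ltn_trans ij.
- exists j; split; last by rewrite i1.
  by move=> l lj; rewrite i1 ?j1//; exact: ltn_trans ji.
- subst j; exists i; split; last exact: lt_trans j2.
  by move=> l li; rewrite i1 ?j1.
Qed.

Lemma lex_total k k' : [|| eqdeg k k', lex k k' | lex k' k].
Proof.
have [//|] := boolP (eqdeg k k') => /forallPn[i0 ki0] /=.
have [i ki imin] := @arg_minnP _ i0 (fun i => k i != k' i) (@nat_of_ord n) ki0.
have eqj (j : 'I_n) : (j < i)%N -> k j = k' j.
  by move=> ji; apply/eqP; apply: contraTT ji => kj; rewrite -leqNgt imin.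
have [lt|gt|/eqP] := ltgtP (k i) (k' i); last by rewrite (negbTE ki).
  by apply/orP; left; apply/lexP; exists i.
by apply/orP; right; apply/lexP; exists i; split => // j /eqj.
Qed.

Lemma lexD2r k k1 k2 : lex k1 k2 -> lex (fun j => k1 j + k j) (fun j => k2 j + k j).
Proof.
move=> /lexP[i [H1 H2]]; apply/lexP; exists i; split; last by rewrite ltrD2r.
by move=> j /H1 ->.
Qed.

Lemma lexD2l k k1 k2 : lex k1 k2 -> lex (fun j => k j + k1 j) (fun j => k j + k2 j).
Proof.
move=> /lexP[i [H1 H2]]; apply/lexP; exists i; split; last by rewrite ltrD2l.
by move=> j /H1 ->.
Qed.

Definition exponent e : 'I_n -> int := fun j => (e j)%:Z.

Lemma exponent_shift e k : shiftable e k -> exponent (shift e k) = fun j => exponent e j + k j.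
Proof.
by move=> /forallP ek; apply/funext => j; rewrite /exponent ffunE gez0_abs.
Qed.

Lemma shift_add e k (g : {ffun 'I_n -> nat}) : shiftable e k ->
  shift [ffun j => e j + g j]%N k = [ffun j => shift e k j + g j]%N.
Proof.
move=> /forallP ek; apply/ffunP => j; rewrite !ffunE.
have := ek j; lia.
Qed.

Lemma lex_max (A : Type) (d : A -> 'I_n -> int) (s : seq A) : (0 < size s)%N ->
  exists k, has (fun x => eqdeg (d x) k) s && all (fun x => eqdeg (d x) k || lex (d x) k) s.
Proof.
elim: s => // x [_ _|y s IH _].
  by exists (d x); rewrite /= (introT (eqdegP _ _)).
have [k /andP[hk ak]] := IH isT.
have /or3P[/eqdegP xk|xk|kx] := lex_total (d x) k.
- exists k; apply/andP; split; first by apply/orP; left; apply/eqdegP.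
  by apply/andP; split => //; rewrite (introT (eqdegP _ _)).
- exists k; apply/andP; split; first by apply/orP; right.
  by apply/andP; split => //; rewrite xk orbT.
- exists (d x); apply/andP; split; first by apply/orP; left; apply/eqdegP.
  apply/andP; split; first by rewrite (introT (eqdegP _ _)).
  apply: sub_all ak => z /orP[/eqdegP ->|zk]; first by rewrite kx orbT.
  by rewrite (lex_trans zk kx) orbT.
Qed.

End lexicographic.

(** * Decomposition of a symbol into homogeneous components *)

Section hom_decomposition.
Variables (R : realType) (n : nat).
Local Notation C := R[i].
Local Notation mu := (lebesgue_Cn R n).
Variable Om : set 'rV[C]_n.
Hypotheses (oOm : open Om) (rOm : reinhardt Om).
Let mOm : measurable Om := open_measurable_Cn oOm.
Local Notation hom_fun := (hom_fun Om).
Implicit Types (p : hom_fun) (s : seq hom_fun).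

Lemma polar (c : C) : exists t : R, c = (cabs c)%:C * expi t.
Proof.
have [->|c0] := eqVneq c 0; first by exists 0; rewrite cabs0 mul0r.
have cc : (cabs c)%:C != 0 by rewrite -normc_cabs normr_eq0.
have [t ct] : exists t : R, c / (cabs c)%:C = expi t.
  apply: unit_expi; rewrite cabsM cabsV cabs_real ger0_norm ?cabs_ge0//.
  by rewrite divff// cabs_eq0.
by exists t; rewrite -ct mulrC divfK.
Qed.

Lemma quasi_homogeneous_hom (q : 'rV[C]_n -> C) : bounded_quasi_homogeneous Om q ->
  exists p : hom_fun, {ae mu, forall z, Om z -> q z = p z}.
Proof.
move=> [[f [k fk]] [e [er He]] [g mg qg]].
have [B B0 qB] : exists2 B : R, 0 <= B & forall z, Om z -> cabs (q z) <= B.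
  pose B := `|complex.Re e| + 1; exists B; first by rewrite addr_ge0.
  move=> z Oz; rewrite -lecR -normc_cabs; apply: He => //.
  by rewrite -(RRe_real er) ltcR (le_lt_trans (ler_norm _))// ltrDl.
have hq : ae_homogeneous Om k q.
  move=> th; apply: aeW => z Oz.
  have [t zt] : exists t : 'I_n -> R, forall j, z 0 j = (cabs (z 0 j))%:C * expi (t j).
    by exists (fun j => sval (cid (polar (z 0 j)))) => j; case: cid.
  pose r : 'rV[R]_n := \row_j cabs (z 0 j).
  have r0 j : 0 <= r 0 j by rewrite mxE cabs_ge0.
  have zE : z = \row_j ((r 0 j)%:C * expi (t j)) by apply/rowP => j; rewrite !mxE.
  have zE' : rotate th z = \row_j ((r 0 j)%:C * expi (th j + t j)).
    by apply/rowP => j; rewrite !mxE {1}zt expiD mulrCA.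
  have Oz' : Om (rotate th z) by exact: rOm.
  have := fk r _ r0; rewrite /= => fk'.
  have qz : q z = f r * expi (\sum_j (k j)%:~R * t j) by rewrite {1}zE fk' -?zE.
  have -> : q (rotate th z) = f r * expi (\sum_j (k j)%:~R * (th j + t j)).
    by rewrite {1}zE' fk' -?zE'.
  rewrite qz mulrCA -expiD -big_split /=.
  by congr (_ * expi _); apply: eq_bigr => j _; rewrite mulrDr.
(* The Borel representative [g] is cut off where it exceeds the bound of [q], which happens only on
   a null set; homogeneity is inherited from [q]. *)
pose S := Om `&` (fun z => cabs (g z) ^+ 2) @^-1` `]-oo, B ^+ 2].
have mS : measurable S by apply: measurable_cabs_sqr.
pose p z : C := (\1_S z : R)%:C * g z.
have mp : measurable_fun Om p.
  apply: measurable_funM_complex => //.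
  apply/measurable_fun_complexP => //; split => /=; last exact: measurable_cst.
  by apply: measurable_funTS; exact: measurable_indic.
have pB z : Om z -> cabs (p z) <= B.
  move=> Oz; rewrite cabsM cabs_real indicE; case: (boolP (z \in S)) => [|_].
    rewrite inE normr1 mul1r => -[_]; rewrite /= in_itv/=.
    by rewrite ler_sqr ?nnegrE ?cabs_ge0.
  by rewrite normr0 mul0r.
have qp : {ae mu, forall z, Om z -> q z = p z}.
  apply: filterS qg => z Hz Oz; rewrite /p indicE mem_set ?mul1r ?Hz//; split => //=.
  by rewrite in_itv/= ler_sqr ?nnegrE ?cabs_ge0// -Hz// qB.
by exists (HomFun mp (ex_intro2 _ _ B B0 pB) (eq_ae_homogeneous rOm qp hq)).
Qed.

Lemma sum_hom (I : Type) (r : seq I) (q : I -> 'rV[C]_n -> C) :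
  (forall l, bounded_quasi_homogeneous Om (q l)) ->
  exists s, {ae mu, forall z, Om z -> \sum_(l <- r) q l z = \sum_(p <- s) p z}.
Proof.
move=> hq; elim: r => [|l r [s Hs]]; first by exists [::]; apply: aeW => z _; rewrite !big_nil.
have [p qp] := quasi_homogeneous_hom (hq l); exists (p :: s).
by apply: filterS2 qp Hs => z H1 H2 Oz; rewrite !big_cons H1// H2.
Qed.

Lemma sum_same_degree (k : 'I_n -> int) s : all (fun p => eqdeg (degree p) k) s ->
  exists p, degree p = k /\ forall z, p z = \sum_(r <- s) r z.
Proof.
elim: s => [_|q s IH /= /andP[/eqdegP qk /IH[p [pk ps]]]].
  have m0 : measurable_fun Om (fun=> 0 : C) by [].
  have b0 : exists2 B : R, 0 <= B & forall z, Om z -> cabs ((fun=> 0 : C) z) <= B.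
    by exists 0 => // z _; rewrite cabs0.
  have h0 : ae_homogeneous Om k (fun=> 0) by move=> th; apply: aeW => z _; rewrite mulr0.
  by exists (HomFun m0 b0 h0); split => // z; rewrite big_nil.
have mq := measurable_funD_complex mOm (hom_measurable q) (hom_measurable p).
have bq : exists2 B : R, 0 <= B & forall z, Om z -> cabs (q z + p z) <= B.
  have [B B0 HB] := hom_bounded q; have [B' B'0 HB'] := hom_bounded p.
  exists (B + B'); first exact: addr_ge0.
  by move=> z Oz; rewrite (le_trans (cabsD _ _))// lerD ?HB ?HB'.
have hq : ae_homogeneous Om k (fun z => q z + p z).
  apply: ae_homogeneousD; first by rewrite -qk; exact: hom_homogeneous.
  by rewrite -pk; exact: hom_homogeneous.
by exists (HomFun mq bq hq); split => // z; rewrite big_cons -ps.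
Qed.

(** All terms of the largest degree are added up. If their sum is zero almost everywhere it is
    dropped, and the list gets shorter. *)
Lemma leading_component s :
  ~ {ae mu, forall z, Om z -> \sum_(p <- s) p z = 0} ->
  exists psi rest, [/\ ~ {ae mu, forall z, Om z -> (psi : hom_fun) z = 0},
    {ae mu, forall z, Om z -> \sum_(p <- s) p z = \sum_(p <- psi :: rest) p z} &
    all (fun p => lex (degree p) (degree psi)) rest].
Proof.
elim: {s}(size s) {-2}s (leqnn (size s)) => [|N IH] s.
  by rewrite leqn0 => /eqP/size0nil -> []; apply: aeW => z _; rewrite big_nil.
move=> sN s0; have [s_gt0|] := ltnP 0 (size s); last first.
  by rewrite leqn0 => /eqP/size0nil s_nil; case: s0; apply: aeW => z _; rewrite s_nil big_nil.
have [k /andP[hk ak]] := lex_max (@degree _ _ _) s_gt0.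
pose a p := eqdeg (degree p) k.
have [psi [psik psiE]] : exists p, degree p = k /\ forall z, p z = \sum_(r <- seq.filter a s) r z.
  by apply: sum_same_degree; exact: filter_all.
have sE z : \sum_(p <- s) p z = psi z + \sum_(p <- seq.filter (predC a) s) p z.
  by rewrite (bigID a)/= psiE !big_filter.
have [psi0|] := pselect {ae mu, forall z, Om z -> psi z = 0}; last first.
  move=> psi0; exists psi, (seq.filter (predC a) s); split => //.
    by apply: aeW => z _; rewrite sE big_cons.
  rewrite psik; elim: (s) ak => //= p s' IHs /andP[/orP[|] pk /IHs ak'].
    by rewrite /a pk.
  by case: ifP => // _ /=; rewrite pk.
have sE' : {ae mu, forall z, Om z ->
    \sum_(p <- s) p z = \sum_(p <- seq.filter (predC a) s) p z}.
  by apply: filterS psi0 => z H Oz; rewrite sE H// add0r.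
have [||psi' [rest [H1 H2 H3]]] := IH (seq.filter (predC a) s).
- rewrite -ltnS (leq_trans _ sN)// size_filter -(count_predC a s).
  by rewrite -[X in (X < _)%N]add0n ltn_add2r -has_count.
- move=> H; apply: s0; apply: filterS2 H sE' => z H1 H2 Oz.
  by rewrite H2// H1.
exists psi', rest; split => //.
by apply: filterS2 sE' H2 => z E1 E2 Oz; rewrite E1// E2.
Qed.

End hom_decomposition.

(** * The leading coefficient of the product *)

Section leading_term.
Variables (R : realType) (n : nat).
Local Notation C := R[i].
Local Notation mu := (lebesgue_Cn R n).
Local Notation expo := {ffun 'I_n -> nat}.
Variable Om : set 'rV[C]_n.
Hypotheses (oOm : open Om) (rOm : reinhardt Om) (cOm : connected Om) (neOm : Om !=set0).
Hypotheses (bOm : bounded_set Om).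
Let mOm : measurable Om := open_measurable_Cn oOm.
Local Notation hom_fun := (hom_fun Om).

Lemma all_allpairs (A B D : Type) (P : pred D) (a : pred A) (b : pred B) (f : A -> B -> D) s t :
  all a s -> all b t -> (forall x y, a x -> b y -> P (f x y)) -> all P [seq f x y | x <- s, y <- t].
Proof.
move=> + bt H; elim: s => //= x s IH /andP[ax /IH {}IH]; rewrite all_cat IH andbT all_map.
by apply: sub_all bt => y; exact: H.
Qed.

Definition degree_le K (p : hom_fun) := [forall j, (absz (degree p j) <= K)%N].

Definition exponent_ge N (e : expo) := [forall j, (N <= e j)%N].

Variables (I : eqType) (phi : I -> 'rV[C]_n -> C) (psi : I -> hom_fun) (rest : I -> seq hom_fun).
Variable K : nat.
Hypothesis phiE : forall j,
  {ae mu, forall z, Om z -> phi j z = \sum_(p <- psi j :: rest j) p z}.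
Hypothesis rest_lex : forall j, all (fun p => lex (degree p) (degree (psi j))) (rest j).
Hypothesis degK : forall j, all (degree_le K) (psi j :: rest j).

(** Each index is paired with the leading exponent just before its operator acts. *)
Fixpoint visits (J : seq I) (e : expo) : seq (I * expo) :=
  if J is j :: J' then (j, e) :: visits J' (shift e (degree (psi j))) else [::].

Let shiftable_ge N e p : exponent_ge (N + K) e -> degree_le K p -> shiftable e (degree p).
Proof.
move=> /forallP eN /forallP pK; apply/forallP => j.
by have := eN j; have := pK j; lia.
Qed.

Let shift_ge N e p : exponent_ge (N + K) e -> degree_le K p -> exponent_ge N (shift e (degree p)).
Proof.
move=> /forallP eN /forallP pK; apply/forallP => j; rewrite ffunE.
by have := eN j; have := pK j; lia.
Qed.

(** A symbol lowers an exponent by at most [K], so a reserve of [K] per remaining symbol keeps all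
    exponents nonnegative. *)
Lemma visits_shiftable J e : exponent_ge (size J * K) e ->
  all (fun x => shiftable x.2 (degree (psi x.1))) (visits J e).
Proof.
elim: J e => //= j J IH e; rewrite mulSn addnC => eJ.
have /= /andP[pK _] := degK j.
by rewrite (shiftable_ge eJ pK) IH//; exact: shift_ge.
Qed.

Lemma visits_add J e (g : expo) : exponent_ge (size J * K) e ->
  visits J [ffun j => e j + g j]%N = [seq (x.1, [ffun j => x.2 j + g j]%N : expo) | x : I * expo <- visits J e].
Proof.
elim: J e => //= j J IH e; rewrite mulSn addnC => eJ.
have /= /andP[pK _] := degK j.
by rewrite shift_add ?(shiftable_ge eJ pK)// IH//; exact: shift_ge.
Qed.

(** The new tail [T1] consists of [psi j] acting on the old tail and of [rest j] acting on
    everything; each of its exponents is strictly below the new leading one. *)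
Lemma toeplitz_leading J g c (e : expo) (T : seq (C * expo)) :
  exponent_ge (size J * K) e -> all (fun t => exponent_ge (size J * K) t.2) T ->
  all (fun t => lex (exponent t.2) (exponent e)) T ->
  (forall z, Om z -> g z = polyf ((c, e) :: T) z) ->
  exists e' T', all (fun t => lex (exponent t.2) (exponent e')) T' /\
    forall z, Om z -> foldl (fun g j => toeplitz Om (phi j) g) g J z =
      polyf ((c * \prod_(x <- visits J e) shift_coef (psi x.1) x.2, e') :: T') z.
Proof.
elim: J g c e T => [|j J IH] g c e T; first by move=> _ _ T1 gT; exists e, T; rewrite big_nil mulr1.
rewrite [size _]/= mulSn addnC => eJ TJ Te gT.
have /= /andP[pK rK] := degK j.
have sT : all (fun p => all (fun t => shiftable t.2 (degree p)) ((c, e) :: T)) (psi j :: rest j).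
  apply: sub_all (degK j) => p pK'; rewrite /= (shiftable_ge eJ pK')/=.
  by apply: sub_all TJ => t tJ; exact: shiftable_ge tJ pK'.
have tg := toeplitz_polyf oOm rOm cOm neOm bOm (phiE j) gT sT.
set e1 := shift e (degree (psi j)).
pose sh (p : hom_fun) (t : C * expo) := (t.1 * shift_coef p t.2, shift t.2 (degree p)).
pose T1 := [seq sh (psi j) t | t <- T] ++ [seq sh p t | p <- rest j, t <- (c, e) :: T].
have [||| e' [T' [T'lex T'E]]] := IH (toeplitz Om (phi j) g) (c * shift_coef (psi j) e) e1 T1 _ _ _ tg.
- exact: shift_ge.
- rewrite all_cat all_map; apply/andP; split.
    by apply: sub_all TJ => t tJ; exact: shift_ge tJ pK.
  have eTJ : all (fun t : C * expo => exponent_ge (size J * K + K) t.2) ((c, e) :: T).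
    by rewrite /= eJ.
  by apply: (all_allpairs rK eTJ) => p t pK' tJ; exact: shift_ge tJ pK'.
- have lexT t : exponent_ge (size J * K + K) t.2 -> lex (exponent t.2) (exponent e) ->
      lex (exponent (shift t.2 (degree (psi j)))) (exponent e1).
    move=> tJ te; rewrite (exponent_shift (shiftable_ge tJ pK)).
    by rewrite (exponent_shift (shiftable_ge eJ pK)); exact: lexD2r.
  rewrite all_cat all_map; apply/andP; split.
    elim: (T) TJ Te => //= t T2 IHT /andP[tJ TJ] /andP[te Te].
    by rewrite lexT// IHT.
  (* Equality with [e] is allowed here, since a degree from [rest j] is already strictly smaller. *)
  pose b (t : C * expo) := exponent_ge (size J * K + K) t.2 &&
    (eqdeg (exponent t.2) (exponent e) || lex (exponent t.2) (exponent e)).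
  have bT : all b ((c, e) :: T).
    rewrite /= /b eJ /= (introT (eqdegP _ _))//=.
    elim: (T) TJ Te => //= t T2 IHT /andP[tJ TJ] /andP[te Te].
    by rewrite tJ te orbT IHT.
  pose a (p : hom_fun) := degree_le K p && lex (degree p) (degree (psi j)).
  have ar : all a (rest j).
    elim: (rest j) rK (rest_lex j) => //= p r IHr /andP[pK' rK'] /andP[pl rl].
    by rewrite /a pK' pl IHr.
  apply: (all_allpairs ar bT) => p t /andP[pK' pl] /andP[tJ tl].
  rewrite /sh /= (exponent_shift (shiftable_ge eJ pK)) (exponent_shift (shiftable_ge tJ pK')).
  have l1 : lex (fun i => exponent e i + degree p i) (fun i => exponent e i + degree (psi j) i).
    exact: lexD2l.
  move: tl => /orP[/eqdegP ->//|tl].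
  by apply: lex_trans l1; exact: lexD2r.
exists e', T'; split=> // z Oz; rewrite [foldl _ _ _]/= T'E//.
by rewrite [visits _ _]/= big_cons mulrA.
Qed.

Lemma toeplitz_product_leading J (e : expo) : exponent_ge (size J * K) e ->
  (forall z, Om z -> foldl (fun g j => toeplitz Om (phi j) g) (polyf [:: (1, e)]) J z = 0) ->
  exists2 x, x \in visits J e & shift_coef (psi x.1) x.2 = 0.
Proof.
move=> eJ g0.
have [e' [T' [T'lex T'E]]] := @toeplitz_leading J (polyf [:: (1, e)]) 1 e [::] eJ isT isT (fun _ _ => erefl).
have : 1 * \prod_(x <- visits J e) shift_coef (psi x.1) x.2 = 0.
  apply: (polyf_coef oOm rOm neOm bOm (e := e') (T := T')).
    move=> t tT; apply/eqP => te; move/allP: T'lex => /(_ t tT).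
    by rewrite te lex_irr.
  by move=> z Oz; rewrite -T'E// g0.
rewrite mul1r => /eqP; rewrite prodf_seq_eq0 => /hasP[x xv /eqP x0].
by exists x.
Qed.

End leading_term.

(** * Real weights and the conclusion *)

Section weights.
Variables (R : realType) (n : nat).
Local Notation C := R[i].
Local Notation mu := (lebesgue_Cn R n).
Local Notation expo := {ffun 'I_n -> nat}.
Variable Om : set 'rV[C]_n.
Hypotheses (oOm : open Om) (rOm : reinhardt Om) (neOm : Om !=set0).
Hypotheses (bOm : bounded_set Om).
Let mOm : measurable Om := open_measurable_Cn oOm.

(** [W = p z^e conj(z^e')] is rotation invariant, and adding [g] to both exponents multiplies it by
    [|z|^(2g)]. If the coefficient vanishes, so do the moments of its real and imaginary parts; a
    part that is not null serves as the weight. *)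
Lemma real_weight (p : hom_fun Om) (e : expo) : shiftable e (degree p) ->
  ~ {ae mu, forall z, Om z -> p z = 0} ->
  exists w : 'rV[C]_n -> R, [/\ bounded_measurable_on Om w,
    exists g : nat -> nat,
      \int[mu]_(z in Om) (w z * \prod_(j < n) (cabs (z 0 j) ^+ 2) ^+ (g j).+1) != 0 &
    forall g : nat -> nat, shift_coef p [ffun j => e j + g j]%N = 0 ->
      \int[mu]_(z in Om) (w z * \prod_(j < n) (cabs (z 0 j) ^+ 2) ^+ g j) = 0].
Proof.
move=> ek p0; set e' := shift e (degree p).
pose W z := p z * (mon e z * conjc (mon e' z)).
have mW : measurable_fun Om W.
  apply: measurable_funM_complex => //; first exact: hom_measurable.
  apply: measurable_funM_complex => //; first exact: measurable_mon.
  by apply: measurable_fun_conjc => //; exact: measurable_mon.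
have [B WB] : exists B : R, forall z, Om z -> cabs (W z) <= B.
  have [B B0 HB] := hom_bounded p; have [D D0 HD] := mon_bounded e bOm.
  have [D' D'0 HD'] := mon_bounded e' bOm; exists (B * (D * D')) => z Oz.
  by rewrite cabsM ler_pM ?cabs_ge0 ?HB// cabsM ler_pM ?cabs_ge0 ?cabsJ ?HD ?HD'.
have W0 : ~ {ae mu, forall z, Om z -> W z = 0}.
  move=> W0; apply: p0; apply: filterS2 W0 (ae_nonzero_coords R n) => z Wz nz Oz.
  have /eqP := Wz Oz; rewrite /W !mulf_eq0 (negbTE (mon_neq0 e nz)) /=.
  by rewrite -[conjc _ == 0]cabs_eq0 cabsJ cabs_eq0 (negbTE (mon_neq0 e' nz)) orbF => /eqP.
have hW : ae_homogeneous Om (fun=> 0) W.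
  have := ae_homogeneousM (hom_homogeneous p) (ae_homogeneousM (ae_homogeneous_mon Om e)
    (ae_homogeneous_conjc (ae_homogeneous_mon Om e'))).
  congr (ae_homogeneous _ _ _); apply/funext => j.
  have := congr1 (fun f => f j) (exponent_shift ek); rewrite /exponent => ->.
  by rewrite opprD addrCA addrA addrA; ring.
have [mr mi] := (measurable_fun_complexP _ mOm).1 mW.
have inv (q : C -> R) : ae_homogeneous Om (fun=> 0) (fun z => (q (W z))%:C).
  move=> th; apply: filterS (hW th) => z Hz Oz; rewrite Hz//.
  by rewrite big1 ?expi0 ?mul1r// => j _; rewrite mul0r.
have coef0 (g : nat -> nat) : shift_coef p [ffun j => e j + g j]%N = 0 ->
    Cintegral Om (fun z => W z * (\prod_(j < n) (cabs (z 0 j) ^+ 2) ^+ g j)%:C) = 0.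
  set eg : expo := [ffun j => _]; pose gg : expo := [ffun j : 'I_n => g j].
  have egE : eg = [ffun j => e j + gg j]%N by apply/ffunP => j; rewrite !ffunE.
  move=> /eqP; rewrite /shift_coef mulf_eq0 invr_eq0.
  rewrite (negbTE (L2_dot_mon_neq0 oOm bOm _ neOm)) orbF => /eqP <-.
  apply: eq_Cintegral => z _; rewrite egE shift_add// -/e' /W.
  have monD (f h : expo) : mon [ffun j => f j + h j]%N z = mon f z * mon h z.
    by rewrite /mon -big_split; apply: eq_bigr => j _; rewrite ffunE exprD.
  have -> : (\prod_(j < n) (cabs (z 0 j) ^+ 2) ^+ g j)%:C = mon gg z * conjc (mon gg z).
    rewrite mul_conjc_cabs /mon cabs_prod -prodrXl; congr (_%:C).
    by apply: eq_bigr => j _; rewrite ffunE cabsX -!exprM mulnC.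
  rewrite !monD.
  have -> : conjc (mon e' z * mon gg z) = conjc (mon e' z) * conjc (mon gg z).
    exact: (rmorphM (@conjc R)).
  by ring.
have [Wr0|Wr0] := pselect {ae mu, forall z, Om z -> complex.Re (W z) = 0}; last first.
  have bw : bounded_measurable_on Om (fun z => complex.Re (W z)).
    by split=> //; exists B => z Oz; rewrite (le_trans (Re_le_cabs _))// WB.
  exists (fun z => complex.Re (W z)); split=> //.
    apply: contrapT => H; apply: Wr0; apply: (radial_moments_eq0 oOm rOm bOm bw (inv _)) => g.
    by apply/eqP/negPn/negP => g0; apply: H; exists g.
  move=> g /coef0 /(congr1 (@complex.Re R)) /= H; rewrite -[RHS]H.
  by apply: eq_Rintegral => z _; case: (W z) => x y /=; rewrite mulr0 subr0.
have bw : bounded_measurable_on Om (fun z => complex.Im (W z)).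
  by split=> //; exists B => z Oz; rewrite (le_trans (Im_le_cabs _))// WB.
exists (fun z => complex.Im (W z)); split=> //.
  apply: contrapT => H; apply: W0.
  have Wi0 : {ae mu, forall z, Om z -> complex.Im (W z) = 0}.
    apply: (radial_moments_eq0 oOm rOm bOm bw (inv _)) => g.
    by apply/eqP/negPn/negP => g0; apply: H; exists g.
  apply: filterS2 Wr0 Wi0 => z Hr Hi Oz.
  by apply/eqP; rewrite eq_complex Hr// Hi// !eqxx.
move=> g /coef0 /(congr1 (@complex.Im R)) /= H; rewrite -[RHS]H.
by apply: eq_Rintegral => z _; case: (W z) => x y /=; rewrite mulr0 add0r.
Qed.

End weights.

Lemma degree_bounded (R : realType) n (Om : set 'rV[R[i]]_n) (s : seq (hom_fun Om)) :
  exists K, all (degree_le K) s.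
Proof.
elim: s => [|p s [K sK]]; first by exists 0%N.
exists (maxn (\max_j absz (degree p j)) K); apply/andP; split.
  by apply/forallP => j; rewrite leq_max (leq_bigmax (F := fun j => absz (degree p j)) j).
by apply: sub_all sK => q /forallP qK; apply/forallP => j; rewrite leq_max qK orbT.
Qed.

Theorem theorem1 (R : realType) (n : nat) (Om : set 'rV[R[i]]_n) (m : nat)
    (phi : 'I_m -> 'rV[R[i]]_n -> R[i]) :
  domain Om -> bounded_set Om -> reinhardt Om ->
  (forall j, sum_of_quasi_homogeneous Om (phi j)) ->
  (forall f, bergman_space Om f ->
    forall z, Om z -> toeplitz_product Om phi f z = 0) ->
  exists j, {ae lebesgue_Cn R n, forall z, Om z -> phi j z = 0}.
Proof.
move=> [neOm cOm oOm] bOm rOm hphi T0; apply: contrapT => nphi.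
have mOm := open_measurable_Cn oOm.
pose mu := lebesgue_Cn R n.
have lead j : exists x : hom_fun Om * seq (hom_fun Om),
    [/\ ~ {ae mu, forall z, Om z -> x.1 z = 0},
      {ae mu, forall z, Om z -> phi j z = \sum_(p <- x.1 :: x.2) p z} &
      all (fun p => lex (degree p) (degree x.1)) x.2].
  have [N [q [hq phiq]]] := hphi j.
  have [s qs] := sum_hom oOm rOm (index_enum 'I_N) hq.
  have phis : {ae mu, forall z, Om z -> phi j z = \sum_(p <- s) p z}.
    by apply: filterS qs => z H Oz; rewrite phiq// H.
  have [|psi [rest [psi0 sE lt]]] := @leading_component R n Om oOm s.
    move=> s0; apply: nphi; exists j; apply: filterS2 phis s0 => z H1 H2 Oz.
    by rewrite H1// H2.
  exists (psi, rest); split => //.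
  by apply: filterS2 phis sE => z H1 H2 Oz; rewrite H1// H2.
pose psi j := (sval (cid (lead j))).1.
pose rest j := (sval (cid (lead j))).2.
have psi0 j : ~ {ae mu, forall z, Om z -> psi j z = 0}.
  by rewrite /psi; case: cid => x [].
have phiE j : {ae mu, forall z, Om z -> phi j z = \sum_(p <- psi j :: rest j) p z}.
  by rewrite /psi /rest; case: cid => x [].
have rest_lex j : all (fun p => lex (degree p) (degree (psi j))) (rest j).
  by rewrite /psi /rest; case: cid => x [].
have [K degK] : exists K, forall j, all (degree_le K) (psi j :: rest j).
  exists (\max_j sval (cid (degree_bounded (psi j :: rest j)))) => j.
  have := svalP (cid (degree_bounded (psi j :: rest j))).
  apply: sub_all => p /forallP pK; apply/forallP => i; apply: (leq_trans (pK i)).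
  exact: (leq_bigmax (F := fun j => sval (cid (degree_bounded (psi j :: rest j)))) j).
(* A reserve of [K] per symbol. It fixes the weights once and for all, and any [g] may still be
   added. *)
pose e0 : {ffun 'I_n -> nat} := [ffun=> size (enum 'I_m) * K]%N.
have e0K (g : 'I_n -> nat) : exponent_ge (size (enum 'I_m) * K) [ffun j => e0 j + g j]%N.
  by apply/forallP => j; rewrite !ffunE leq_addr.
have e0K' : exponent_ge (size (enum 'I_m) * K) e0 by apply/forallP => j; rewrite ffunE.
pose V := visits psi (enum 'I_m) e0.
have Vs := allP (visits_shiftable degK e0K').
have weight x : exists w : 'rV[R[i]]_n -> R, x \in V ->
    [/\ bounded_measurable_on Om w,
    exists g : nat -> nat,
      \int[mu]_(z in Om) (w z * \prod_(j < n) (cabs (z 0 j) ^+ 2) ^+ (g j).+1) != 0 &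
    forall g : nat -> nat, shift_coef (psi x.1) [ffun j => x.2 j + g j]%N = 0 ->
      \int[mu]_(z in Om) (w z * \prod_(j < n) (cabs (z 0 j) ^+ 2) ^+ g j) = 0].
  have [xV|_] := boolP (x \in V); last by exists (fun=> 0).
  have [w Hw] := real_weight oOm rOm neOm bOm (Vs x xV) (psi0 x.1).
  by exists w.
pose w x := sval (cid (weight x)).
have wP x := svalP (cid (weight x)).
have [M M0 OM] := bounded_set_cabs bOm.
have [|||| g Hg] := @multi_prod_moments_neq0 _ _ _ mu Om mOm n (M ^+ 2)
  (fun j z => cabs (z 0 j) ^+ 2) [seq w x | x <- V].
- move=> j; apply: measurable_cabs_sqr => //.
  by apply: measurable_funTS; exact: measurable_entry.
- move=> j z Oz; rewrite sqr_ge0/= ler_sqr ?nnegrE ?cabs_ge0 ?OM//.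
  exact: ltW.
- move=> _ /mapP[x xV ->]; have [bw _ _] := wP x xV.
  have := integrable_bmeas mOm (integrable_cst_domain oOm bOm 1) bw.
  by apply: eq_integrable => // z _; rewrite /= mul1r.
- by move=> _ /mapP[x xV ->]; have [_ wg _] := wP x xV.
(* No weight has a zero moment at [g], yet the product kills [z^(e0+g)], so some coefficient along
   its visits vanishes. By [visits_add] these visits are those from [e0] translated by [g], which is
   the contradiction. *)
have [|y yV y0] := @toeplitz_product_leading R n Om oOm rOm cOm neOm bOm _ phi psi rest K
  phiE rest_lex degK (enum 'I_m) [ffun j => e0 j + g j]%N (e0K g).
  by move=> z Oz; apply: T0 => //; exact: bergman_polyf.
pose gg : {ffun 'I_n -> nat} := [ffun j : 'I_n => g j].
have egE : [ffun j => e0 j + g j]%N = [ffun j => e0 j + gg j]%N.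
  by apply/ffunP => j; rewrite !ffunE.
move: yV y0; rewrite egE (visits_add degK gg e0K') => /mapP[x xV ->] /= x0.
have [_ _ wx] := wP x xV; have /negP := Hg (w x) (map_f w xV); apply; apply/eqP.
apply: wx; rewrite -[RHS]x0; congr shift_coef.
by apply/ffunP => j; rewrite !ffunE.
Qed.
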